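(* Let $n\geqslant 2$ be an integer. There exists a constant $C(n)\geqslant 0$ depending only on $n$ such that for all integers $\delta\geqslant 1$ and $s\geqslant 0$, all reduced singular hypersurfaces $X$ of degree $\delta$ of $\mathbb{P}^n_{\mathbb{Q}}$ whose singular locus is of dimension $s$, and all real $B\geqslant 1$, \[\sum_{\xi\in S(X;B)} \mu_{\xi}(X)\left(\mu_{\xi}(X)-1\right)^{n-s-1}\leqslant C(n)\,\delta^{n-s}\max\{B,\delta-1\}^{s+1}.\]
   Context: For $\xi\in\mathbb{P}^n(\mathbb{Q})$ write $\xi=[\xi_0:\cdots:\xi_n]$ with $\xi_i\in\mathbb{Z}$ and $\gcd(\xi_0,\ldots,\xi_n)=1$; its height is $H_{\mathbb{Q}}(\xi)=\max_{0\leqslant i\leqslant n}|\xi_i|$. For a closed subscheme $X$ of $\mathbb{P}^n_{\mathbb{Q}}$, $S(X;B)=\{\xi\in X(\mathbb{Q})\mid H_{\mathbb{Q}}(\xi)\leqslant B\}$. Multiplicity: for a pure dimensional scheme $X$ of finite type over a field and a point $\xi\in X$ with $\dim\mathcal{O}_{X,\xi}=t\geqslant 1$, maximal ideal $\mathfrak{m}_\xi$ and residue field $\kappa(\xi)$, for $m$ large $\dim_{\kappa(\xi)}(\mathfrak{m}_\xi^m/\mathfrak{m}_\xi^{m+1})$ is a polynomial in $m$ of the form $\mu_\xi(X)\frac{m^{t-1}}{(t-1)!}+o(m^{t-1})$; the integer $\mu_\xi(X)\geqslant 1$ is the multiplicity of $\xi$ in $X$. *)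

(* Defs.v *)
From HB Require Import structures.
From mathcomp Require Import all_boot all_order all_algebra.
From mathcomp Require Import generic_quotient ring_quotient fraction.
From mathcomp Require Import boolp classical_sets cardinality fsbigop reals.
From mathcomp Require Import mpoly ring zify.

Set Implicit Arguments.
Unset Strict Implicit.
Unset Printing Implicit Defensive.

Import Order.TTheory GRing.Theory Num.Theory.
Local Open Scope ring_scope.

Local Notation "x %:F" := (tofrac x) : ring_scope.

Section LocalRings.
Variable A : comNzRingType.

(* The nonunits: the maximal ideal when [A] is local. *)
Definition max_ideal : set A := fun a => ~ exists b, a * b = 1.

Definition ideal_mul (I J : set A) : set A := fun a =>
  exists s : seq (A * A),
    (forall p, p \in s -> I p.1 /\ J p.2) /\ a = \sum_(p <- s) p.1 * p.2.

Fixpoint ideal_pow (I : set A) (k : nat) : set A :=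
  if k is k'.+1 then ideal_mul I (ideal_pow I k') else setT.

(* [m^k / m^(k+1)] has dimension [d] over the residue field [A / m]: the
   family [e] of elements of [m^k] is a basis modulo [m^(k+1)], the scalars
   being represented by elements of [A]. *)
Definition gr_dim (k d : nat) : Prop :=
  exists e : 'I_d -> A,
    [/\ forall i, ideal_pow max_ideal k (e i),
        forall x, ideal_pow max_ideal k x -> exists a : 'I_d -> A,
          ideal_pow max_ideal k.+1 (x - \sum_i a i * e i)
      & forall a : 'I_d -> A,
          ideal_pow max_ideal k.+1 (\sum_i a i * e i) ->
          forall i, max_ideal (a i)].

Definition prime_chain (d : nat) : Prop :=
  exists P : nat -> prime_idealr A, forall i, (i < d)%N ->
    {subset P i <= P i.+1} /\ ~ {subset P i.+1 <= P i}.

Definition krull_dim (d : nat) : Prop := prime_chain d /\ ~ prime_chain d.+1.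

Definition regular_local : Prop := exists d, krull_dim d /\ gr_dim 1 d.

Definition reduced_ring : Prop := forall (a : A) k, a ^+ k = 0 -> a = 0.

Definition is_multiplicity (mu : nat) : Prop :=
  exists (t : nat) (p : {poly rat}) (N : nat),
    [/\ (1 <= t)%N, krull_dim t,
        forall m, (N <= m)%N -> exists2 d, gr_dim m d & d%:R = p.[m%:R],
        (size p <= t)%N
      & p`_t.-1 = mu%:R / (t.-1)`!%:R].

Definition multiplicity : nat := xget 0%N is_multiplicity.

End LocalRings.

(* The points of the scheme P^n over Q: homogeneous prime ideals of
   Q[T_0, ..., T_n] that do not contain all the T_i. *)
Record projpoint (n : nat) := ProjPoint {
  point_ideal :> prime_idealr {mpoly rat[n.+1]};
  point_homog : forall g, g \in point_ideal ->
    forall d, pihomog mdeg d g \in point_ideal;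
  point_relevant : exists i, 'X_i \notin point_ideal }.

(* The points of the closed subscheme of P^n defined by [f = 0]. *)
Record hypoint (n : nat) (f : {mpoly rat[n.+1]}) := HyPoint {
  hypoint_point :> projpoint n;
  hypoint_on : f \in point_ideal hypoint_point }.

Section ProjectiveStalk.
Variables (n : nat) (x : projpoint n).
Local Notation K := {fraction {mpoly rat[n.+1]}}.

Definition stalk_pred : {pred K} := fun z =>
  `[< exists d (g h : {mpoly rat[n.+1]}),
      [/\ g \is d.-homog, h \is d.-homog, h \notin point_ideal x
        & z = g%:F / h%:F] >].

Lemma notin_point_neq0 h : h \notin point_ideal x -> h != 0.
Proof. by apply: contraNneq => ->; rewrite idealr0. Qed.

Lemma stalk_subring_closed : subring_closed stalk_pred.
Proof.
split.
- apply/asboolP; exists 0%N, 1, 1; split; rewrite ?dhomog1 ?idealr1 //.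
  by rewrite divff // tofrac_eq0 oner_eq0.
- move=> _ _ /asboolP[d [g [h [hg hh hP ->]]]] /asboolP[e [g' [h' [hg' hh' hP' ->]]]].
  apply/asboolP; exists (d + e)%N, (g * h' - h * g'), (h * h'); split.
  + by rewrite rpredB // dhomogM.
  + exact: dhomogM.
  + by rewrite prime_idealrM negb_or hP.
  + have /negPf h0 := notin_point_neq0 hP; have /negPf h0' := notin_point_neq0 hP'.
    rewrite rmorphB !rmorphM /= -(mulNr g'%:F) addf_div ?tofrac_eq0 ?h0 ?h0' //.
    by rewrite mulNr [g'%:F * _]mulrC.
- move=> _ _ /asboolP[d [g [h [hg hh hP ->]]]] /asboolP[e [g' [h' [hg' hh' hP' ->]]]].
  apply/asboolP; exists (d + e)%N, (g * g'), (h * h'); split.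
  + exact: dhomogM.
  + exact: dhomogM.
  + by rewrite prime_idealrM negb_or hP.
  + by rewrite !rmorphM /= mulf_div.
Qed.

HB.instance Definition _ :=
  GRing.isSubringClosed.Build K stalk_pred stalk_subring_closed.

(* The local ring of P^n at [x], as the ring of degree zero fractions whose
   denominator does not vanish at [x]. *)
Record proj_stalk := ProjStalk { stalk_val :> K; _ : stalk_val \in stalk_pred }.
HB.instance Definition _ := [isSub for stalk_val].
HB.instance Definition _ := [Choice of proj_stalk by <:].
HB.instance Definition _ := [SubChoice_isSubComNzRing of proj_stalk by <:].

End ProjectiveStalk.

Section HypersurfaceStalk.
Variables (n : nat) (f : {mpoly rat[n.+1]}) (x : hypoint f).

Definition hyp_ideal : {pred proj_stalk x} := fun z =>
  `[< exists d (g h : {mpoly rat[n.+1]}),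
      [/\ f * g \is d.-homog, h \is d.-homog, h \notin point_ideal x
        & val z = (f * g)%:F / h%:F] >].

Lemma hyp_ideal_closed : idealr_closed hyp_ideal.
Proof.
split.
- apply/asboolP; exists 0%N, 0, 1; split; rewrite ?dhomog1 ?idealr1 //.
    by rewrite mulr0 rpred0.
  by rewrite mulr0 rmorph0 mul0r.
- apply/asboolP => -[d [g [h [_ _ hP]]]] /= /esym/divr1_eq/eqP.
  rewrite tofrac_eq => /eqP e; move: hP.
  by rewrite -e mulrC idealMr // hypoint_on.
- move=> a u v /asboolP[d [g [h [hg hh hP eu]]]].
  move=> /asboolP[d' [g' [h' [hg' hh' hP' ev]]]].
  have /asboolP[e [c [k [hc hk hP'' ea]]]] := valP a.
  apply/asboolP; exists (e + d + d')%N, (c * g * h' + k * h * g'), (k * h * h').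
  split.
  + have -> : f * (c * g * h' + k * h * g') =
      c * (f * g) * h' + k * h * (f * g').
      by ring.
    by rewrite rpredD // !dhomogM.
  + by rewrite !dhomogM.
  + by rewrite !prime_idealrM !negb_or hP hP' hP''.
  + have h0 := notin_point_neq0 hP; have h0' := notin_point_neq0 hP'.
    have k0 := notin_point_neq0 hP''.
    rewrite /= [val a]ea [val u]eu [val v]ev mulf_div -!rmorphM /=.
    rewrite addf_div ?tofrac_eq0 ?mulf_neq0 // -!rmorphM -rmorphD /=.
    congr (_%:F / _).
    by ring.
Qed.

HB.instance Definition _ :=
  isIdealr.Build (proj_stalk x) hyp_ideal hyp_ideal_closed.

Definition stalk : comNzRingType := {ideal_quot hyp_ideal}.

End HypersurfaceStalk.

Definition reduced_hypersurface n (f : {mpoly rat[n.+1]}) : Prop :=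
  forall x : hypoint f, reduced_ring (stalk x).

Definition singular_point n (f : {mpoly rat[n.+1]}) (x : hypoint f) : Prop :=
  ~ regular_local (stalk x).

(* A strictly increasing chain of homogeneous primes in the singular locus is
   a strictly decreasing chain of irreducible closed subsets of that locus,
   namely the closures of the corresponding points. *)
Definition singular_chain n (f : {mpoly rat[n.+1]}) (s : nat) : Prop :=
  exists x : nat -> hypoint f,
    (forall i, (i <= s)%N -> singular_point (x i)) /\
    (forall i, (i < s)%N -> {subset x i <= x i.+1} /\ ~ {subset x i.+1 <= x i}).

Definition singular_dim n (f : {mpoly rat[n.+1]}) (s : nat) : Prop :=
  singular_chain f s /\ ~ singular_chain f s.+1.

(* Each rational point of P^n is represented once: among its two primitive
   integral coordinate vectors, by the one whose first nonzero coordinate is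
   positive. *)
Definition primitive_coord n (xi : {ffun 'I_n.+1 -> int}) : bool :=
  (\big[gcdn/0%N]_i `|xi i|%N == 1%N) &&
  [exists i, (0 < xi i) && [forall (j : 'I_n.+1 | (j < i)%N), xi j == 0]].

Record ratpoint n := RatPoint {
  coord :> {ffun 'I_n.+1 -> int};
  _ : primitive_coord coord }.
HB.instance Definition _ n := [isSub for @coord n].
HB.instance Definition _ n := [Choice of ratpoint n by <:].

Definition height n (xi : ratpoint n) : nat := \max_i `|xi i|%N.

Section RationalPoint.
Variables (n : nat) (xi : ratpoint n).

Definition rat_coord (i : 'I_n.+1) : rat := (xi i)%:~R.

(* The kernel of Q[T_0, ..., T_n] -> Q[X], T_i |-> xi_i X; a homogeneous
   polynomial belongs to it if and only if it vanishes at xi. *)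
Definition vanishing : {pred {mpoly rat[n.+1]}} := fun g =>
  mmap (@polyC rat) (fun i => rat_coord i *: 'X) g == 0.

Local Notation phi := (mmap (@polyC rat) (fun i => rat_coord i *: 'X)).

Lemma vanishing_idealr_closed : idealr_closed vanishing.
Proof.
split.
- by rewrite unfold_in raddf0.
- by rewrite unfold_in rmorph1 oner_eq0.
- move=> a u v; rewrite !unfold_in => /eqP hu /eqP hv.
  by rewrite rmorphD rmorphM /= hu hv mulr0 addr0.
Qed.

Lemma vanishing_prime : prime_idealr_closed vanishing.
Proof. by move=> u v; rewrite !unfold_in rmorphM mulf_eq0. Qed.

HB.instance Definition _ :=
  isIdealr.Build {mpoly rat[n.+1]} vanishing vanishing_idealr_closed.
HB.instance Definition _ :=
  isPrimeIdealrClosed.Build {mpoly rat[n.+1]} vanishing vanishing_prime.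

Lemma mmap_homog d (g : {mpoly rat[n.+1]}) :
  g \is d.-homog -> phi g = g.@[rat_coord] *: 'X^d.
Proof.
move=> /dhomogP hg; rewrite /mmap mevalE scaler_suml.
rewrite big_seq [RHS]big_seq; apply: eq_bigr => m hm.
rewrite -(hg _ hm) /mmap1 mul_polyC -scalerA; congr (_ *: _).
rewrite (_ : 'X^(_) = \prod_i 'X^(m i)); last by rewrite prodrXr -mdegE.
rewrite -mul_polyC rmorph_prod -big_split /=.
by apply: eq_bigr => i _; rewrite -mul_polyC exprMn rmorphXn.
Qed.

Lemma vanishing_homogE d (g : {mpoly rat[n.+1]}) :
  g \is d.-homog -> (g \in vanishing) = (g.@[rat_coord] == 0).
Proof.
move=> hg; rewrite unfold_in (mmap_homog hg).
by rewrite scaler_eq0 -size_poly_eq0 size_polyXn orbF.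
Qed.

Lemma vanishing_homog g : g \in vanishing ->
  forall d, pihomog mdeg d g \in vanishing.
Proof.
rewrite unfold_in => /eqP g0 d.
have hd e : phi (pihomog mdeg e g) = (pihomog mdeg e g).@[rat_coord] *: 'X^e.
  by apply: mmap_homog; exact: pihomogP.
pose k := maxn (mmeasure mdeg g) d.+1.
have : phi g = 0 by [].
rewrite {1}(@pihomog_partitionE _ _ mdeg k g) ?leq_maxl //.
rewrite raddf_sum /= => /(congr1 (fun p : {poly rat} => p`_d)).
rewrite coef0 coef_sum (bigD1 (Ordinal (leq_maxr (mmeasure mdeg g) d.+1))) //=.
rewrite big1 ?addr0 => [|i hi]; last first.
  rewrite hd coefZ coefXn; case: eqP => [e|]; last by rewrite mulr0.
  by case/eqP: hi; apply: val_inj.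
rewrite hd coefZ coefXn eqxx mulr1 unfold_in hd => ->.
by rewrite scale0r.
Qed.

Lemma vanishing_relevant : exists i, 'X_i \notin vanishing.
Proof.
have /andP[_ /existsP[i /andP[hi _]]] := valP xi; exists i.
rewrite unfold_in mmapX mmap1U scaler_eq0 polyX_eq0 orbF.
by rewrite intr_eq0 gt_eqF.
Qed.

Definition projpoint_of_rat : projpoint n :=
  ProjPoint vanishing_homog vanishing_relevant.

End RationalPoint.

(* [mu_xi(X)]; it is set to 0 if [xi] does not lie on [X]. *)
Definition rat_multiplicity n (f : {mpoly rat[n.+1]}) (xi : ratpoint n) : nat :=
  match @idP (f \in point_ideal (projpoint_of_rat xi)) with
  | ReflectT xi_on_X =>
      multiplicity (stalk (@HyPoint n f (projpoint_of_rat xi) xi_on_X))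
  | ReflectF _ => 0%N
  end.

Definition bounded_points (R : realType) n (f : {mpoly rat[n.+1]}) (B : R) :
    set (ratpoint n) := fun xi =>
  f.@[rat_coord xi] = 0 /\ (height xi)%:R <= B.

Lemma finite_bounded_points (R : realType) n (f : {mpoly rat[n.+1]}) (B : R) :
  finite_set (bounded_points f B).
Proof.
pose N := Num.truncn B.
pose F (u : {ffun 'I_n.+1 -> 'I_N.*2.+1}) : {ffun 'I_n.+1 -> int} :=
  [ffun i => (u i)%:Z - N%:Z].
apply: (@sub_finite_set _ _ (@coord n @^-1` [set` codom F])%classic); last first.
  by apply: finite_preimage; [move=> ? ? _ _; exact: val_inj | exact: finite_seq].
have B0 (xi : ratpoint n) : (height xi)%:R <= B -> 0 <= B.
  exact: le_trans (ler0n _ _).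
move=> xi [_ hB] /=; apply/codomP.
have hN i : (`|xi i| <= N)%N.
  rewrite truncn_ge_nat ?(B0 xi) //; apply: le_trans hB; rewrite ler_nat.
  exact: (leq_bigmax i).
exists [ffun i => inord (absz (xi i + N%:Z)%R)]; apply/ffunP => i.
rewrite !ffunE; move: (hN i); move: (coord xi i) => z hz.
by rewrite inordK; lia.
Qed.

(* Main.v *)
Require Import Defs.
From HB Require Import structures.
From mathcomp Require Import all_boot all_order all_algebra.
From mathcomp Require Import generic_quotient ring_quotient fraction.
From mathcomp Require Import finmap.
From mathcomp Require Import boolp classical_sets cardinality fsbigop reals.
From mathcomp Require Import mpoly ring lra zify.

(** Let [c = n - s] be the codimension of the singular locus. Since the common
zeros of [f] and of its partial derivatives have codimension [c], one can choose
[c - 1] linear combinations [g_j] of the derivatives such that [f = g_j = 0] has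
codimension [c]: at each step avoid the minimal primes that do not contain all
the derivatives. A point of multiplicity [mu] on the hypersurface is a point of
multiplicity at least [mu] of [f] and [mu - 1] of each [g_j] in the affine cone.
The integral points with coordinates bounded by [b] are zeros of the polynomials
[\prod_(|k| <= b) (T_i - k)] of degree [2 b + 1], and [s + 1] general linear
combinations [h_j] of these have leading forms that complete [f, g_j] to a system
of parameters. A Bezout inequality for the [n + 1] polynomials [f, g_j, h_j] on
the affine cone then bounds the sum of [mu (mu - 1) ^ (c - 1)], up to a constant,
by the product of the degrees, [delta (delta - 1) ^ (c - 1) (2 b + 1) ^ (s + 1)].

The Bezout inequality needs no Cohen-Macaulay argument as long as a constant is
allowed: replace the polynomials by powers [G_i ^ T_i] of a common large degree,
bound the dimension of the quotient from above by the number of monomials of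
bounded degree, and bound each local contribution from below by the dimension of
the polynomials modulo a power of the maximal ideal.

Multiplicities and regularity are read off a chart [Q[z_1, ..., z_n] -> O_{X,x}]
that identifies the stalk with a localization of [Q[z] / (f)]. A point where
all the derivatives of [f] vanish is not regular: otherwise the derivations into
its residue field that kill generators of its maximal ideal would form a space
of dimension larger than the transcendence degree of that field. *)

Set Implicit Arguments.
Unset Strict Implicit.
Unset Printing Implicit Defensive.

Import Order.TTheory GRing.Theory Num.Theory.
Local Open Scope ring_scope.

(** * Linear algebra modulo a subspace *)

Section LinearAlgebraModulo.
Variables (K : fieldType) (V : lmodType K).
Implicit Types (U : V -> Prop).

Definition lin_closed U := U 0 /\ forall a u v, U u -> U v -> U (a *: u + v).

Definition indep_mod U (I : finType) (e : I -> V) :=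
  forall c : I -> K, U (\sum_i c i *: e i) -> forall i, c i = 0.

Definition spans_mod U (J : finType) (b : J -> V) (v : V) :=
  exists c : J -> K, U (v - \sum_j c j *: b j).

Lemma lin_closedD U u v : lin_closed U -> U u -> U v -> U (u + v).
Proof. by move=> [_ h] hu hv; rewrite -[u]scale1r; exact: h. Qed.

Lemma lin_closedZ U a u : lin_closed U -> U u -> U (a *: u).
Proof. by move=> [h0 h] hu; rewrite -[_ *: _]addr0; exact: h. Qed.

Lemma lin_closedN U u : lin_closed U -> U u -> U (- u).
Proof. by move=> hU hu; rewrite -scaleN1r; exact: lin_closedZ. Qed.

Lemma lin_closedB U u v : lin_closed U -> U u -> U v -> U (u - v).
Proof. by move=> hU hu hv; apply: lin_closedD => //; exact: lin_closedN. Qed.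

Lemma lin_closed_sum U (I : Type) (r : seq I) (P : pred I) (F : I -> V) :
  lin_closed U -> (forall i, P i -> U (F i)) -> U (\sum_(i <- r | P i) F i).
Proof.
move=> hU hF; elim/big_ind : _ => //; first by case: hU.
by move=> x y; exact: lin_closedD.
Qed.

Lemma lin_closed_lincomb U (I : finType) (e : I -> V) (c : I -> K) :
  lin_closed U -> (forall i, U (e i)) -> U (\sum_i c i *: e i).
Proof. by move=> hU he; apply: lin_closed_sum => // i _; exact: lin_closedZ. Qed.

(** With more [e i] than [b j], the matrix of coefficients has a nonzero row vector in its kernel,
    whose entries give a relation among the [e i] modulo [U]. *)
Lemma leq_card_indep_spans U (I J : finType) (e : I -> V) (b : J -> V) :
  lin_closed U -> indep_mod U e -> (forall i, spans_mod U b (e i)) ->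
  (#|I| <= #|J|)%N.
Proof.
move=> hU he /choice[C hC]; rewrite leqNgt; apply/negP => ltJI.
pose M := \matrix_(i < #|I|, j < #|J|) C (enum_val i) (enum_val j).
have : kermx M != 0.
  rewrite kermx_eq0 /row_free neq_ltn (leq_ltn_trans _ ltJI) //.
  exact: rank_leq_col.
case/rowV0Pn => v /sub_kermxP vM /rV0Pn[i0 vi0].
have := he (fun i => v 0 (enum_rank i)) _ (enum_val i0).
rewrite enum_valK => h; case/eqP: vi0; apply: h.
have -> : \sum_i v 0 (enum_rank i) *: e i =
    \sum_i v 0 (enum_rank i) *: (e i - \sum_j C i j *: b j).
  under [RHS]eq_bigr do rewrite scalerBr scaler_sumr.
  rewrite sumrB [X in _ - X]exchange_big /= [X in _ - X]big1 ?subr0 // => j _.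
  under eq_bigr do rewrite scalerA.
  rewrite -scaler_suml (_ : \sum_i _ = (v *m M) 0 (enum_rank j)).
    by rewrite vM mxE scale0r.
  rewrite mxE (reindex (@enum_val I predT)) /=; last exact/onW_bij/enum_val_bij.
  by apply: eq_bigr => i _; rewrite mxE enum_valK enum_rankK.
exact: lin_closed_lincomb.
Qed.

(** An independent family of maximal length spans: a vector outside its span could be appended to
    it. *)
Lemma exists_basis_mod U (m : nat) : lin_closed U ->
  (forall q (e : 'I_q -> V), indep_mod U e -> (q <= m)%N) ->
  exists q (e : 'I_q -> V), indep_mod U e /\ forall v, spans_mod U e v.
Proof.
move=> hU hm.
pose P q := `[< exists e : 'I_q -> V, indep_mod U e >].
have exP : exists q, P q.
  by exists 0%N; apply/asboolP; exists (fun=> 0) => c _ [].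
have ubP q : P q -> (q <= m)%N by move=> /asboolP[e]; exact: hm.
case: (ex_maxnP exP ubP) => q /asboolP[e he] qmax.
exists q, e; split=> // v; apply: contrapT => nv.
suff /qmax : P q.+1 by rewrite ltnn.
apply/asboolP; exists (fun i => oapp e v (unlift ord_max i)) => c hc.
rewrite (bigD1_ord ord_max) //= unlift_none /= in hc.
rewrite (eq_bigr (fun i => c (lift ord_max i) *: e i)) in hc; last first.
  by move=> i _; rewrite liftK.
have c0 : c ord_max = 0.
  apply: contrapT => /eqP c0; apply: nv.
  exists (fun i => - ((c ord_max)^-1 * c (lift ord_max i))).
  have -> : v - \sum_j - ((c ord_max)^-1 * c (lift ord_max j)) *: e j
    = (c ord_max)^-1 *: (c ord_max *: v + \sum_(i < q) c (lift ord_max i) *: e i).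
    rewrite scalerDr scalerA mulVf // scale1r scaler_sumr -sumrN.
    by congr (_ + _); apply: eq_bigr => j _; rewrite scaleNr opprK scalerA.
  exact: lin_closedZ.
rewrite c0 scale0r add0r in hc => i.
by case: (unliftP ord_max i) => [j ->|-> //]; exact: (he (fun j => c (lift ord_max j))).
Qed.

End LinearAlgebraModulo.

(** A vector space over an infinite field is not a finite union of proper subspaces. In the
    induction, a [v] that is good for the first [m] subspaces but lies in [U m] is replaced by
    [k%:R *: v + w] with [w] outside [U m]; the pigeonhole principle provides [k]. *)
Lemma subspace_avoidance (K : numFieldType) (V : lmodType K) (W : V -> Prop)
    (U : nat -> V -> Prop) (m : nat) :
  lin_closed W -> (forall i, (i < m)%N -> lin_closed (U i)) ->
  exists2 v, W v & forall i, (i < m)%N -> (exists2 w, W w & ~ U i w) -> ~ U i v.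
Proof.
move=> hW; elim: m => [|m IH] hU; first by exists 0 => //; case: hW.
have [i lt_im|v Wv hv] := IH; first by apply: hU; exact: ltnW.
have [[Umv [w Ww nUw]]|good] :=
    pselect (U m v /\ exists2 w, W w & ~ U m w); last first.
  exists v => // i; rewrite ltnS leq_eqVlt => /orP[/eqP ->|]; last exact: hv.
  by move=> hw Uv; exact: good.
have hUm := hU m (leqnn _).
pose sep i := exists2 w, W w & ~ U i w.
(* Each such [U i] contains [w + k v] for at most one [k]. *)
pose bad i (k : nat) := sep i /\ U i (k%:R *: v + w).
have bad1 i k k' : (i < m)%N -> bad i k -> bad i k' -> k = k'.
  move=> lt_im [si h] [_ h']; apply: contrapT => /eqP nk; apply: (hv i lt_im si).
  have hUi := hU i (ltnW lt_im).
  have := lin_closedZ (k%:R - k'%:R)^-1 hUi (lin_closedB hUi h h').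
  rewrite opprD addrACA subrr addr0 -scalerBl scalerA mulVf ?scale1r //.
  by rewrite subr_eq0 eqr_nat.
have [k hk] : exists k, forall i, (i < m)%N -> ~ bad i k.
  apply: contrapT => nk.
  have /choice[f hf] : forall k : nat, exists i, (i < m)%N /\ bad i k.
    move=> k; apply: contrapT => ni; apply: nk; exists k => i lt_im hi.
    by apply: ni; exists i.
  pose g (k : 'I_m.+1) : 'I_m := Ordinal (proj1 (hf k)).
  have : injective g.
    move=> k k' /(congr1 val) /= e; apply: val_inj.
    apply: (bad1 (f k)); [exact: (proj1 (hf k)) | exact: (proj2 (hf k)) |].
    by rewrite e; exact: (proj2 (hf k')).
  by move/leq_card; rewrite !card_ord ltnn.
exists (k%:R *: v + w); first by case: hW => _; apply.
move=> i; rewrite ltnS leq_eqVlt => /orP[/eqP ->|lt_im] hs h; last first.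
  by apply: (hk i lt_im).
apply: nUw.
by have := lin_closedB hUm h (lin_closedZ k%:R hUm Umv); rewrite addrAC subrr add0r.
Qed.

(** * Orders of vanishing *)

Lemma subm_diag n (m : 'X_{1..n}) : (m - m)%MM = 0%MM.
Proof. by apply/mnmP => i; rewrite mnmBE subnn mnm0E. Qed.

Section PolynomialRing.
Variables (K : fieldType) (N : nat).
Local Notation S := {mpoly K[N]}.

Lemma mpoly_ring_ind (P : S -> Prop) :
  (forall c, P c%:MP) -> (forall i, P 'X_i) ->
  (forall p q, P p -> P q -> P (p + q)) ->
  (forall p q, P p -> P q -> P (p * q)) -> forall p, P p.
Proof.
move=> PC PX PD PM p.
have Pexp q k : P q -> P (q ^+ k).
  by move=> Pq; elim: k => [|k IH]; [exact: (PC 1) | rewrite exprS; exact: PM].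
rewrite [p]mpolyE; elim/big_ind : _; [exact: (PC 0) | exact: PD |].
move=> m _; rewrite -mul_mpolyC; apply: (PM); first exact: (PC).
rewrite mpolyXE_id; elim/big_ind : _; [exact: (PC 1) | exact: PM |].
by move=> i _; exact: Pexp.
Qed.

Lemma rmorph_mpoly_eq (T : nzRingType) (f g : {rmorphism S -> T}) :
  (forall c, f c%:MP = g c%:MP) -> (forall i, f 'X_i = g 'X_i) -> f =1 g.
Proof.
move=> hC hX; apply: mpoly_ring_ind => // p q hp hq.
- by rewrite !rmorphD /= hp hq.
- by rewrite !rmorphM /= hp hq.
Qed.

Lemma mderiv_mmap M (h : 'I_N -> {mpoly K[M]}) j (p : S) :
  (mmap (@mpolyC M K) h p)^`M(j) =
  \sum_i mmap (@mpolyC M K) h p^`M(i) * (h i)^`M(j).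
Proof.
elim/mpoly_ring_ind : p => [c|k|p q IHp IHq|p q IHp IHq].
- by rewrite mmapC mderivC big1 // => i _; rewrite mderivC mmap0 mul0r.
- rewrite mmapX mmap1U (bigD1 k) //= mderivX mnm1E eqxx scale1r big1 => [|i nik].
    by rewrite subm_diag mpolyX0 rmorph1 mul1r addr0.
  by rewrite mderivX mnm1E eq_sym (negPf nik) scale0r mmap0 mul0r.
- rewrite rmorphD /= mderivD IHp IHq -big_split; apply: eq_bigr => i _ /=.
  by rewrite mderivD rmorphD /= mulrDl.
- rewrite rmorphM /= mderivM IHp IHq mulr_suml mulr_sumr -big_split /=.
  apply: eq_bigr => i _; rewrite mderivM rmorphD !rmorphM /=; ring.
Qed.

(** Membership in the [k]-th power of the ideal generated by the variables. *)
Definition ord_ge k (p : S) := forall m : 'X_{1..N}, (mdeg m < k)%N -> p@_m = 0.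

Lemma ord_ge0 p : ord_ge 0 p. Proof. by []. Qed.

Lemma ord_ge_le k l p : (k <= l)%N -> ord_ge l p -> ord_ge k p.
Proof. by move=> kl h m lt_mk; apply: h; exact: leq_trans kl. Qed.

Lemma ord_ge_lin k : lin_closed (ord_ge k).
Proof.
split=> [m _|a u v hu hv m lt_mk]; first by rewrite mcoeff0.
by rewrite mcoeffD mcoeffZ hu // hv // mulr0 addr0.
Qed.

Lemma ord_geM k l p q : ord_ge k p -> ord_ge l q -> ord_ge (k + l) (p * q).
Proof.
move=> hp hq m lt_m; rewrite mcoeffM big1 // => -[m1 m2] /= /eqP em.
have [lt1|le1] := ltnP (mdeg m1) k; first by rewrite hp // mul0r.
have [lt2|le2] := ltnP (mdeg m2) l; first by rewrite hq // mulr0.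
by have := leq_add le1 le2; rewrite -mdegD -em leqNgt lt_m.
Qed.

Lemma ord_geMl k p q : ord_ge k q -> ord_ge k (p * q).
Proof. by rewrite -[k]add0n; exact: ord_geM. Qed.

Lemma ord_geX k e p : ord_ge k p -> ord_ge (k * e) (p ^+ e).
Proof.
move=> hp; elim: e => [|e IH]; first by rewrite muln0.
by rewrite exprS mulnS; exact: ord_geM.
Qed.

Lemma ord_ge_prod (I : Type) (r : seq I) (P : pred I) (F : I -> S) (k : I -> nat) :
  (forall i, P i -> ord_ge (k i) (F i)) ->
  ord_ge (\sum_(i <- r | P i) k i) (\prod_(i <- r | P i) F i).
Proof.
by move=> h; elim/big_rec2 : _ => // i x y Pi hy; apply: ord_geM => //; exact: h.
Qed.

Lemma ord_geXm (m : 'X_{1..N}) : ord_ge (mdeg m) 'X_[m].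
Proof. by move=> l; rewrite mcoeffX; case: eqP => // ->; rewrite ltnn. Qed.

Lemma ord_ge1P p : ord_ge 1 p <-> p@_0%MM = 0.
Proof.
split=> [|h m]; first by apply; rewrite mdeg0.
by rewrite ltnS leqn0 mdeg_eq0 => /eqP ->.
Qed.

Lemma ord_ge_deriv k i p : ord_ge k.+1 p -> ord_ge k p^`M(i).
Proof.
by move=> h m lt_mk; rewrite mcoeff_deriv h ?mul0rn // mdegD mdeg1 addn1.
Qed.

Lemma exact_order p : p != 0 -> exists k, ord_ge k p /\ ~ ord_ge k.+1 p.
Proof.
move=> p0; have exk : exists k, ~~ `[< ord_ge k.+1 p >].
  exists (msize p); apply/asboolP => h; case/eqP: p0; apply/mpolyP => m.
  rewrite mcoeff0; have [lt_m|] := ltnP (mdeg m) (msize p).+1; first exact: h.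
  by move=> /ltnW /msize_mdeg_ge /memN_msupp_eq0.
case: (ex_minnP exk) => k /asboolP hk kmin; exists k; split=> //.
case: k hk kmin => [|k] hk kmin //.
apply: contrapT => nk; have /kmin : ~~ `[< ord_ge k.+1 p >] by apply/asboolP.
by rewrite ltnn.
Qed.

Lemma ord_ge_homog k d p : p \is d.-homog -> (d < k)%N -> ord_ge k p -> p = 0.
Proof.
move=> hp lt_dk h; apply/mpolyP => m; rewrite mcoeff0.
have [/eqP e|/(dhomog_nemf_coeff hp)//] := boolP (mdeg m == d).
by apply: h; rewrite e.
Qed.

Lemma mcoeff_pihomog d (p : S) (m : 'X_{1..N}) :
  (pihomog mdeg d p)@_m = if mdeg m == d then p@_m else 0.
Proof.
have [/eqP e|] := boolP (mdeg m == d); last first.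
  by move=> h; apply: dhomog_nemf_coeff h; exact: pihomogP.
have hk : (msize p <= maxn (msize p) d.+1)%N := leq_maxl _ _.
have -> : p@_m = \sum_(i < maxn (msize p) d.+1) (pihomog mdeg i p)@_m.
  by rewrite {1}(pihomog_partitionE hk) raddf_sum.
rewrite (bigD1 (Ordinal (leq_maxr (msize p) d.+1))) //=.
rewrite [X in _ = _ + X]big1 ?addr0 ?e ?eqxx // => i /negP ni.
apply: (@dhomog_nemf_coeff _ _ mdeg i); first exact: pihomogP.
by rewrite /= e; apply/eqP => di; apply: ni; apply/eqP/val_inj.
Qed.

Lemma ord_ge_pihomog k (p : S) : ord_ge k p -> ord_ge k.+1 (p - pihomog mdeg k p).
Proof.
move=> h m; rewrite ltnS leq_eqVlt mcoeffB mcoeff_pihomog => /orP[/eqP ->|lt_mk].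
  by rewrite eqxx subrr.
by rewrite h // (ltn_eqF lt_mk) subr0.
Qed.

(** Initial forms multiply without cancellation in a domain. In the induction on [j], the degree [k]
    form of [f] times the degree [j] form of [q] has degree [k + j] but a larger order, so it is
    zero. *)
Lemma ord_ge_mulr k j f q :
  ord_ge k f -> ~ ord_ge k.+1 f -> ord_ge (k + j) (f * q) -> ord_ge j q.
Proof.
move=> hk nk; elim: j => [//|j IH] h.
have hj : ord_ge j q by apply: IH; apply: ord_ge_le h; rewrite addnS.
have hf := ord_ge_pihomog hk; have hq := ord_ge_pihomog hj.
set f0 := pihomog mdeg k f in hf; set q0 := pihomog mdeg j q in hq.
have f0h : f0 \is k.-homog by exact: pihomogP.
have q0h : q0 \is j.-homog by exact: pihomogP.
have k_f0 : ord_ge k f0.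
  by move=> m lt_mk; rewrite mcoeff_pihomog (ltn_eqF lt_mk).
have : f0 * q0 = 0.
  apply: (@ord_ge_homog (k + j).+1 (k + j)) => //; first exact: dhomogM.
  have -> : f0 * q0 = f * q - (f - f0) * q - f0 * (q - q0) by ring.
  apply: (lin_closedB (ord_ge_lin _)); last by rewrite -addnS; exact: ord_geM.
  apply: (lin_closedB (ord_ge_lin _)); first by rewrite -addnS.
  by rewrite -addSn; exact: ord_geM.
move/eqP; rewrite mulf_eq0 => /orP[/eqP e|/eqP e]; last by rewrite e subr0 in hq.
by rewrite e subr0 in hf.
Qed.

Local Notation tr a := (mmap (@mpolyC N K) (fun i => 'X_i + (a i)%:MP)).

Lemma trK (a b : 'I_N -> K) p : (forall i, b i = - a i) -> tr b (tr a p) = p.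
Proof.
move=> hb; have h := @rmorph_mpoly_eq _ (tr b \o tr a) idfun _ _ p; apply: h.
  by move=> c /=; rewrite !mmapC.
by move=> i /=; rewrite mmapX mmap1U rmorphD /= mmapX mmap1U mmapC hb mpolyCN subrK.
Qed.

(* [p] belongs to the [k]-th power of the maximal ideal of the point [a]. *)
Definition mult_ge (a : 'I_N -> K) k p := ord_ge k (tr a p).

Variable a : 'I_N -> K.

Lemma mult_ge_le k l p : (k <= l)%N -> mult_ge a l p -> mult_ge a k p.
Proof. exact: ord_ge_le. Qed.

Lemma mult_ge_lin k : lin_closed (mult_ge a k).
Proof.
have [h0 h] := ord_ge_lin k.
split=> [|c u v hu hv]; first by rewrite /mult_ge mmap0.
rewrite /mult_ge rmorphD /= mmapZ mul_mpolyC; exact: h.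
Qed.

Lemma mult_geMl k p q : mult_ge a k q -> mult_ge a k (p * q).
Proof. by rewrite /mult_ge rmorphM; exact: ord_geMl. Qed.

Lemma mult_geMr k p q : mult_ge a k p -> mult_ge a k (p * q).
Proof. by rewrite mulrC; exact: mult_geMl. Qed.

Lemma mult_geX k e p : mult_ge a k p -> mult_ge a (k * e) (p ^+ e).
Proof. by rewrite /mult_ge rmorphXn; exact: ord_geX. Qed.

Lemma mult_ge_prod (I : Type) (r : seq I) (P : pred I) (F : I -> S) (k : I -> nat) :
  (forall i, P i -> mult_ge a (k i) (F i)) ->
  mult_ge a (\sum_(i <- r | P i) k i) (\prod_(i <- r | P i) F i).
Proof. by rewrite /mult_ge rmorph_prod; exact: ord_ge_prod. Qed.

Lemma mult_ge_deriv k i p : mult_ge a k.+1 p -> mult_ge a k p^`M(i).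
Proof.
move=> /(ord_ge_deriv i); rewrite mderiv_mmap (bigD1 i) //= big1 => [|j nji].
  rewrite mderivD mderivC addr0 mderivX mnm1E eqxx scale1r addr0.
  by rewrite subm_diag mpolyX0 mulr1.
by rewrite mderivD mderivC addr0 mderivX mnm1E (negPf nji) scale0r mulr0.
Qed.

Lemma mult_geXsubC i : mult_ge a 1 ('X_i - (a i)%:MP).
Proof.
rewrite /mult_ge rmorphB /= mmapX mmap1U mmapC addrK -[1%N](mdeg1 i).
exact: ord_geXm.
Qed.

Lemma mult_ge1P p : mult_ge a 1 p <-> p.@[a] = 0.
Proof.
rewrite /mult_ge ord_ge1P.
have h := @rmorph_mpoly_eq _ (mcoeff 0%MM \o tr a) (meval a) _ _ p.
rewrite -[_@__]/((mcoeff 0%MM \o tr a) p) h //= => [c|i].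
  by rewrite mmapC mevalC mcoeffC eqxx mulr1.
rewrite mmapX mmap1U mcoeffD mcoeffC eqxx mulr1 mcoeffX mevalXU.
by rewrite mnm1_eq0 add0r.
Qed.

End PolynomialRing.

(** * A Bezout inequality *)

Section SpansMod.
Variables (K : fieldType) (V : lmodType K) (U : V -> Prop).
Hypothesis hU : lin_closed U.
Variables (J : finType) (b : J -> V).

Lemma spans_mod_sub v : U v -> spans_mod U b v.
Proof.
by exists (fun=> 0); rewrite big1 ?subr0 // => j _; rewrite scale0r.
Qed.

Lemma spans_mod_mem j : spans_mod U b (b j).
Proof.
exists (fun i => (i == j)%:R); rewrite (bigD1 j) //= eqxx scale1r big1 ?addr0.
  by rewrite subrr; case: hU.
by move=> i /negPf ->; rewrite scale0r.
Qed.

Lemma spans_mod_lin : lin_closed (spans_mod U b).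
Proof.
split=> [|a u v [c hc] [c' hc']]; first by apply: spans_mod_sub; case: hU.
exists (fun j => a * c j + c' j).
have -> : a *: u + v - \sum_j (a * c j + c' j) *: b j =
   a *: (u - \sum_j c j *: b j) + (v - \sum_j c' j *: b j).
  rewrite scalerBr scaler_sumr addrACA -opprD -big_split /=.
  by congr (_ - _); apply: eq_bigr => j _; rewrite scalerDl scalerA.
by case: hU => _; apply.
Qed.

End SpansMod.

Section Ideals.
Variables (K : fieldType) (N : nat).
Local Notation S := {mpoly K[N]}.

Definition igen (I : finType) (F : I -> S) (p : S) :=
  exists c : I -> S, p = \sum_i c i * F i.

Variables (I : finType) (F : I -> S).

Lemma igen_lin : lin_closed (igen F).
Proof.
split=> [|a u v [c ->] [c' ->]].
  by exists (fun=> 0); rewrite big1 // => i _; rewrite mul0r.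
exists (fun i => a *: c i + c' i); rewrite scaler_sumr -big_split /=.
by apply: eq_bigr => i _; rewrite mulrDl scalerAl.
Qed.

Lemma igen_mem i p : igen F (p * F i).
Proof.
exists (fun j => if j == i then p else 0); rewrite (bigD1 i) //= eqxx.
by rewrite big1 ?addr0 // => j /negPf ->; rewrite mul0r.
Qed.

Lemma pihomogM e d (c t : S) : t \is d.-homog ->
  pihomog mdeg e (c * t) = if (d <= e)%N then pihomog mdeg (e - d) c * t else 0.
Proof.
move=> ht; rewrite {1}(pihomog_partitionE (leqnn (msize c))) mulr_suml raddf_sum /=.
have hj j : pihomog mdeg e (pihomog mdeg j c * t) =
    if (j + d)%N == e then pihomog mdeg j c * t else 0.
  have h : pihomog mdeg j c * t \is (j + d).-homog.
    by apply: dhomogM => //; exact: pihomogP.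
  case: eqP => [<-|/eqP ne]; first by rewrite pihomog_dE.
  exact: pihomog_ne0 h.
under eq_bigr do rewrite hj.
have [le_de|lt_ed] := leqP d e; last first.
  by rewrite big1 // => j _; rewrite gtn_eqF // ltn_addl.
have [lt|ge] := ltnP (e - d) (msize c).
  rewrite (bigD1 (Ordinal lt)) //= subnK // eqxx big1 ?addr0 // => j nj.
  case: eqP => // ej; case/eqP: nj; apply: val_inj => /=.
  by rewrite -ej addnK.
rewrite big1 => [|j _]; last first.
  case: eqP => // ej; move: ge; rewrite -ej addnK leqNgt.
  by rewrite ltn_ord.
have -> : pihomog mdeg (e - d) c = 0; last by rewrite mul0r.
apply/mpolyP => m; rewrite mcoeff_pihomog mcoeff0; case: eqP => // em.
by apply: memN_msupp_eq0; apply: msize_mdeg_ge; rewrite em.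
Qed.

(** The coefficients can be replaced by their components of the right degree. Since [e - d i] is
    truncated, the case [e < d i] needs its own clause. *)
Lemma igen_homog (d : I -> nat) e p :
  (forall i, F i \is (d i).-homog) -> p \is e.-homog -> igen F p ->
  exists c : I -> S, p = \sum_i c i * F i /\
    forall i, c i \is (e - d i).-homog /\ ((e < d i)%N -> c i = 0).
Proof.
move=> hF hp [c pE].
exists (fun i => if (d i <= e)%N then pihomog mdeg (e - d i) (c i) else 0).
split=> [|i]; last first.
  by case: leqP => // _; split => //; [exact: pihomogP | exact: rpred0].
rewrite -[LHS](pihomog_dE hp) pE raddf_sum; apply: eq_bigr => i _ /=.
by rewrite (pihomogM _ _ (hF i)); case: ifP => // _; rewrite mul0r.
Qed.

Lemma msizeM_leq k l p q : (msize p <= k)%N -> (msize q <= l.+1)%N ->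
  (msize (p * q : S) <= k + l)%N.
Proof.
have [->|p0] := eqVneq p 0; first by rewrite mul0r msize0.
have [->|q0] := eqVneq q 0; first by rewrite mulr0 msize0.
by move=> hp hq; rewrite msizeM // -ltnS prednK ?addn_gt0 ?lt0n ?msize_poly_eq0 ?p0 //;
  rewrite -addnS leq_add.
Qed.

Lemma msizeX_leq d p e : (msize p <= d.+1)%N -> (msize (p ^+ e : S) <= (d * e).+1)%N.
Proof.
move=> hp; elim: e => [|e IH]; first by rewrite expr0 msize1.
by rewrite exprS mulnS -addSn; exact: msizeM_leq.
Qed.

Lemma dhomog_msize_leq d p : p \is d.-homog -> (msize (p : S) <= d.+1)%N.
Proof.
by move=> /dhomogP hp; rewrite msizeE; apply/bigmax_leqP_seq => m /hp -> _.
Qed.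

End Ideals.

Section Reduction.
Variables (K : fieldType) (N : nat).
Local Notation S := {mpoly K[N]}.
Variables (d : 'I_N -> nat) (th G : 'I_N -> S) (M : nat).
Hypothesis th_homog : forall i, th i \is (d i).-homog.
Hypothesis G_top : forall i, (msize (G i - th i) <= d i)%N.
Hypothesis th_primary : forall p e, p \is e.-homog -> (M <= e)%N -> igen th p.

(** Induction on [\sum_i t i]: in [p = \sum_i c i * th i], the form [c i] has degree [e - d i], so
    the induction hypothesis applies to it with [t i] lowered by one, and the factor [th i] restores
    the exponent. *)
Lemma igen_powers (t : 'I_N -> nat) e p :
  p \is e.-homog -> (M + \sum_i t i * d i <= e)%N ->
  igen (fun i => th i ^+ (t i).+1) p.
Proof.
have [s] := ubnP (\sum_i t i)%N; elim: s t e p => // s IH t e p lt_ts hp le_e.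
have [c [-> hc]] : exists c, p = \sum_i c i * th i /\
    forall i, c i \is (e - d i).-homog /\ ((e < d i)%N -> c i = 0).
  apply: igen_homog => //; apply: (th_primary hp).
  exact: leq_trans (leq_addr _ _) le_e.
apply: lin_closed_sum; first exact: igen_lin.
move=> i _; have [hci ci0] := hc i.
have [lt_ed|le_de] := ltnP e (d i).
  by rewrite ci0 // mul0r; case: (igen_lin (fun j => th j ^+ (t j).+1)).
have [ti0|ti_gt0] := posnP (t i).
  by have := igen_mem (fun j => th j ^+ (t j).+1) i (c i); rewrite ti0 expr1.
pose t' j := (t j - (j == i))%N.
have sum_t' (w : 'I_N -> nat) : (\sum_j t j * w j = w i + \sum_j t' j * w j)%N.
  rewrite (bigD1 i) //= [X in _ = (_ + X)%N](bigD1 i) //= /t' eqxx addnA.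
  congr (_ + _)%N; first by case: (t i) ti_gt0 => // k _; rewrite subn1 mulSn.
  by apply: eq_bigr => j /negPf ->; rewrite subn0.
have [||c' c'E] := IH t' (e - d i)%N (c i) _ hci _.
- have := sum_t' (fun=> 1%N).
  rewrite (eq_bigr t) => [|j _]; last exact: muln1.
  rewrite [X in (_ + X)%N](eq_bigr t') => [|j _]; last exact: muln1.
  by move=> h; move: lt_ts; rewrite h add1n ltnS.
- by move: le_e; rewrite (sum_t' d); lia.
rewrite c'E mulr_suml; apply: lin_closed_sum; first exact: igen_lin.
move=> j _; rewrite -mulrA [_ * th i]mulrC.
have := igen_mem (fun j => th j ^+ (t j).+1) j.
rewrite /t'; case: eqP => [->|_] h.
  by rewrite -exprS subn1 prednK //; exact: h.
by rewrite subn0 mulrA; exact: h.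
Qed.

Lemma msize_pow_diff i e : (msize (G i ^+ e - th i ^+ e) <= d i * e)%N.
Proof.
have hth : (msize (th i) <= (d i).+1)%N by exact: dhomog_msize_leq.
have hG : (msize (G i) <= (d i).+1)%N.
  rewrite -[G i](subrK (th i)); apply: leq_trans (msizeD_le _ _) _.
  by rewrite geq_max hth (leq_trans (G_top i)).
elim: e => [|e IH]; first by rewrite !expr0 subrr msize0.
have -> : G i ^+ e.+1 - th i ^+ e.+1 =
  (G i ^+ e - th i ^+ e) * G i + (G i - th i) * th i ^+ e.
  by rewrite !exprS; ring.
apply: leq_trans (msizeD_le _ _) _; rewrite geq_max; apply/andP; split.
  by rewrite mulnSr; exact: msizeM_leq.
by rewrite mulnS; apply: msizeM_leq => //; exact: msizeX_leq.
Qed.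

(** Division by leading forms: while [p] is too large, its top component is a combination of the
    [th i ^+ T i], and subtracting the same combination of the [G i ^+ T i] lowers the degree. *)
Lemma reduce_mod_powers (T : 'I_N -> nat) p : (forall i, 0 < T i)%N ->
  exists r, (msize r <= M + \sum_i (T i).-1 * d i)%N /\
    igen (fun i => G i ^+ T i) (p - r).
Proof.
move=> T_gt0; set X := (M + _)%N.
have hI := igen_lin (fun i => G i ^+ T i).
have [s] := ubnP (msize p); elim: s p => // s IH p.
rewrite ltnS => le_ps; have [le_pX|lt_Xp] := leqP (msize p) X.
  by exists p; split => //; rewrite subrr; case: hI.
set e := (msize p).-1; have eE : msize p = e.+1 by rewrite /e; case: (msize p) lt_Xp.
have : igen (fun i => th i ^+ T i) (pihomog mdeg e p).
  have := @igen_powers (fun i => (T i).-1) e (pihomog mdeg e p).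
  have -> : (fun i => th i ^+ (T i).-1.+1) = (fun i => th i ^+ T i).
    by apply/funext => i; rewrite prednK.
  by apply; [exact: pihomogP | rewrite -ltnS -eE].
case/(@igen_homog _ _ _ _ (fun i => d i * T i)%N e) => [i||c [pE hc]].
- exact: dhomogMn.
- exact: pihomogP.
pose p' := p - \sum_i c i * G i ^+ T i.
have p'E : p' = (p - pihomog mdeg e p) -
    \sum_i (G i ^+ T i - th i ^+ T i) * c i.
  rewrite pE /p' -addrA -opprD -big_split /=; congr (_ - _).
  by apply: eq_bigr => i _; ring.
have size_p' : (msize p' <= e)%N.
  rewrite p'E; apply: leq_trans (msizeD_le _ _) _; rewrite geq_max; apply/andP; split.
    rewrite msizeE; apply/bigmax_leqP_seq => m; rewrite mcoeff_msupp.
    rewrite mcoeffB mcoeff_pihomog => h _; move: h.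
    case: ifP => [_|/negbT ne]; first by rewrite subrr eqxx.
    rewrite subr0 -mcoeff_msupp => /msize_mdeg_lt.
    by rewrite eE ltnS ltn_neqAle ne => ->.
  rewrite mmeasureN; apply: leq_trans (msize_sum _ _ _) _.
  apply/bigmax_leqP => i _; have [hci ci0] := hc i.
  have [lt|le] := ltnP e (d i * T i); first by rewrite ci0 // mulr0 msize0.
  rewrite -(subnKC le); apply: msizeM_leq; first exact: msize_pow_diff.
  exact: dhomog_msize_leq.
have [|r [hr hpr]] := IH p'; first by rewrite (leq_ltn_trans size_p') // -eE.
exists r; split=> //.
have -> : p - r = (p' - r) + \sum_i c i * G i ^+ T i by rewrite /p'; ring.
by apply: lin_closedD => //; exists c.
Qed.

End Reduction.

Section LocalDimension.
Variables (K : fieldType) (N : nat).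
Local Notation S := {mpoly K[N]}.
Variables (G : 'I_N -> S) (T m r : 'I_N -> nat) (a : 'I_N -> K) (k L : nat).
Hypothesis G_mult : forall i, mult_ge a (m i) (G i).
Hypothesis T_gt0 : forall i, (0 < T i)%N.
Hypothesis m_gt0 : forall i, (0 < m i)%N.
Hypothesis L_le : forall i, (L <= m i * T i * r i)%N.
Hypothesis le_Lk : (L <= k)%N.

(** The sum of the ideal of the [G i ^+ T i] and of the [k]-th power of the maximal ideal of [a];
    the quotient by it is a truncated local ring at [a]. *)
Definition thick_ideal (p : S) :=
  exists2 q, igen (fun i => G i ^+ T i) q & mult_ge a k (p - q).

Lemma thick_ideal_lin : lin_closed thick_ideal.
Proof.
have hI := igen_lin (fun i => G i ^+ T i).
split=> [|c u v [q hq hu] [q' hq' hv]].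
  by exists 0; [case: hI | rewrite subr0; case: (mult_ge_lin a k)].
exists (c *: q + q'); first by case: hI => _; apply.
have -> : c *: u + v - (c *: q + q') = c *: (u - q) + (v - q').
  by rewrite scalerBr opprD addrACA.
by case: (mult_ge_lin a k) => _; apply.
Qed.

Variables (lam : nat) (b : 'I_lam -> S).
Hypothesis b_spans : forall v, spans_mod thick_ideal b v.

Let Gp (e : 'I_N -> nat) := \prod_i G i ^+ (T i * e i).
Let box := {dffun forall i, 'I_(r i)}.
Let fam (x : box * 'I_lam) := Gp (fun i => x.1 i) * b x.2.

(** Expanding [p] along [b] in [Gp e * p] leaves terms that gain a factor [G i ^+ T i] and a term of
    order at least [k >= L]. A product [Gp e] has order at least [L] once the exponents sum to [L],
    and already once some [e i] reaches [r i]. *)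
Lemma box_spans v : spans_mod (mult_ge a L) fam v.
Proof.
have hU := mult_ge_lin a L; have hSP := spans_mod_lin hU fam.
have Gp_ord e : mult_ge a (\sum_i m i * (T i * e i)) (Gp e).
  by apply: mult_ge_prod => i _; exact: mult_geX.
suff H h e p : (L <= h + \sum_i e i)%N -> spans_mod (mult_ge a L) fam (Gp e * p).
  have := H L (fun=> 0%N) v (leq_addr _ _).
  by rewrite /Gp big1 ?mul1r // => i _; rewrite muln0.
elim: h e p => [|h IH] e p.
  rewrite add0n => hL; apply: spans_mod_sub => //; apply: mult_geMr.
  apply: mult_ge_le (Gp_ord e); apply: leq_trans hL _; apply: leq_sum => i _.
  by rewrite mulnA leq_pmull // muln_gt0 m_gt0 T_gt0.
move=> hL; have [c [q [d' qE]]] := b_spans p.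
set z := _ - q => hz.
have -> : p = \sum_j c j *: b j + (\sum_i d' i * G i ^+ T i + z).
  by rewrite /z qE; ring.
rewrite mulrDr [X in _ + X]mulrDr; apply: (lin_closedD hSP); last apply: (lin_closedD hSP).
- rewrite mulr_sumr; apply: lin_closed_sum => // j _.
  rewrite -scalerAr; apply: lin_closedZ => //.
  have [/forallP hr|] := boolP [forall i, e i < r i]%N.
    have -> : Gp e * b j = fam ([ffun i => Ordinal (hr i)], j).
      by congr (_ * _); apply: eq_bigr => i _; rewrite ffunE.
    exact: spans_mod_mem.
  rewrite negb_forall => /existsP[i]; rewrite -leqNgt => le_re.
  apply: spans_mod_sub => //; apply: mult_geMr; apply: mult_ge_le (Gp_ord e).
  rewrite (bigD1 i) //=; apply: leq_trans (leq_addr _ _).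
  by apply: leq_trans (L_le i) _; rewrite -mulnA leq_mul2l leq_mul2l le_re !orbT.
- rewrite mulr_sumr; apply: lin_closed_sum => // i _.
  have -> : Gp e * (d' i * G i ^+ T i) = Gp (fun j => (e j + (j == i))%N) * d' i.
    rewrite mulrCA mulrC; congr (_ * _).
    rewrite /Gp (bigD1 i) //= [RHS](bigD1 i) //= eqxx addn1 mulnSr exprD.
    rewrite mulrAC; congr (_ * _); apply: eq_bigr => j /negPf ->.
    by rewrite addn0.
  apply: IH; rewrite big_split /= (bigD1 i (F := fun j => nat_of_bool (j == i))) //=.
  by apply: leq_trans hL _; rewrite eqxx addSnnS leq_add2l -addn1 leq_add2l leq_addr.
- apply: spans_mod_sub => //. apply: mult_geMl; exact: mult_ge_le hz.
Qed.

(** After translation to the origin these are distinct monomials of degree at most [N * (l - 1)],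
    which is less than [N * l]. *)
Lemma indep_shifted_monomials l : (0 < N)%N ->
  indep_mod (mult_ge a (N * l))
    (fun e : {ffun 'I_N -> 'I_l} => \prod_i ('X_i - (a i)%:MP) ^+ e i).
Proof.
move=> N_gt0 c hc f.
have trE (e : {ffun 'I_N -> 'I_l}) :
    mmap (@mpolyC N K) (fun i => 'X_i + (a i)%:MP)
      (c e *: \prod_i ('X_i - (a i)%:MP) ^+ e i) =
    c e *: 'X_[[multinom nat_of_ord (e i) | i < N]].
  rewrite mmapZ mul_mpolyC; congr (_ *: _); rewrite rmorph_prod mpolyXE_id.
  apply: eq_bigr => i _ /=.
  by rewrite mnmE rmorphXn rmorphB /= mmapX mmap1U mmapC addrK.
have := hc [multinom nat_of_ord (f i) | i < N].
rewrite (raddf_sum (mmap _ _)) (raddf_sum (mcoeff _)) /=.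
rewrite (bigD1 f) //= trE mcoeffZ mcoeffX eqxx mulr1 big1 ?addr0 => [|e nef].
  apply; rewrite mdegE; under eq_bigr do rewrite mnmE.
  have l_gt0 : (0 < l)%N by exact: leq_ltn_trans (leq0n _) (ltn_ord (f (Ordinal N_gt0))).
  apply: (@leq_ltn_trans (\sum_(i < N) l.-1)).
    by apply: leq_sum => i _; rewrite -ltnS prednK.
  by rewrite sum_nat_const card_ord ltn_mul2l N_gt0 /= prednK.
rewrite trE mcoeffZ mcoeffX; case: eqP => [/mnmP h|]; last by rewrite mulr0.
by case/eqP: nef; apply/ffunP => i; apply: val_inj; have := h i; rewrite !mnmE.
Qed.

Lemma local_dimension_bound l : (0 < N)%N -> (L = N * l)%N ->
  (l ^ N <= (\prod_i r i) * lam)%N.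
Proof.
move=> N_gt0 LE; have h := indep_shifted_monomials (l := l) N_gt0.
rewrite -LE in h.
have := leq_card_indep_spans (mult_ge_lin a L) h (fun e => box_spans _).
rewrite card_ffun !card_ord card_prod card_dep_ffun card_ord foldrE big_map big_enum.
by under eq_bigr do rewrite card_ord.
Qed.

End LocalDimension.

Lemma leq_summand (I : finType) (F : I -> nat) i : (F i <= \sum_j F j)%N.
Proof. by rewrite (bigD1 i) //= leq_addr. Qed.

Lemma card_bmultinom_leq N X : (#|{: 'X_{1..N < X}}| <= X ^ N)%N.
Proof.
pose f (m : 'X_{1..N < X}) : {ffun 'I_N -> 'I_X} :=
  [ffun i => Ordinal (leq_ltn_trans
    (leq_trans (leq_summand m i) (eq_leq (esym (mdegE m)))) (bmdeg m))].
have f_inj : injective f.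
  move=> m m' /ffunP h; apply/val_inj/mnmP => i.
  by have := congr1 val (h i); rewrite !ffunE.
by apply: leq_trans (leq_card _ f_inj) _; rewrite card_ffun !card_ord.
Qed.

Section Bezout.
Variables (K : fieldType) (N : nat).
Local Notation S := {mpoly K[N]}.
Variables (I : finType) (a : I -> 'I_N -> K).
Hypothesis a_distinct : forall x y, x != y -> exists i, a x i != a y i.

(** An affine function [l] with value 1 at [a x] and 0 at [a y] is sharpened to order [k] at both
    points. *)
Lemma separating_poly k x y : x != y ->
  exists w : S, mult_ge (a y) k w /\ mult_ge (a x) k (w - 1).
Proof.
move=> /a_distinct[i]; rewrite -subr_eq0 => nz.
pose l : S := (a x i - a y i)^-1 *: ('X_i - (a y i)%:MP).
have ly : mult_ge (a y) 1 l.
  by apply: lin_closedZ (mult_geXsubC _ _); exact: mult_ge_lin.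
have lx : mult_ge (a x) 1 (1 - l).
  by apply/mult_ge1P; rewrite mevalB meval1 mevalZ mevalB mevalXU mevalC mulVf ?subrr.
have one_sub (t : S) j : exists v, 1 - t ^+ j = (1 - t) * v.
  exists (\sum_(s < j) t ^+ s).
  by rewrite -[LHS]opprB -[1 - t]opprB mulNr -subrX1.
have [v vE] := one_sub l k; have [v' v'E] := one_sub (1 - l ^+ k) k.
(* This polynomial is divisible by [l ^+ k], and its difference from 1 by [(1 - l) ^+ k]. *)
exists (1 - (1 - l ^+ k) ^+ k); split.
  rewrite v'E opprB addrC subrK; apply: mult_geMr.
  by rewrite -[X in mult_ge _ X]mul1n; exact: mult_geX.
rewrite addrAC subrr sub0r; apply: (lin_closedN (mult_ge_lin _ _)).
rewrite -[X in mult_ge _ X]mul1n; apply: mult_geX.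
by rewrite vE; exact: mult_geMr.
Qed.

(** The Chinese remainder theorem for the [k]-th powers of the maximal ideals of the points. *)
Lemma point_idempotents k : exists u : I -> S, forall x,
  mult_ge (a x) k (u x - 1) /\ forall y, y != x -> mult_ge (a y) k (u x).
Proof.
have /choice[w hw] : forall xy : I * I, exists w : S, xy.1 != xy.2 ->
    mult_ge (a xy.2) k w /\ mult_ge (a xy.1) k (w - 1).
  move=> [x y]; have [->|nxy] := eqVneq x y; first by exists 0.
  by have [w hw] := separating_poly k nxy; exists w.
exists (fun x => \prod_(y | y != x) w (x, y)) => x; split=> [|y nyx]; last first.
  rewrite (bigD1 y) //=; apply: mult_geMr.
  by have [] := hw (x, y); rewrite // eq_sym.
elim/big_ind : _ => [|v v' hv hv'|y nyx].
- by rewrite subrr; case: (mult_ge_lin (a x) k).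
- have -> : v * v' - 1 = (v - 1) * v' + (v' - 1) by ring.
  by apply: (lin_closedD (mult_ge_lin _ _)) => //; exact: mult_geMr.
- by have [] := hw (x, y); rewrite // eq_sym.
Qed.

(** Multiplied by the approximate idempotents [u x], the local families form a single family that is
    independent modulo the ideal of the [G i ^+ T i]; the quotient by this ideal is spanned by the
    monomials of degree less than [X]. *)
Lemma leq_sum_local_dims (G : 'I_N -> S) (T : 'I_N -> nat) k X
    (lam : I -> nat) (b : forall x, 'I_(lam x) -> S) :
  (forall p, exists r, (msize r <= X)%N /\ igen (fun i => G i ^+ T i) (p - r)) ->
  (forall x, indep_mod (thick_ideal G T (a x) k) (b x)) ->
  (\sum_x lam x <= X ^ N)%N.
Proof.
move=> hX hb; have [u hu] := point_idempotents k.
pose e (z : {x : I & 'I_(lam x)}) := u (tag z) * b (tag z) (tagged z).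
have card_e : #|{: {x : I & 'I_(lam x)}}| = (\sum_x lam x)%N.
  rewrite card_tagged sumnE big_map big_enum.
  by apply: eq_bigr => x _; rewrite card_ord.
pose mono (m : 'X_{1..N < X}) : S := 'X_[m].
have hI := igen_lin (fun i => G i ^+ T i).
have e_indep : indep_mod (igen (fun i => G i ^+ T i)) e.
  move=> c hc [x j0].
  pose cx j := c (Tagged (fun x => 'I_(lam x)) j).
  suff : thick_ideal G T (a x) k (\sum_j @cx x j *: b x j).
    by move=> /hb; exact.
  exists (\sum_z c z *: e z) => //.
  have -> : \sum_z c z *: e z = \sum_y \sum_j @cx y j *: (u y * b y j).
    rewrite sig_big_dep; apply: eq_bigr => z _ /=.
    by rewrite /cx /e /=; case: z.
  rewrite (bigD1 x) //= opprD addrA -sumrB.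
  have hM := mult_ge_lin (a x) k.
  apply: (lin_closedB hM).
    apply: lin_closed_sum => // j _; rewrite -scalerBr; apply: (lin_closedZ _ hM).
    rewrite -[X in X - _]mul1r -mulrBl -opprB mulNr; apply: (lin_closedN hM).
    by apply: mult_geMr; case: (hu x).
  apply: lin_closed_sum => // y nyx; apply: lin_closed_sum => // j _; apply: (lin_closedZ _ hM).
  by apply: mult_geMr; apply: (proj2 (hu y)); rewrite eq_sym.
have e_span z : spans_mod (igen (fun i => G i ^+ T i)) mono (e z).
  have [r [hr hp]] := hX (e z); exists (fun m => r@_(val m)).
  by rewrite -(mpolywE hr).
have := leq_card_indep_spans hI e_indep e_span; rewrite card_e => /leq_trans; apply.
exact: card_bmultinom_leq.
Qed.

Lemma leq_prod_local_dim (G : 'I_N -> S) (T m : 'I_N -> nat) x k lam (b : 'I_lam -> S) :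
  (0 < N)%N -> (forall i, mult_ge (a x) (m i) (G i)) ->
  (forall i, 0 < T i)%N -> (forall i, 0 < m i)%N ->
  (N * \prod_i (m i * T i) <= k)%N ->
  (forall v, spans_mod (thick_ideal G T (a x) k) b v) ->
  (\prod_i (m i * T i) <= N ^ N * lam)%N.
Proof.
move=> N_gt0 hG T_gt0 m_gt0 le_k hb; set l := (\prod_i _)%N in le_k *.
have l_gt0 : (0 < l)%N by apply: prodn_gt0 => i; rewrite muln_gt0 m_gt0 T_gt0.
(* All [m i * T i * r i] equal [N * l], so [l * \prod_i r i = (N * l) ^ N]. Multiplying the bound
   [l ^ N <= \prod_i r i * lam] by [l] and cancelling [l ^ N] gives the claim. *)
pose r i := ((N * l) %/ (m i * T i))%N.
have hr i : (m i * T i * r i = N * l)%N.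
  by rewrite mulnC divnK // dvdn_mull // /l (bigD1 i) //= dvdn_mulr.
have h := local_dimension_bound hG T_gt0 m_gt0 (fun i => eq_leq (esym (hr i)))
  le_k hb N_gt0 erefl.
have lr : (l * \prod_i r i = (N * l) ^ N)%N.
  rewrite -big_split /= (eq_bigr _ (fun i _ => hr i)).
  by rewrite prod_nat_const card_ord.
have lN_gt0 : (0 < l ^ N)%N by rewrite expn_gt0 l_gt0.
rewrite -(leq_pmul2r lN_gt0) mulnAC -expnMn -lr -mulnA.
by rewrite leq_pmul2l.
Qed.

(* The powers [G i ^+ T i] all have degree [E], so that the quotient by them is
   spanned by the monomials of degree less than [N * E + M]; each point [a x]
   accounts for at least a multiple of [\prod_i (m x i * T i)] of its dimension. *)
Theorem bezout_multiplicities (d : 'I_N -> nat) (th G : 'I_N -> S) (M : nat)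
    (m : I -> 'I_N -> nat) :
  (0 < N)%N ->
  (forall i, th i \is (d i).-homog) ->
  (forall i, (msize (G i - th i) <= d i)%N) ->
  (forall p e, p \is e.-homog -> (M <= e)%N -> igen th p) ->
  (forall i, 0 < d i)%N ->
  (forall x i, 0 < m x i)%N ->
  (forall x i, mult_ge (a x) (m x i) (G i)) ->
  (\sum_x \prod_i m x i <= (N * N.+1) ^ N * \prod_i d i)%N.
Proof.
move=> N_gt0 th_homog G_top th_primary d_gt0 m_gt0 G_mult.
set D := (\prod_i d i)%N.
have D_gt0 : (0 < D)%N by exact: prodn_gt0.
(* A common multiple of the [d i] that is at least [M], so that [N * E + M <= N.+1 * E]. *)
pose E := (D * M.+1)%N; have E_gt0 : (0 < E)%N by rewrite muln_gt0 D_gt0.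
pose T i := (E %/ d i)%N.
have TdE i : (T i * d i = E)%N.
  by rewrite divnK // dvdn_mulr // /D (bigD1 i) //= dvdn_mulr.
have T_gt0 i : (0 < T i)%N by move: E_gt0; rewrite -(TdE i) muln_gt0 => /andP[].
(* The sum makes one truncation order large enough for all the points. *)
pose k := (\sum_x N * \prod_i (m x i * T i))%N.
pose X := (M + \sum_i (T i).-1 * d i)%N.
have hred p := reduce_mod_powers th_homog G_top th_primary p T_gt0.
have le_X : (X <= N.+1 * E)%N.
  rewrite mulSn leq_add //; first by rewrite -[M]mul1n leq_mul.
  have -> : (N * E = \sum_(i < N) E)%N by rewrite sum_nat_const card_ord.
  apply: leq_sum => i _.
  by rewrite -(TdE i) leq_mul2r leq_pred orbT.
pose mono (mm : 'X_{1..N < X}) : S := 'X_[mm].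
have bounded x q (e : 'I_q -> S) :
    indep_mod (thick_ideal G T (a x) k) e -> (q <= #|{: 'X_{1..N < X}}|)%N.
  move=> he; rewrite -[q]card_ord.
  apply: (leq_card_indep_spans (b := mono) (thick_ideal_lin _ _ _ _) he) => i.
  have [r [hr hp]] := hred (e i); exists (fun m => r@_(val m)).
  rewrite -(mpolywE hr); exists (e i - r) => //.
  by rewrite subrr; case: (mult_ge_lin (a x) k).
have hbasis x : exists lam_b : {lam & 'I_lam -> S},
    indep_mod (thick_ideal G T (a x) k) (tagged lam_b) /\
    forall v, spans_mod (thick_ideal G T (a x) k) (tagged lam_b) v.
  have [q [e he]] := exists_basis_mod (thick_ideal_lin _ _ _ _) (bounded x).
  by exists (Tagged (fun lam => 'I_lam -> S) e).
have /choice[B hB] := hbasis.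
have sum_lam : (\sum_x tag (B x) <= X ^ N)%N.
  exact: (leq_sum_local_dims hred (fun x => proj1 (hB x))).
have local x : (\prod_i (m x i * T i) <= N ^ N * tag (B x))%N.
  apply: (@leq_prod_local_dim G T (m x) x k) (proj2 (hB x)) => //.
  exact: (leq_summand (fun x => (N * \prod_i (m x i * T i))%N) x).
have : (\sum_x \prod_i (m x i * T i) <= N ^ N * X ^ N)%N.
  apply: (@leq_trans (\sum_x N ^ N * tag (B x))); first exact: leq_sum.
  by rewrite -big_distrr leq_mul2l sum_lam orbT.
under eq_bigr do rewrite big_split.
rewrite -big_distrl /= => h.
have TD : (\prod_i T i * D = E ^ N)%N.
  by rewrite -big_split /= (eq_bigr _ (fun i _ => TdE i)) prod_nat_const card_ord.
have EN_gt0 : (0 < E ^ N)%N by rewrite expn_gt0 E_gt0.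
rewrite -(leq_pmul2r EN_gt0) -{1}TD mulnA.
apply: (@leq_trans (N ^ N * X ^ N * D)); first by rewrite leq_mul2r h orbT.
rewrite expnMn -!mulnA leq_mul2l; apply/orP; right.
rewrite [X in (_ <= X)%N]mulnCA [(_ * D)%N]mulnC leq_mul2l -expnMn.
by apply/orP; right; rewrite leq_exp2r.
Qed.

End Bezout.

(** * Homogeneous prime ideals *)

Section Dickson.

(** Choose each time an index where [u] is smallest beyond the index chosen before. *)
Lemma nondecreasing_subsequence (u : nat -> nat) : exists phi : nat -> nat,
  {homo phi : i j / (i < j)%N} /\ {homo u \o phi : i j / (i <= j)%N}.
Proof.
have /choice[g hg] : forall n, exists m, (n <= m)%N /\
    forall k, (n <= k)%N -> (u m <= u k)%N.
  move=> n; pose P x := `[< exists2 m, (n <= m)%N & u m = x >].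
  have exP : exists x, P x by exists (u n); apply/asboolP; exists n.
  case: (ex_minnP exP) => x /asboolP[m le_nm <-] xmin.
  by exists m; split => // k le_nk; apply: xmin; apply/asboolP; exists k.
pose phi k := iter k (fun m => g m.+1) (g 0%N).
have phiS k : (phi k < phi k.+1)%N by have [] := hg (phi k).+1.
have phi_homo : {homo phi : i j / (i < j)%N} by apply: homo_ltn => //; exact: ltn_trans.
exists phi; split=> // i j; rewrite leq_eqVlt => /orP[/eqP -> //|lt_ij] /=.
have le_phi := phi_homo _ _ lt_ij.
case: i lt_ij le_phi => [|i] lt_ij le_phi; apply: (proj2 (hg _)) => //.
by apply: leq_trans (ltnW le_phi); exact: phiS.
Qed.

(** Extract a nondecreasing subsequence for one exponent after the other. *)
Lemma dickson N (m : nat -> 'X_{1..N}) : exists i j, (i < j)%N /\ (m i <= m j)%MM.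
Proof.
suff H n : (n <= N)%N -> exists phi : nat -> nat, {homo phi : i j / (i < j)%N} /\
    forall c : 'I_N, (c < n)%N -> {homo (fun k => m (phi k) c) : i j / (i <= j)%N}.
  have [phi [hphi hm]] := H N (leqnn N).
  exists (phi 0%N), (phi 1%N); split; first exact: hphi.
  by apply/mnm_lepP => c; apply: (hm c).
elim: n => [|k IH] lt_kN; first by exists id; split.
have [phi [hphi hm]] := IH (ltnW lt_kN).
have [psi [hpsi hu]] := nondecreasing_subsequence (fun i => m (phi i) (Ordinal lt_kN)).
exists (phi \o psi); split=> [i j lt_ij|c]; first by apply/hphi/hpsi.
rewrite ltnS leq_eqVlt => /orP[/eqP ck|lt_ck] i j le_ij /=; last first.
  apply: (hm c lt_ck); move: le_ij; rewrite leq_eqVlt => /orP[/eqP -> //|/hpsi].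
  exact: ltnW.
have -> : c = Ordinal lt_kN by apply: val_inj.
exact: hu.
Qed.

End Dickson.

Lemma wf_minimal (T : Type) (R : T -> T -> Prop) (P : T -> Prop) :
  well_founded R -> (exists x, P x) -> exists x, P x /\ forall y, R y x -> ~ P y.
Proof.
move=> wfR [x Px]; apply: contrapT => nmin; elim/(well_founded_ind wfR) : x Px.
move=> x IH Px; apply: nmin; exists x; split => // y Ryx Py; exact: IH Py.
Qed.

Section PrimeIdeals.
Variables (K : fieldType) (N : nat).
Local Notation S := {mpoly K[N]}.
Implicit Types (I P : S -> Prop).

Definition is_ideal I := I 0 /\ forall a u v, I u -> I v -> I (a * u + v).

Definition is_prime P :=
  [/\ is_ideal P, ~ P 1 & forall a b, P (a * b) -> P a \/ P b].

Definition homog_ideal I := is_ideal I /\ forall p, I p -> forall d, I (pihomog mdeg d p).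

Definition homog_prime P := is_prime P /\ forall p, P p -> forall d, P (pihomog mdeg d p).

Definition adjoin I g : S -> Prop := fun p => exists q, I (p - q * g).

Lemma ideal_lin I : is_ideal I -> lin_closed I.
Proof.
by move=> [h0 h]; split=> // a u v hu hv; rewrite -mul_mpolyC; exact: h.
Qed.

Lemma ideal_mull I p q : is_ideal I -> I q -> I (p * q).
Proof. by move=> [h0 h] hq; rewrite -[_ * _]addr0; exact: h. Qed.

Lemma ideal_mulr I p q : is_ideal I -> I p -> I (p * q).
Proof. by rewrite mulrC; exact: ideal_mull. Qed.

Lemma ideal_add I p q : is_ideal I -> I p -> I q -> I (p + q).
Proof. by move=> /ideal_lin; exact: lin_closedD. Qed.

Lemma ideal_sub I p q : is_ideal I -> I p -> I q -> I (p - q).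
Proof. by move=> /ideal_lin; exact: lin_closedB. Qed.

Lemma ideal_addl I p q : is_ideal I -> I p -> I (p + q) -> I q.
Proof. by move=> hI hp hpq; have := ideal_sub hI hpq hp; rewrite addrAC subrr add0r. Qed.

Lemma ideal_sum I (T : Type) (r : seq T) (Q : pred T) (F : T -> S) :
  is_ideal I -> (forall i, Q i -> I (F i)) -> I (\sum_(i <- r | Q i) F i).
Proof. by move=> /ideal_lin; exact: lin_closed_sum. Qed.

Lemma adjoin_sub I g p : I p -> adjoin I g p.
Proof. by move=> hp; exists 0; rewrite mul0r subr0. Qed.

Lemma adjoin_mem I g : is_ideal I -> adjoin I g g.
Proof. by move=> [h0 _]; exists 1; rewrite mul1r subrr. Qed.

Lemma adjoin_ideal I g : is_ideal I -> is_ideal (adjoin I g).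
Proof.
move=> hI; split=> [|a u v [q hq] [q' hq']]; first by apply: adjoin_sub; case: hI.
exists (a * q + q').
have -> : a * u + v - (a * q + q') * g = a * (u - q * g) + (v - q' * g) by ring.
by case: hI => _; apply.
Qed.

Lemma adjoin_homog I g d : homog_ideal I -> g \is d.-homog -> homog_ideal (adjoin I g).
Proof.
move=> [hI hh] hg; split=> [|p [q hq] e]; first exact: adjoin_ideal.
have := hh _ hq e; rewrite pihomogB (pihomogM _ _ hg); case: ifP => _ h.
  by exists (pihomog mdeg (e - d) q).
by exists 0; rewrite mul0r.
Qed.

Lemma adjoin_min I J g : is_ideal J -> (forall p, I p -> J p) -> J g ->
  forall p, adjoin I g p -> J p.
Proof.
move=> hJ IJ Jg p [q /IJ h].
by have := ideal_add hJ h (ideal_mull q hJ Jg); rewrite subrK.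
Qed.

Lemma homog_ideal_comp I p : homog_ideal I -> (forall d, I (pihomog mdeg d p)) -> I p.
Proof.
move=> [hI _] h; rewrite (pihomog_partitionE (leqnn (msize p))).
by apply: ideal_sum.
Qed.

(* The components of largest degree outside the ideal multiply, modulo the
   ideal, to a component of the product. *)
Lemma homog_prime_criterion I : homog_ideal I -> ~ I 1 ->
  (forall d e a b, a \is d.-homog -> b \is e.-homog -> I (a * b) -> I a \/ I b) ->
  homog_prime I.
Proof.
move=> hI nI1 hab; have [iI hh] := hI; split=> //; split=> // a b Iab.
have [Ia|nIa] := pselect (I a); [by left | right]; apply: contrapT => nIb.
have topdeg p : ~ I p -> exists d, ~ I (pihomog mdeg d p) /\
    forall j, (d < j)%N -> I (pihomog mdeg j p).
  move=> nIp.
  have exd : exists d, ~~ `[< I (pihomog mdeg d p) >].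
    apply: contrapT => h; apply: nIp; apply: homog_ideal_comp => // d.
    by apply: contrapT => h'; apply: h; exists d; apply/asboolP.
  have ub d : ~~ `[< I (pihomog mdeg d p) >] -> (d <= msize p)%N.
    apply: contraR; rewrite -ltnNge => lt_d; apply/asboolP.
    have -> : pihomog mdeg d p = 0; last by case: iI.
    apply/mpolyP => m; rewrite mcoeff_pihomog mcoeff0; case: ifP => // /eqP e.
    by apply/memN_msupp_eq0/msize_mdeg_ge; rewrite e ltnW.
  case: (ex_maxnP exd ub) => d /asboolP nd dmax; exists d; split=> // j lt_dj.
  apply: contrapT => nj; have /dmax : ~~ `[< I (pihomog mdeg j p) >] by apply/asboolP.
  by rewrite leqNgt lt_dj.
have [d [nd dmax]] := topdeg _ nIa; have [e [ne emax]] := topdeg _ nIb.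
have comp : I (pihomog mdeg (d + e) (a * b)) by exact: hh.
have hhom k (p : S) : pihomog mdeg k p \is k.-homog by exact: pihomogP.
suff /(hab _ _ _ _ (hhom d a) (hhom e b))[] :
  I (pihomog mdeg d a * pihomog mdeg e b) by [].
have mulc k p (q : S) : pihomog mdeg (k + e) (pihomog mdeg k p * q) =
    pihomog mdeg k p * pihomog mdeg e q.
  by rewrite mulrC (pihomogM _ _ (hhom k p)) leq_addr addKn mulrC.
have mulc' k j p (q : S) : pihomog mdeg j (pihomog mdeg k p * q) =
    if (k <= j)%N then pihomog mdeg k p * pihomog mdeg (j - k) q else 0.
  by rewrite mulrC (pihomogM _ _ (hhom k p)); case: ifP => // _; rewrite mulrC.
move: comp; rewrite {1}(pihomog_partitionE (leqnn (msize a))) mulr_suml raddf_sum /=.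
have [lt_d|le_d] := ltnP d (msize a); last first.
  case: nd; have -> : pihomog mdeg d a = 0; last by case: iI.
  apply/mpolyP => m; rewrite mcoeff_pihomog mcoeff0; case: ifP => // /eqP em.
  by apply/memN_msupp_eq0/msize_mdeg_ge; rewrite em.
rewrite (bigD1 (Ordinal lt_d)) //= mulc addrC => h; apply: ideal_addl h => //.
apply: ideal_sum => // i ni; rewrite mulc'; case: leqP => le_i; last by case: iI.
have : (i < d)%N || (d < i)%N.
  by rewrite -neq_ltn; apply: contraNneq ni => id_; apply/eqP/val_inj.
move=> /orP[lt_id|lt_di].
  by apply: ideal_mull => //; apply: emax; move: lt_id le_i; lia.
by apply: ideal_mulr => //; exact: dmax.
Qed.

(** Choose [p k] in [I k.+1] but not in [I k], with the smallest possible leading monomial. By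
    Dickson's lemma the leading monomial of some [p i] divides that of a later [p j]; cancelling the
    leading term of [p j] contradicts its minimality. *)
Lemma no_infinite_chain (I : nat -> S -> Prop) :
  (forall k, is_ideal (I k)) -> (forall k p, I k p -> I k.+1 p) ->
  ~ forall k, exists p, I k.+1 p /\ ~ I k p.
Proof.
move=> hI Iinc hstrict.
have Imono i j p : (i <= j)%N -> I i p -> I j p.
  move=> /subnKC <-; elim: (j - i)%N => [|l IH]; first by rewrite addn0.
  by move=> /IH; rewrite addnS; exact: Iinc.
have /choice[p hp] : forall k, exists p, (I k.+1 p /\ ~ I k p) /\
    forall q, (mlead q < mlead p)%O -> ~ (I k.+1 q /\ ~ I k q).
  move=> k; have [p0 hp0] := hstrict k.
  have [|m [[p [hp <-]] pmin]] :=
    @wf_minimal _ _ (fun m => exists p, (I k.+1 p /\ ~ I k p) /\ mlead p = m) (@ltom_wf N).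
    by exists (mlead p0), p0.
  by exists p; split=> // q lt_q hq; apply: (pmin _ lt_q); exists q.
have [i [j [lt_ij le_m]]] := dickson (fun k => mlead (p k)).
have [[Ip nIp] _] := hp i; have [[Iq nIq] qmin] := hp j.
have pi0 : p i != 0 by apply: contra_notN nIp => /eqP ->; case: (hI i).
pose t : S := ((p j)@_(mlead (p j)) / (p i)@_(mlead (p i))) *:
  'X_[mlead (p j) - mlead (p i)].
have Ijt : I j (t * p i) by apply: ideal_mull => //; exact: Imono Ip.
have nIq' : ~ I j (p j - t * p i).
  by move=> h; apply: nIq; have := ideal_add (hI j) h Ijt; rewrite subrK.
apply: (qmin (p j - t * p i)); last first.
  by split=> //; apply: ideal_sub => //; exact: Iinc.
have q0 : p j - t * p i != 0 by apply: contra_notN nIq' => /eqP ->; case: (hI j).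
have tc : t * p i = ((p j)@_(mlead (p j)) / (p i)@_(mlead (p i))) *:
    (p i * 'X_[mlead (p j) - mlead (p i)]).
  by rewrite /t -scalerAl; congr (_ *: _); exact: mulrC.
have le1 : (mlead (p j - t * p i) <= mlead (p j))%O.
  apply: le_trans (mleadB_le _ _) _; rewrite leUx lexx /= tc.
  apply: le_trans (mleadZ_le _ _) _.
  by rewrite mleadM ?mleadXm -?msize_poly_eq0 ?msizeX // ?msize_poly_eq0 // addmC submK.
rewrite lt_neqAle le1 andbT; apply: contraTneq (mlead_supp q0) => ->.
rewrite mcoeff_msupp negbK mcoeffB tc mcoeffZ -[X in _ * _@_X](submK le_m).
by rewrite mcoeffMX divfK ?subrr // mleadc_eq0.
Qed.

End PrimeIdeals.

(** * Primes over a homogeneous ideal *)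

Section Decomposition.
Variables (K : fieldType) (N : nat).
Local Notation S := {mpoly K[N]}.
Implicit Types (I J P : S -> Prop).

(** A finite tree of splittings. A prime over [I] that contains [a * b] contains [a] or [b], so
    every prime over [I] lies over a leaf. *)
Inductive decomposable : (S -> Prop) -> Prop :=
| Decomposable_unit I : I 1 -> decomposable I
| Decomposable_prime I : homog_prime I -> decomposable I
| Decomposable_split I a b : is_ideal I -> I (a * b) ->
    decomposable (adjoin I a) -> decomposable (adjoin I b) -> decomposable I.

(** A homogeneous ideal without such a tree is neither the unit ideal nor prime, so it contains a
    product of two forms outside it, and adjoining one of the two gives a larger ideal without a
    tree. Iterating contradicts [no_infinite_chain]. *)
Lemma homog_ideal_decomposable I : homog_ideal I -> decomposable I.
Proof.
move=> hI; apply: contrapT => nI.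
pose T := {J | homog_ideal J /\ ~ decomposable J}.
have /choice[f hf] : forall J : T, exists J' : T,
    (forall p, sval J p -> sval J' p) /\ exists p, sval J' p /\ ~ sval J p.
  move=> [J [hJ nJ]] /=; apply: contrapT => nstep.
  have grow d g : g \is d.-homog -> ~ J g -> decomposable (adjoin J g).
    move=> hg nJg; apply: contrapT => ng; apply: nstep.
    exists (exist _ (adjoin J g) (conj (adjoin_homog hJ hg) ng)) => /=.
    split=> [p|]; first exact: adjoin_sub.
    by exists g; split => //; apply: adjoin_mem; case: hJ.
  apply: nJ; have [J1|nJ1] := pselect (J 1); first exact: Decomposable_unit.
  apply: contrapT => nJ; apply: (nJ); apply: Decomposable_prime.
  apply: homog_prime_criterion => // d e a b ha hb Jab.
  have [Ja|nJa] := pselect (J a); [by left | right].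
  apply: contrapT => nJb; apply: nJ.
  by apply: (Decomposable_split _ Jab); [case: hJ | exact: grow ha _ | exact: grow hb _].
pose c k := iter k f (exist _ I (conj hI nI) : T).
apply: (@no_infinite_chain K N (fun k => sval (c k))) => k.
- by case: (svalP (c k)) => -[].
- by case: (hf (c k)) => h _; exact: h.
- by case: (hf (c k)) => _.
Qed.

(** The primes at the leaves include the minimal primes over [I], possibly among others. *)
Lemma decomposable_primes I : decomposable I -> exists (m : nat) (P : nat -> S -> Prop),
  (forall i, (i < m)%N -> homog_prime (P i) /\ forall p, I p -> P i p) /\
  forall Q, is_prime Q -> (forall p, I p -> Q p) ->
    exists2 i, (i < m)%N & forall p, P i p -> Q p.
Proof.
elim=> {I} [I I1|I hI|I a b iI Iab _ [m1 [P1 [h1 min1]]] _ [m2 [P2 [h2 min2]]]].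
- exists 0%N, (fun=> I); split=> // Q [_ nQ1 _] /(_ _ I1).
  by [].
- by exists 1%N, (fun=> I); split=> // Q hQ IQ; exists 0%N.
exists (m1 + m2)%N, (fun i => if (i < m1)%N then P1 i else P2 (i - m1)%N).
split=> [i lt_i|Q hQ IQ].
  case: ltnP => [lt|le].
    by have [hP sP] := h1 i lt; split=> // p Ip; apply: sP; exact: adjoin_sub.
  have [|hP sP] := h2 (i - m1)%N; first by rewrite ltn_subLR.
  by split=> // p Ip; apply: sP; exact: adjoin_sub.
have [iQ _ pQ] := hQ; have [Qa|Qb] := pQ _ _ (IQ _ Iab).
  have [i lt_i sQ] := min1 Q hQ (adjoin_min iQ IQ Qa).
  by exists i; [rewrite ltn_addr | rewrite lt_i].
have [i lt_i sQ] := min2 Q hQ (adjoin_min iQ IQ Qb).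
by exists (m1 + i)%N; [rewrite ltn_add2l | rewrite ltnNge leq_addr addKn].
Qed.

Lemma mnm_split (m : 'X_{1..N}) k : (k <= mdeg m)%N ->
  exists m1 m2 : 'X_{1..N}, m = (m1 + m2)%MM /\ mdeg m1 = k.
Proof.
elim: k => [|k IH] le_k; first by exists 0%MM, m; rewrite add0m mdeg0.
have [m1 [m2 [mE m1k]]] := IH (ltnW le_k).
have : m2 != 0%MM by apply: contraTneq le_k => m20; rewrite mE m20 addm0 m1k ltnn.
rewrite -mdeg_eq0 mdegE sum_nat_eq0 negb_forall => /existsP[i] /=.
rewrite -lep1mP => le_i.
exists (m1 + U_(i))%MM, (m2 - U_(i))%MM; split; last by rewrite mdegD m1k mdeg1 addn1.
by rewrite -addmA [(U_(i) + _)%MM]addmC submK.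
Qed.

Lemma mem_variables_monomial P (m : 'X_{1..N}) :
  is_ideal P -> (forall i, P 'X_i) -> (0 < mdeg m)%N -> P 'X_[m].
Proof.
move=> iP hP; rewrite lt0n mdegE sum_nat_eq0 negb_forall => /existsP[i] /=.
by rewrite -lep1mP => /submK <-; rewrite mpolyXD; exact: ideal_mull.
Qed.

(** An ideal without projective zeros contains all monomials of large degree. At a splitting, a
    monomial of degree at least [Ma + Mb] is a product of one in [adjoin I a] and one in
    [adjoin I b], and [a * b] is in [I]. *)
Lemma decomposable_irrelevant I : decomposable I ->
  (forall P, homog_prime P -> (forall p, I p -> P p) -> forall i, P 'X_i) ->
  is_ideal I ->
  exists M, forall m : 'X_{1..N}, (M <= mdeg m)%N -> I 'X_[m].
Proof.
elim=> {I} [I I1 _ iI|I hI irr [iI0 iI1]|I a b _ Iab _ IHa _ IHb irr iI].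
- by exists 0%N => m _; rewrite -[X in I X]mulr1; exact: ideal_mull.
- by exists 1%N => m; apply: mem_variables_monomial => //; exact: irr.
have irr_adj g P : homog_prime P -> (forall p, adjoin I g p -> P p) -> forall i, P 'X_i.
  by move=> hP sP; apply: irr => // p Ip; apply: sP; exact: adjoin_sub.
have [Ma hMa] := IHa (irr_adj a) (adjoin_ideal a iI).
have [Mb hMb] := IHb (irr_adj b) (adjoin_ideal b iI).
exists (Ma + Mb)%N => m le_m.
have [|m1 [m2 [mE m1k]]] := @mnm_split m Ma.
  exact: leq_trans (leq_addr _ _) le_m.
have [|q hq] := hMa m1; first by rewrite m1k.
have [|q' hq'] := hMb m2.
  by move: le_m; rewrite mE mdegD m1k leq_add2l.
rewrite mE mpolyXD.
have -> : 'X_[m1] * 'X_[m2] = 'X_[m2] * ('X_[m1] - q * a) +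
   ((q * a) * ('X_[m2] - q' * b) + q * q' * (a * b)) by ring.
by apply: ideal_add => //; [|apply: ideal_add => //]; exact: ideal_mull.
Qed.

End Decomposition.

(** * Projective dimension through chains of homogeneous primes *)

Section HomogeneousChains.
Variables (K : numFieldType) (N : nat).
Local Notation S := {mpoly K[N]}.
Implicit Types (I J P : S -> Prop).

Definition relevant P := exists i : 'I_N, ~ P 'X_i.

(** These are chains of irreducible closed subsets of the projective zero set of [I]:
    [~ homog_chain I r] says that this set has dimension less than [r], and for [r = 0] that it is
    empty. *)
Definition homog_chain I r := exists P : nat -> S -> Prop,
  (forall i, (i <= r)%N ->
     [/\ homog_prime (P i), relevant (P i) & forall p, I p -> P i p]) /\
  forall i, (i < r)%N ->
     (forall p, P i p -> P i.+1 p) /\ exists p, P i.+1 p /\ ~ P i p.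

Lemma chain_mono (P : nat -> S -> Prop) r :
  (forall i, (i < r)%N -> forall p, P i p -> P i.+1 p) ->
  forall i j, (i <= j <= r)%N -> forall p, P i p -> P j p.
Proof.
move=> hP i j /andP[/subnKC <-]; elim: (j - i)%N => [|l IH]; first by rewrite addn0.
by rewrite addnS => lt_r p Pip; apply: hP => //; apply: IH => //; exact: ltnW.
Qed.

Lemma homog_chain_cons I r P0 p0 (P : nat -> S -> Prop) :
  [/\ homog_prime P0, relevant P0 & forall p, I p -> P0 p] ->
  (forall p, P0 p -> P 0%N p) -> P 0%N p0 -> ~ P0 p0 ->
  (forall i, (i <= r)%N -> [/\ homog_prime (P i), relevant (P i) & forall p, I p -> P i p]) ->
  (forall i, (i < r)%N -> (forall p, P i p -> P i.+1 p) /\ exists p, P i.+1 p /\ ~ P i p) ->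
  homog_chain I r.+1.
Proof.
move=> hP0 s0 Pp0 nPp0 hP hstep.
exists (fun i => if i is j.+1 then P j else P0); split=> [[|i]|[|i]] //.
- by rewrite ltnS; exact: hP.
- by move=> _; split=> //; exists p0.
- by rewrite ltnS; exact: hstep.
Qed.

(** Choose [g] in [V] outside every leaf prime of [I] that does not contain [V]. A chain over
    [adjoin I g] starts above some leaf prime [P i]. If [P i] contains [V], the chain lies over [J];
    otherwise [P i] does not contain [g] and can be put in front, which gives a longer chain over
    [I]. *)
Lemma generic_section I J (V : S -> Prop) r : homog_ideal I -> lin_closed V ->
  ~ homog_chain I r.+1 -> ~ homog_chain J r ->
  (forall P, homog_prime P -> relevant P -> (forall p, I p -> P p) ->
     (forall v, V v -> P v) -> forall p, J p -> P p) ->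
  exists2 g, V g & ~ homog_chain (adjoin I g) r.
Proof.
move=> hI hV nI nJ hJ.
have [m [P [hP minP]]] := decomposable_primes (homog_ideal_decomposable hI).
have [i lt_i|g Vg hg] := subspace_avoidance (U := P) (m := m) hV.
  by apply: ideal_lin; have [[[]]] := hP i lt_i.
exists g => // -[Q [hQ hstep]].
have [[pQ _] [x nQx] IQ] := hQ 0%N isT.
have [|i lt_i sQ] := minP (Q 0%N) pQ.
  by move=> p Ip; apply: IQ; exact: adjoin_sub.
have [hPi IPi] := hP i lt_i.
have rel_Pi : relevant (P i) by exists x => /sQ.
have [VP|/existsNP[v /not_implyP[Vv nPv]]] := pselect (forall v, V v -> P i v).
  apply: nJ; exists Q; split=> // j le_j; have [hQj rQj _] := hQ j le_j; split=> //.
  move=> p Jp; apply: (@chain_mono Q r _ 0%N j) => //.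
    by move=> k /hstep[].
  by apply: sQ; exact: (hJ (P i)).
apply: nI; apply: (@homog_chain_cons I r (P i) g Q) => //.
- by apply: IQ; apply: adjoin_mem; case: hI.
- by apply: hg => //; exists v.
- by move=> j /hQ[? ? IQj]; split=> // p Ip; apply: IQj; exact: adjoin_sub.
Qed.

End HomogeneousChains.

(** * Lengths of chains of primes *)

Section ChainBound.
Variables (K : fieldType) (N : nat).
Local Notation S := {mpoly K[N]}.
Implicit Types (P Q : S -> Prop).

(** A lower bound [s] for the Hilbert function of the quotient by [P]. *)
Definition indep_size P s D := exists (X : finType) (b : X -> S),
  [/\ #|X| = s, forall x, (msize (b x) <= D)%N & indep_mod P b].

(** The family consists of the [F ^+ e * b x] with [e < m]. Its coefficients vanish by induction on
    [e]: the prime [P] allows division by [F ^+ e], and modulo [P'], which contains [F], only the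
    terms of exponent [e] remain. *)
Lemma indep_size_step P P' F m s D : is_prime P -> (forall p, P p -> P' p) ->
  is_prime P' -> P' F -> ~ P F ->
  indep_size P' s D -> indep_size P (m * s) (m * msize F + D).
Proof.
move=> [iP nP1 pP] PP' [iP' _ _] P'F nPF [X [b [cardX size_b b_indep]]].
exists ('I_m * X)%type, (fun z : 'I_m * X => F ^+ z.1 * b z.2); split=> [|[e x]|c hc].
- by rewrite card_prod card_ord cardX.
- have sF : (msize F <= (msize F).-1.+1)%N by exact: leqSpred.
  rewrite mulrC addnC; apply: msizeM_leq => //.
  apply: leq_trans (msizeX_leq e sF) _; rewrite ltnS mulnC leq_mul ?leq_pred //.
  exact: ltnW.
suff H e : (e <= m)%N -> forall z : 'I_m * X, (z.1 < e)%N -> c z = 0.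
  by move=> z; apply: (H m).
elim: e => [//|e IH] lt_em; have {}IH := IH (ltnW lt_em).
suff c0 x : c (Ordinal lt_em, x) = 0.
  move=> [i x] /=; rewrite ltnS leq_eqVlt => /orP[/eqP ei|lt_ie]; last exact: IH.
  by rewrite (_ : i = Ordinal lt_em) //; exact: val_inj.
apply: (b_indep (fun x => c (Ordinal lt_em, x))).
pose rest := \sum_(i < m | (e < i)%N) \sum_x c (i, x) *: (F ^+ (i - e.+1) * b x).
have sumE : \sum_z c z *: (F ^+ z.1 * b z.2) =
    F ^+ e * (\sum_x c (Ordinal lt_em, x) *: b x + F * rest).
  rewrite (eq_bigr (fun z => c (z.1, z.2) *: (F ^+ z.1 * b z.2))) => [|[] //].
  rewrite -(pair_bigA _ (fun i x => c (i, x) *: (F ^+ i * b x))) /=.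
  rewrite mulrDr (bigD1 (Ordinal lt_em)) //=; congr (_ + _).
    by rewrite mulr_sumr; apply: eq_bigr => y _; rewrite scalerAr.
  rewrite (bigID (fun i : 'I_m => (i < e)%N)) /= big1 ?add0r => [|i /andP[_ lt_ie]].
    rewrite /rest !mulr_sumr; apply: eq_big => [i|i /andP[ni le_ei]].
      by rewrite -leqNgt ltn_neqAle -val_eqE /= eq_sym.
    have lt_ei : (e < i)%N.
      by move: ni le_ei; rewrite -val_eqE /= -leqNgt ltn_neqAle eq_sym => -> ->.
    rewrite !mulr_sumr; apply: eq_bigr => y _.
    rewrite -!scalerAr; congr (_ *: _); rewrite !mulrA -exprSr -exprD.
    by rewrite subnKC.
  by apply: big1 => y _; rewrite (IH (i, y)) ?scale0r.
have nPFe k : ~ P (F ^+ k).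
  elim: k => [|k IHk]; first by rewrite expr0.
  by rewrite exprS => /pP[].
move: hc; rewrite sumE => /pP[/nPFe //|/PP' h].
by rewrite -[\sum_x _](addrK (F * rest)); apply: ideal_sub => //; exact: ideal_mulr.
Qed.

(* The polynomials in the variables of [A] embed in the quotient by [P]. *)
Definition independent_variables P (A : {set 'I_N}) := forall Q : S, P Q ->
  (forall m, m \in msupp Q -> forall i, i \notin A -> m i = 0%N) -> Q = 0.

Lemma indep_size_variables P A m : independent_variables P A ->
  indep_size P (m ^ #|A|) (m * #|A|).+1.
Proof.
move=> hA; pose X := {ffun {i | i \in A} -> 'I_m}.
pose mm (e : X) : 'X_{1..N} :=
  [multinom oapp (fun i => nat_of_ord (e i)) 0%N (insub i) | i < N].
have mmE e (i : {i | i \in A}) : mm e (val i) = e i by rewrite mnmE valK.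
have mm_inj : injective mm.
  move=> e e' h; apply/ffunP => i; apply: val_inj.
  by rewrite /= -!mmE h.
have card_A : #|{: {i | i \in A}}| = #|A| by rewrite card_sig.
exists X, (fun e => 'X_[mm e]); split=> [|e|c hc e].
- by rewrite card_ffun card_ord card_A.
- rewrite msizeX ltnS mdegE (bigID (mem A)) /= [X in (_ + X)%N]big1 ?addn0; last first.
    by move=> i niA; rewrite mnmE insubN.
  apply: (@leq_trans (\sum_(i in A) m)); last by rewrite sum_nat_const mulnC.
  apply: leq_sum => i iA; rewrite mnmE insubT //=.
  exact: ltnW.
have cE : (\sum_e c e *: 'X_[mm e])@_(mm e) = c e.
  rewrite raddf_sum /= (bigD1 e) //= mcoeffZ mcoeffX eqxx mulr1 big1 ?addr0 // => e' ne.
  by rewrite mcoeffZ mcoeffX (inj_eq mm_inj) (negPf ne) mulr0.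
rewrite -cE (hA _ hc) ?mcoeff0 // => l.
rewrite mcoeff_msupp raddf_sum /= => nz i niA.
have [e' /eqP ee] : exists e', mm e' == l.
  apply/existsP; apply: contraNT nz; rewrite negb_exists => /forallP h.
  by rewrite big1 // => e' _; rewrite mcoeffZ mcoeffX (negPf (h e')) mulr0.
by rewrite -ee mnmE insubN.
Qed.

(* Counting the monomials in the [A]-variables and in the successive elements
   [F i] of [P i.+1] outside [P i]. *)
Lemma chain_bound (P : nat -> S -> Prop) c (A : {set 'I_N}) :
  (forall i, (i <= c)%N -> is_prime (P i)) ->
  (forall i, (i < c)%N ->
     (forall p, P i p -> P i.+1 p) /\ exists p, P i.+1 p /\ ~ P i p) ->
  independent_variables (P c) A -> (c + #|A| <= N)%N.
Proof.
move=> hP hstep hA.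
suff H j : (j <= c)%N -> exists E, forall m, (0 < m)%N ->
    indep_size (P (c - j)%N) (m ^ (j + #|A|)) (m * E).
  have [E hE] := H c (leqnn c); rewrite subnn in hE.
  rewrite leqNgt; apply/negP => lt_N.
  have bound m : (0 < m)%N -> (m ^ (c + #|A|) <= (m * E) ^ N)%N.
    move=> m_gt0; have [X [b [<- size_b b_indep]]] := hE m m_gt0.
    apply: leq_trans (card_bmultinom_leq N (m * E)).
    apply: (leq_card_indep_spans (U := P 0%N) (b := fun mm : 'X_{1..N < m * E} => 'X_[mm])
      _ b_indep) => [|x].
      by apply: ideal_lin; have [] := hP 0%N isT.
    exists (fun mm => (b x)@_(val mm)); rewrite -(mpolywE (size_b x)) subrr.
    by have [[h0 _] _ _] := hP 0%N isT.
  (* If [c + #|A|] exceeded [N], the left side would grow in [m] at least as [m ^ N.+1], and the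
     right side is [m ^ N * E ^ N]; the value [(E ^ N).+1] is large enough to separate them. *)
  have := bound (E ^ N).+1 isT; rewrite expnMn leqNgt => /negP; apply.
  apply: (@leq_trans ((E ^ N).+1 ^ N.+1)); last exact: leq_pexp2l.
  by rewrite expnSr ltn_pmul2l ?expn_gt0.
elim: j => [|j IH] lt_jc.
  exists #|A|.+1 => m m_gt0; rewrite subn0.
  have [X [b [cX sb ib]]] := indep_size_variables m hA.
  exists X, b; split=> // x; apply: leq_trans (sb x) _.
  by rewrite mulnS -add1n leq_add2r.
have [E hE] := IH (ltnW lt_jc).
have [|PP' [F [P'F nPF]]] := hstep (c - j.+1)%N; first by rewrite -subSn ?subSS ?leq_subr.
have e : (c - j.+1).+1 = (c - j)%N by rewrite -subSn ?subSS.
rewrite e in PP' P'F.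
exists (msize F + E)%N => m m_gt0; rewrite addSn expnS mulnDr.
apply: indep_size_step PP' _ P'F nPF _.
- by apply: hP; exact: leq_subr.
- by apply: hP; exact: leq_subr.
- exact: hE.
Qed.

End ChainBound.

(** The zero ideal can be put in front of the chain because [f] is nonzero, and a variable outside
    the last prime is independent modulo it. Hence [r.+1 + 1 <= N.+1]. *)
Lemma homog_chain_bound (K : numFieldType) N (I : {mpoly K[N.+1]} -> Prop) f r :
  I f -> f != 0 -> homog_chain I r -> (r < N)%N.
Proof.
move=> If f0 [P [hP hstep]].
pose P' i := if i is j.+1 then P j else fun p : {mpoly K[N.+1]} => p = 0.
have prime0 : is_prime (fun p : {mpoly K[N.+1]} => p = 0).
  split=> [||a b /eqP]; last by rewrite mulf_eq0 => /orP[] /eqP; [left | right].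
    by split=> // a u v -> ->; rewrite mulr0 addr0.
  by apply/eqP; exact: oner_neq0.
have [[pr hr] [x nx] _] := hP r (leqnn r).
have := @chain_bound K N.+1 P' r.+1 [set x].
rewrite cards1 addn1 ltnS; apply.
- by case=> [|i] // /hP[[]].
- case=> [_|i]; last exact: hstep.
  have [[[iP _ _] _] _ IP] := hP 0%N isT.
  by split=> [p ->|]; [case: iP | exists f; split; [exact: IP | exact/eqP]].
move=> Q PQ hQ.
(* A homogeneous component of [Q] is a multiple of a power of ['X_x]. *)
apply/mpolyP => m; rewrite mcoeff0; apply: contrapT => /eqP nz.
have mE l : l \in msupp Q -> l = (U_(x) *+ mdeg l)%MM.
  move=> lQ; apply/mnmP => i; rewrite mulmnE mnm1E.
  have l0 j : j != x -> l j = 0%N by move=> nj; apply: hQ => //; rewrite inE.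
  have [<-|nxi] := eqVneq x i; last by rewrite mul0n l0 // eq_sym.
  by rewrite mul1n mdegE (bigD1 x) //= big1 ?addn0 // => j; exact: l0.
have hm := hr _ PQ (mdeg m).
have compE : pihomog mdeg (mdeg m) Q = Q@_m *: 'X_x ^+ mdeg m.
  apply/mpolyP => l; rewrite mcoeff_pihomog mcoeffZ mpolyXn mcoeffX.
  have mm := mE m; rewrite mcoeff_msupp nz in mm; rewrite -mm //.
  have [-> |ne] := eqVneq m l; first by rewrite eqxx mulr1.
  rewrite mulr0; case: eqP => // el; apply: memN_msupp_eq0.
  by apply: contra_neqN ne => lQ; rewrite (mE l lQ) el -mm.
have [iP _ pP] := pr.
have : P r ('X_x ^+ mdeg m).
  rewrite -[_ ^+ _]scale1r -(mulVf nz) -scalerA -compE.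
  by apply: lin_closedZ => //; exact: ideal_lin.
have nP k : ~ P r ('X_x ^+ k).
  elim: k => [|k IH]; first by rewrite expr0; case: pr.
  by rewrite exprS => /pP[].
exact: nP.
Qed.

(** * The Jacobian criterion *)

Section LinearSystems.
Variables (K : fieldType) (N : nat).
Local Notation S := {mpoly K[N]}.
Variable P : S -> Prop.
Hypothesis hP : is_prime P.

Lemma linear_system_mod_prime (J : finType) (k : nat) (C : {set J})
    (R : nat -> J -> S) : (k < #|C|)%N ->
  exists v : J -> S, [/\ forall j, j \notin C -> v j = 0, exists j, ~ P (v j)
    & forall i, (i < k)%N -> P (\sum_j R i j * v j)].
Proof.
have [iP nP1 pP] := hP.
elim: k C R => [|k IH] C R lt_kC.
  have /card_gt0P[j0 j0C] := lt_kC.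
  exists (fun j => (j == j0)%:R); split=> [j|| //].
    by case: eqP => // ->; rewrite j0C.
  by exists j0; rewrite eqxx.
have [allP|/existsNP[j0 /not_implyP[j0C nPa]]] :=
    pselect (forall j, j \in C -> P (R k j)).
  have [v [v0 vnP hv]] := IH C R (ltnW lt_kC).
  exists v; split=> // i; rewrite ltnS leq_eqVlt => /orP[/eqP ->|]; last exact: hv.
  apply: ideal_sum => // j _; have [/allP h|/v0 ->] := boolP (j \in C).
    exact: ideal_mulr.
  by rewrite mulr0; case: iP.
set a := R k j0 in nPa.
pose R' i j := a * R i j - R i j0 * R k j.
have [|v [v0 [j1 vnP] hv]] := IH (C :\ j0) R'.
  by move: lt_kC; rewrite (cardsD1 j0) j0C.
have vj0 : v j0 = 0 by apply: v0; rewrite !inE eqxx.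
pose w j := if j == j0 then - \sum_j R k j * v j else a * v j.
have wE i : \sum_j R i j * w j = a * (\sum_j R i j * v j) - R i j0 * \sum_j R k j * v j.
  rewrite (bigD1 j0) //= /w eqxx [in X in a * X](bigD1 j0) //= vj0 mulr0 add0r.
  rewrite mulrN addrC [a * _]mulr_sumr; congr (_ - _); apply: eq_bigr => j /negPf ->.
  by rewrite mulrCA.
exists w; split=> [j jC||i].
- have nj : j != j0 by apply: contraNneq jC => ->.
  by rewrite /w (negPf nj) v0 ?mulr0 // !inE (negPf jC) andbF.
- exists j1; have nj : j1 != j0 by apply: contra_notN vnP => /eqP ->; rewrite vj0; case: iP.
  by rewrite /w (negPf nj) => /pP[].
rewrite wE ltnS leq_eqVlt => /orP[/eqP ->|/hv].
  by rewrite subrr; case: iP.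
rewrite /R'; under eq_bigr do rewrite mulrBl -!mulrA.
by rewrite sumrB -!mulr_sumr.
Qed.

End LinearSystems.

Section Derivations.
Variables (K : numFieldType) (N : nat).
Local Notation S := {mpoly K[N]}.

Definition derivation (v : 'I_N -> S) (p : S) := \sum_j v j * p^`M(j).

Lemma derivationD v p q : derivation v (p + q) = derivation v p + derivation v q.
Proof.
by rewrite /derivation -big_split; apply: eq_bigr => j _; rewrite mderivD mulrDr.
Qed.

Lemma derivationM v p q : derivation v (p * q) = derivation v p * q + p * derivation v q.
Proof.
rewrite /derivation mulr_suml mulr_sumr -big_split; apply: eq_bigr => j _ /=.
by rewrite mderivM; ring.
Qed.

Lemma derivation_sum v (T : Type) (r : seq T) (F : T -> S) :
  derivation v (\sum_(i <- r) F i) = \sum_(i <- r) derivation v (F i).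
Proof.
elim: r => [|i r IH]; last by rewrite !big_cons derivationD IH.
by rewrite !big_nil /derivation big1 // => j _; rewrite mderiv0 mulr0.
Qed.

Lemma msize_mderiv (p : S) i : p != 0 -> (msize p^`M(i) < msize p)%N.
Proof.
move=> p0; rewrite -[X in (_ < X)%N]prednK ?lt0n ?msize_poly_eq0 // ltnS.
rewrite [X in (X <= _)%N]msizeE; apply/bigmax_leqP_seq => m.
rewrite mcoeff_msupp mcoeff_deriv => nz _.
have /msize_mdeg_lt : (m + U_(i))%MM \in msupp p.
  by rewrite mcoeff_msupp; apply: contraNneq nz => ->; rewrite mul0rn.
by rewrite mdegD mdeg1 addn1; case: (msize p).
Qed.

(* A derivation preserving [P] is determined, modulo [P], by its values on a
   maximal set of variables that are algebraically independent modulo [P]: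
   apply it to an algebraic relation of minimal degree. *)
Lemma derivation_in_prime (P : S -> Prop) (A : {set 'I_N}) v : is_prime P ->
  independent_variables P A ->
  (forall j, j \notin A -> ~ independent_variables P (j |: A)) ->
  (forall p, P p -> P (derivation v p)) ->
  (forall i, i \in A -> P (v i)) -> forall j, P (v j).
Proof.
move=> [iP nP1 pP] indA maxA vP vA j.
have [/vA //|njA] := boolP (j \in A).
pose rel n := exists Q : S, [/\ msize Q = n, Q != 0, P Q
  & forall m, m \in msupp Q -> forall i, i \notin j |: A -> m i = 0%N].
have exrel : exists n, `[< rel n >].
  have /existsNP[Q /not_implyP[PQ /not_implyP[suppQ /eqP Q0]]] := maxA _ njA.
  by exists (msize Q); apply/asboolP; exists Q.
case: (ex_minnP exrel) => n /asboolP[Q [sQ Q0 PQ suppQ]] nmin.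
have nPd : ~ P Q^`M(j).
  move=> Pd; have [d0|d0] := eqVneq (Q^`M(j)) 0; last first.
    have : (n <= msize Q^`M(j))%N.
      apply: nmin; apply/asboolP; exists Q^`M(j); split=> // m.
      rewrite mcoeff_msupp mcoeff_deriv => nz i ni.
      have /suppQ /(_ i ni) : (m + U_(j))%MM \in msupp Q.
        by rewrite mcoeff_msupp; apply: contraNneq nz => ->; rewrite mul0rn.
      by rewrite mnmDE => /eqP; rewrite addn_eq0 => /andP[/eqP].
    by rewrite leqNgt -sQ msize_mderiv.
  case/eqP: Q0; apply: indA => // m mQ i niA.
  have [->|nij] := eqVneq i j; last by apply: suppQ mQ _ _; rewrite !inE negb_or nij.
  apply: contraTeq mQ => mj; rewrite -mcoeff_eq0.
  have le_j : (U_(j) <= m)%MM by rewrite lep1mP.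
  have := congr1 (mcoeff (m - U_(j))%MM) d0.
  rewrite mcoeff0 mcoeff_deriv submK // => /eqP.
  by rewrite mulrn_eq0.
have := vP Q PQ; rewrite /derivation (bigD1 j) //= addrC => h.
have /pP[] // : P (v j * Q^`M(j)).
apply: ideal_addl h => //; apply: ideal_sum => // i nij.
have [iA|niA] := boolP (i \in A); first by apply: ideal_mulr => //; exact: vA.
have -> : Q^`M(i) = 0; last by rewrite mulr0; case: iP.
apply/mpolyP => m; rewrite mcoeff0 mcoeff_deriv.
apply/eqP; rewrite mulrn_eq0 /= mcoeff_eq0; apply/negP => /suppQ /(_ i).
by rewrite !inE negb_or nij niA => /(_ isT); rewrite mnmDE mnm1E eqxx addn1.
Qed.

(** Such a set is a transcendence basis of the fraction field of the quotient by [P]. *)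
Lemma exists_max_independent_variables (P : S -> Prop) : is_prime P ->
  exists A : {set 'I_N}, independent_variables P A /\
    forall j, j \notin A -> ~ independent_variables P (j |: A).
Proof.
move=> [iP nP1 _].
pose ind (A : {set 'I_N}) := `[< independent_variables P A >].
have ind0 : ind finset.set0.
  apply/asboolP => Q PQ suppQ; apply/mpolyP => m; rewrite mcoeff0.
  apply: contrapT => /eqP; rewrite -mcoeff_msupp => mQ.
  have all0 l : l \in msupp Q -> l = 0%MM.
    by move=> lQ; apply/mnmP => i; rewrite mnm0E; apply: suppQ lQ _ _; rewrite inE.
  have QE : Q = (Q@_0%MM)%:MP.
    apply: msize1_polyC; rewrite msizeE; apply/bigmax_leqP_seq => l /all0 -> _.
    by rewrite mdeg0.
  have c0 : Q@_0%MM != 0 by rewrite -mcoeff_msupp -(all0 m mQ).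
  apply: nP1; have -> : 1 = (Q@_0%MM)^-1%:MP * Q.
    by rewrite {2}QE -mpolyCM mulVf // mpolyC1.
  exact: ideal_mull.
have [A /maxsetP[/asboolP indA maxA] _] := maxset_exists ind0.
exists A; split=> // j njA indjA.
have := maxA (j |: A) (introT (asboolP _) indjA) (finset.subsetUr _ _).
by move=> e; move: njA; rewrite -e !inE eqxx.
Qed.

End Derivations.

(* [A] is the localization of [K[X] / (f)] at the prime ideal of the
   polynomials mapped to nonunits. *)
Section LocalPresentation.
Variables (K : numFieldType) (N : nat) (A : comNzRingType).
Local Notation S := {mpoly K[N]}.
Variables (chi : {rmorphism S -> A}) (f : S).

Definition center (g : S) : Prop := max_ideal (chi g).

Definition local_presentation :=
  [/\ is_prime center,
      forall a : A, exists g h, ~ center h /\ a * chi h = chi g,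
      forall g, chi g = 0 -> exists h b, ~ center h /\ g * h = f * b
    & chi f = 0].

Hypothesis hchi : local_presentation.

Let prime_center : is_prime center. Proof. by case: hchi. Qed.
Let frac a : exists g h, ~ center h /\ a * chi h = chi g.
Proof. by case: hchi. Qed.

Lemma notin_centerP h : ~ center h <-> exists b, chi h * b = 1.
Proof. by split=> [/contrapT|h1 h2]. Qed.

Lemma notin_centerM h k : ~ center h -> ~ center k -> ~ center (h * k).
Proof. by move=> nh nk; case: prime_center => _ _ pc /pc[]. Qed.

Lemma max_idealE a g h : ~ center h -> a * chi h = chi g -> (max_ideal a <-> center g).
Proof.
move=> /notin_centerP[b hb] e; split=> ha [c hc]; apply: ha.
  by exists (chi h * c); rewrite mulrA e.
by exists (c * b); rewrite -e mulrACA hc hb mulr1.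
Qed.

Lemma max_idealM a b : max_ideal b -> max_ideal (a * b : A).
Proof. by move=> hb [c hc]; apply: hb; exists (a * c); rewrite mulrA [b * a]mulrC. Qed.

Lemma max_idealD a b : max_ideal a -> max_ideal b -> max_ideal (a + b : A).
Proof.
have [g [h [nh e]]] := frac a; have [g' [h' [nh' e']]] := frac b.
move=> /(max_idealE nh e) cg /(max_idealE nh' e') cg'.
have [iC _ _] := prime_center.
apply/(@max_idealE _ (g * h' + g' * h) (h * h')).
- exact: notin_centerM.
- by rewrite mulrDl !rmorphD !rmorphM /= -e -e'; ring.
- by apply: (ideal_add iC); apply: (ideal_mulr _ iC).
Qed.

Lemma max_ideal0 : max_ideal (0 : A).
Proof. by move=> [b]; rewrite mul0r => /eqP; rewrite eq_sym oner_eq0. Qed.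

Lemma max_ideal_sum (T : eqType) (r : seq T) (F : T -> A) :
  (forall i, i \in r -> max_ideal (F i)) -> max_ideal (\sum_(i <- r) F i).
Proof.
move=> h; rewrite big_seq; elim/big_ind : _ => //; first exact: max_ideal0.
exact: max_idealD.
Qed.

Lemma ideal_pow1P a : ideal_pow (@max_ideal A) 1 a <-> max_ideal a.
Proof.
split=> [[s [hs ->]]|ha].
  apply: (@max_ideal_sum (A * A)%type s (fun p => p.1 * p.2)) => p /hs[h _].
  by rewrite mulrC; exact: max_idealM.
exists [:: (a, 1)]; split=> [p|]; last by rewrite big_seq1 mulr1.
by rewrite inE => /eqP ->.
Qed.

Section NotRegular.
Hypothesis f_neq0 : f != 0.
Hypothesis df : forall i, center f^`M(i).

(** An ideal that contains [f] and the square of the center, and that every derivation maps into the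
    center. *)
Let crit (q : S) := center q /\ forall i, center q^`M(i).

Let crit_ideal : is_ideal crit.
Proof.
have [iC _ _] := prime_center; have [c0 cD] := iC.
split=> [|a u v [hu du] [hv dv]]; first by split=> [//|i]; rewrite mderiv0.
split=> [|i]; first exact: cD.
rewrite mderivD mderivM; apply: (ideal_add iC) => //.
by apply: (ideal_add iC); apply: (ideal_mull _ iC).
Qed.

Let crit_mul p q : center p -> center q -> crit (p * q).
Proof.
have [iC _ _] := prime_center => hp hq; split=> [|i]; first exact: (ideal_mull _ iC).
rewrite mderivM; apply: (ideal_add iC); first exact: (ideal_mull _ iC).
exact: (ideal_mulr _ iC).
Qed.

Let crit_f : crit f.
Proof.
split=> //; have [_ _ _ chif] := hchi.
by rewrite /center chif; exact: max_ideal0.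
Qed.

Variables (d : nat) (e : 'I_d -> A) (g h : 'I_d -> S).
Hypothesis he : forall i, ~ center (h i) /\ e i * chi (h i) = chi (g i).

(* The fractions with numerator in the ideal of the [g i], up to [crit]. *)
Let lset (a : A) := exists k c q, [/\ ~ center k, crit q &
  a * chi k = chi (\sum_i c i * g i + q)].

Let lsetD a b : lset a -> lset b -> lset (a + b).
Proof.
move=> [k [c [q [nk cq ek]]]] [k' [c' [q' [nk' cq' ek']]]].
exists (k * k'), (fun i => c i * k' + c' i * k), (q * k' + q' * k); split.
- exact: notin_centerM.
- by apply: (ideal_add crit_ideal); apply: (ideal_mulr _ crit_ideal).
under eq_bigr do rewrite mulrDl -!mulrA ![_ * g _]mulrC !mulrA.
rewrite big_split /= -!mulr_suml.
rewrite (_ : _ + _ + _ = (\sum_i c i * g i + q) * k' + (\sum_i c' i * g i + q') * k).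
  by rewrite rmorphD !rmorphM /= -ek -ek'; ring.
by ring.
Qed.

Let lsetM a b : lset b -> lset (a * b).
Proof.
have [p [k' [nk' ek']]] := frac a.
move=> [k [c [q [nk cq ek]]]].
exists (k' * k), (fun i => p * c i), (p * q); split.
- exact: notin_centerM.
- exact: (ideal_mull _ crit_ideal).
under eq_bigr do rewrite -mulrA.
by rewrite -mulr_sumr -mulrDr !rmorphM /= -ek -ek'; ring.
Qed.

Let lset_crit q : crit q -> lset (chi q).
Proof.
move=> cq; exists 1, (fun=> 0), q; split=> //; first by case: prime_center.
by rewrite rmorph1 mulr1 big1 ?add0r // => i _; rewrite mul0r.
Qed.

Let lset_e i : lset (e i).
Proof.
have [nh ei] := he i.
exists (h i), (fun j => (j == i)%:R), 0; split=> //; first by case: crit_ideal.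
rewrite addr0 (bigD1 i) //= eqxx mul1r big1 ?addr0 // => j /negPf ->.
by rewrite mul0r.
Qed.

Let lset_div a k : ~ center k -> lset (a * chi k) -> lset a.
Proof.
move=> /notin_centerP[b hb] /(lsetM b).
by rewrite mulrCA [b * _]mulrC hb mulr1.
Qed.

Let lset_pow2 a : ideal_pow (@max_ideal A) 2 a -> lset a.
Proof.
move=> [s [hs ->]]; rewrite big_seq; elim/big_ind : _ => //.
  by rewrite -(rmorph0 chi); apply: lset_crit; case: crit_ideal.
move=> p /hs[m1 /ideal_pow1P m2].
have [g1 [h1 [nh1 e1]]] := frac p.1; have [g2 [h2 [nh2 e2]]] := frac p.2.
apply: (@lset_div _ (h1 * h2)); first exact: notin_centerM.
rewrite rmorphM mulrACA e1 e2 -rmorphM; apply: lset_crit; apply: crit_mul.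
  exact/(max_idealE nh1 e1).
exact/(max_idealE nh2 e2).
Qed.

Hypothesis e_span : forall x, max_ideal x -> exists a : 'I_d -> A,
  ideal_pow (@max_ideal A) 2 (x - \sum_i a i * e i).

(** The [e i] generate the maximal ideal modulo its square. Clearing denominators turns this into a
    relation between polynomials up to a multiple of [f], which lies in [crit]. *)
Lemma center_mod_crit p : center p -> exists k c q,
  [/\ ~ center k, crit q & p * k = \sum_i c i * g i + q].
Proof.
move=> /e_span[a /lset_pow2 ha].
have : lset (chi p).
  rewrite -[chi p](subrK (\sum_i a i * e i)); apply: lsetD => //.
  elim/big_ind : _ => //; last by move=> i _; exact: lsetM.
  by rewrite -(rmorph0 chi); apply: lset_crit; case: crit_ideal.
move=> [k [c [q [nk cq ek]]]].
have [_ _ ker _] := hchi.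
have [|k' [b [nk' eb]]] := ker (p * k - (\sum_i c i * g i + q)).
  by rewrite rmorphB rmorphM /= ek subrr.
exists (k * k'), (fun i => c i * k'), (q * k' + b * f); split.
- exact: notin_centerM.
- by apply: (ideal_add crit_ideal); [exact: (ideal_mulr _ crit_ideal)
    | exact: (ideal_mull _ crit_ideal)].
under eq_bigr do rewrite mulrAC.
rewrite -mulr_suml mulrA.
have -> : p * k * k' = (p * k - (\sum_i c i * g i + q)) * k' +
  (\sum_i c i * g i + q) * k' by ring.
by rewrite eb; ring.
Qed.

(** Apply the derivation to the relation of [center_mod_crit]: all terms other than
    [derivation v p * k] are in the center, and [k] is not. *)
Lemma derivation_center v : (forall i, center (derivation v (g i))) ->
  (forall i, center (g i)) -> forall p, center p -> center (derivation v p).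
Proof.
have [iC nC1 pC] := prime_center.
move=> hv hg p cp; have [k [c [q [nk [cq dq] epk]]]] := center_mod_crit cp.
suff /pC[] : center (derivation v p * k) by [].
have : center (derivation v (p * k)).
  rewrite epk derivationD derivation_sum; apply: (ideal_add iC).
    apply: (ideal_sum _ iC) => i _; rewrite derivationM.
    by apply: (ideal_add iC); apply: (ideal_mull _ iC).
  by apply: (ideal_sum _ iC) => j _; exact: (ideal_mull _ iC).
by rewrite derivationM addrC; apply: (ideal_addl iC); exact: (ideal_mulr _ iC).
Qed.

End NotRegular.

(** If the Krull and embedding dimensions were both [d], the chain bound would give [d + #|V| < N]
    for a transcendence basis [V] of variables. So some derivation, nonzero modulo the center, maps
    the [g i] and the variables of [V] into the center; it then preserves the center, which
    contradicts [derivation_in_prime]. *)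
Lemma not_regular_local : f != 0 -> (forall i, center f^`M(i)) -> ~ regular_local A.
Proof.
move=> f0 df [d [[[Q hQ] _] [e [e1 e_span _]]]].
have [iC nC1 pC] := prime_center.
have /choice[gh hgh] : forall i, exists gh : S * S,
    ~ center gh.2 /\ e i * chi gh.2 = chi gh.1.
  by move=> i; have [g [h gh]] := frac (e i); exists (g, h).
pose g i := (gh i).1; pose h i := (gh i).2.
have cg i : center (g i).
  have [nh ei] := hgh i; apply/(max_idealE nh ei)/ideal_pow1P; exact: e1.
have [V [indV maxV]] := exists_max_independent_variables prime_center.
(* The preimages of the chain of [A], with the zero ideal in front; [f] makes this additional step
   strict. *)
pose P j := if j is i.+1 then fun p => chi p \in Q i else fun p : S => p = 0.
have prime_P j : is_prime (P j).
  case: j => [|i] /=; split=> //.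
  - by split=> // a u v -> ->; rewrite mulr0 addr0.
  - by apply/eqP; exact: oner_neq0.
  - by move=> a b /eqP; rewrite mulf_eq0 => /orP[] /eqP; [left | right].
  - split=> [|a u v]; first by rewrite rmorph0 idealr0.
    by rewrite rmorphD rmorphM /= => hu hv; rewrite rpredD // idealMr.
  - by rewrite rmorph1 idealr1.
  - by move=> a b; rewrite rmorphM prime_idealrM => /orP[]; [left | right].
have unit_notin i k : ~ center k -> chi k \notin Q i.
  move=> /notin_centerP[b hb]; apply/negP => /(idealMr b).
  by rewrite mulrC hb idealr1.
have step_P j : (j < d.+1)%N ->
    (forall p, P j p -> P j.+1 p) /\ exists p, P j.+1 p /\ ~ P j p.
  case: j => [_|i lt_id] /=.
    split=> [p ->|]; first by rewrite rmorph0 idealr0.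
    exists f; split; last exact/eqP.
    by case: hchi => _ _ _ ->; rewrite idealr0.
  have [sQ nsQ] := hQ i lt_id; split=> [p|]; first exact: sQ.
  have /existsNP[a /not_implyP[aQ naQ]] := nsQ.
  have [p [k [nk ea]]] := frac a.
  exists p; rewrite -ea; split; first by rewrite mulrC idealMr.
  by rewrite prime_idealrM (negPf (unit_notin i k nk)) orbF.
have : (d.+1 + #|V| <= N)%N.
  apply: (chain_bound (P := P)) => // R PR; apply: indV.
  by move=> [b hb]; move: PR => /= /(idealMr b); rewrite mulrC hb idealr1.
rewrite addSn => lt_N.
(* The first [d] equations concern the values of the derivation at the [g i], the other [#|V|] its
   values at the variables of [V]. *)
pose row i (j : 'I_N) : S := if insub i is Some i' then (g i')^`M(j)
  else (j == nth j (enum V) (i - d))%:R.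
have [|v [_ [j nvj] hv]] :=
  linear_system_mod_prime prime_center (C := finset.setT) (k := (d + #|V|)%N) row.
  by rewrite cardsT card_ord.
apply: nvj; apply: (derivation_in_prime prime_center indV maxV).
  move=> p; apply: (derivation_center df hgh) => // [x /ideal_pow1P|i].
    exact: e_span.
  have := hv i; rewrite ltn_addr // => /(_ isT); rewrite /row valK.
  by rewrite /derivation; under eq_bigr do rewrite mulrC.
move=> i iV; have := hv (d + index i (enum V))%N.
rewrite ltn_add2l cardE index_mem mem_enum iV => /(_ isT).
rewrite (bigD1 i) //= big1 => [|l nli].
  rewrite /row insubN -?leqNgt ?leq_addr // addKn nth_index ?mem_enum //.
  by rewrite eqxx mul1r addr0.
rewrite /row insubN -?leqNgt ?leq_addr // addKn nth_index ?mem_enum //.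
by rewrite (negPf nli) mul0r.
Qed.

End LocalPresentation.

(** * Multiplicity and order of vanishing *)

Section FiniteDifferences.

Definition fdiff (F : nat -> rat) (m : nat) := F m.+1 - F m.

Lemma fdiff_poly t (p : {poly rat}) m : (size p <= t.+1)%N ->
  iter t fdiff (fun m => p.[m%:R]) m = t`!%:R * p`_t.
Proof.
elim: t p m => [|t IH] p m sp.
  by rewrite /= (size1_polyC sp) hornerC coefC fact0 mul1r.
pose q := \sum_(i < t.+1) p^`N(i.+1).
have -> : iter t.+1 fdiff (fun m => p.[m%:R]) m = iter t fdiff (fun m => q.[m%:R]) m.
  rewrite iterSr; congr (iter t fdiff _ m); apply/funext => k.
  rewrite /fdiff -natr1 (nderiv_taylor_wide (commr1 _) sp) big_ord_recl.
  rewrite nderivn0 expr0 mulr1 addrC addKr /q horner_sum.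
  by apply: eq_bigr => i _; rewrite expr1n mulr1.
have coef_q j : (t <= j)%N -> q`_j = p`_j.+1 *+ j.+1.
  move=> le_tj; rewrite coef_sum big_ord_recl coef_nderivn add1n bin1 big1 ?addr0 //.
  move=> i _; rewrite coef_nderivn nth_default ?mul0rn //.
  by apply: leq_trans sp _; rewrite !addSn !ltnS (leq_trans le_tj) // leq_addl.
rewrite IH; last first.
  apply/leq_sizeP => j le_tj; rewrite coef_q ?(ltnW le_tj) //.
  by rewrite nth_default ?mul0rn // (leq_trans sp).
by rewrite coef_q // -mulr_natr factS natrM; ring.
Qed.

Lemma fdiffB (F G : nat -> rat) t m :
  iter t fdiff (fun m => F m - G m) m = iter t fdiff F m - iter t fdiff G m.
Proof.
elim: t m => [//|t IH] m; rewrite !iterS /fdiff !IH; ring.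
Qed.

Lemma fdiff_shift (F : nat -> rat) t c m :
  iter t fdiff (fun m => F (m + c)%N) m = iter t fdiff F (m + c)%N.
Proof.
by elim: t m => [//|t IH] m; rewrite !iterS /fdiff !IH addSn.
Qed.

Lemma fdiff_const (c : rat) t m : iter t.+1 fdiff (fun=> c) m = 0.
Proof.
by elim: t m => [|t IH] m; [rewrite /= /fdiff subrr | rewrite iterS /fdiff !IH subrr].
Qed.

(** Pascal's rule; the shift [a] absorbs the change of the upper index. *)
Lemma fdiff_binomial k j a m :
  iter j fdiff (fun m => 'C(m + a + (k + j), k + j)%:R) m
  = 'C(m + (a + j) + k, k)%:R.
Proof.
elim: j a m => [|j IH] a m; first by rewrite !addn0.
have -> : (m + (a + j.+1) + k = m + (a.+1 + j) + k)%N by rewrite addSnnS.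
rewrite iterSr -IH; congr (iter j fdiff _ m); apply/funext => l.
rewrite /fdiff addnS !addSn addnS binS natrD addrC addKr.
by rewrite !addnS.
Qed.

End FiniteDifferences.

Lemma monomials_of_degree n m : exists b : seq 'X_{1..n.+1},
  [/\ uniq b, size b = 'C(m + n, n) & forall mm, (mdeg mm == m) = (mm \in b)].
Proof.
exists [seq s2m t | t : m.-tuple 'I_n.+1 <- enum (basis n.+1 m)].
split; [exact: uniq_basis | | exact: basis_cover].
by rewrite size_basis -bin_sub ?leq_addr // addKn.
Qed.

Section InitialForms.
Variables (K : fieldType) (n : nat).
Local Notation S := {mpoly K[n.+1]}.
Variables (m : nat) (b : seq 'X_{1..n.+1}).
Hypothesis b_uniq : uniq b.
Hypothesis b_deg : forall mm, (mdeg mm == m) = (mm \in b).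

Definition monoms (i : 'I_(size b)) : S := 'X_[nth 0%MM b i].

Lemma coef_monoms (c : 'I_(size b) -> K) (i : 'I_(size b)) :
  (\sum_j c j *: monoms j)@_(nth 0%MM b i) = c i.
Proof.
rewrite raddf_sum /= (bigD1 i) //= mcoeffZ mcoeffX eqxx mulr1 big1 ?addr0 // => j ne.
by rewrite mcoeffZ mcoeffX nth_uniq // val_eqE (negPf ne) mulr0.
Qed.

Lemma monoms_indep : indep_mod (ord_ge m.+1) monoms.
Proof.
move=> c hc i; rewrite -coef_monoms; apply: hc.
have : nth 0%MM b i \in b by rewrite mem_nth.
by rewrite -b_deg => /eqP ->.
Qed.

Lemma monoms_ord i : ord_ge m (monoms i).
Proof.
have : nth 0%MM b i \in b by rewrite mem_nth.
by rewrite -b_deg => /eqP {1}<-; exact: ord_geXm.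
Qed.

Lemma monoms_span w : ord_ge m w -> spans_mod (ord_ge m.+1) monoms w.
Proof.
move=> hw; exists (fun i : 'I_(size b) => w@_(nth 0%MM b i)) => mm.
rewrite ltnS leq_eqVlt mcoeffB => /orP[|lt_m]; last first.
  rewrite hw // [X in _ - X](_ : _ = 0) ?subrr //.
  have hU := @ord_ge_lin K n.+1 m.
  apply: (lin_closed_sum (U := ord_ge m)) lt_m => // i _.
  by apply: (lin_closedZ _ hU); exact: monoms_ord.
rewrite b_deg => /(nthP 0%MM)[i lt_i <-].
by rewrite (coef_monoms _ (Ordinal lt_i)) subrr.
Qed.

End InitialForms.

(** * Hilbert function of a hypersurface at a rational point *)

Section GradedDimension.
Variables (K : numFieldType) (n : nat) (A : comNzRingType).
Local Notation S := {mpoly K[n.+1]}.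
Variables (chi : {rmorphism S -> A}) (f : S).
Hypothesis hchi : local_presentation chi f.
Hypothesis center0 : forall g, center chi g <-> g@_0%MM = 0.

Local Notation M := (@max_ideal A).

Let frac a : exists g h, h@_0%MM <> 0 /\ a * chi h = chi g.
Proof.
have [_ hfrac _ _] := hchi; have [g [h [nh e]]] := hfrac a.
by exists g, h; split=> // h0; apply/nh/center0.
Qed.

Let max_idealP a g h : h@_0%MM <> 0 -> a * chi h = chi g -> (max_ideal a <-> g@_0%MM = 0).
Proof.
by move=> nh e; rewrite -center0; apply: (max_idealE _ e) => /center0.
Qed.

Let unit_chi h : h@_0%MM <> 0 -> exists b, chi h * b = 1.
Proof. by move=> nh; apply/notin_centerP => /center0. Qed.

Lemma ideal_pow0 k : ideal_pow M k 0.
Proof. by case: k => [//|k]; exists [::]; rewrite big_nil. Qed.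

Lemma ideal_powD k a b : ideal_pow M k a -> ideal_pow M k b -> ideal_pow M k (a + b).
Proof.
case: k => [//|k] [s [hs ->]] [s' [hs' ->]]; exists (s ++ s'); rewrite big_cat.
by split=> // p; rewrite mem_cat => /orP[/hs|/hs'].
Qed.

Lemma ideal_powM k a b : ideal_pow M k b -> ideal_pow M k (a * b).
Proof.
case: k => [//|k] [s [hs ->]]; exists [seq (a * p.1, p.2) | p <- s]; split.
  by move=> _ /mapP[p /hs[h1 h2] ->]; split=> //; exact: max_idealM.
by rewrite big_map mulr_sumr; apply: eq_bigr => p _; rewrite mulrA.
Qed.

Lemma ideal_powS k a b : M a -> ideal_pow M k b -> ideal_pow M k.+1 (a * b).
Proof.
by exists [:: (a, b)]; rewrite big_seq1; split=> // p; rewrite inE => /eqP ->.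
Qed.

Lemma ideal_pow_sum k (I : Type) (r : seq I) (F : I -> A) :
  (forall i, ideal_pow M k (F i)) -> ideal_pow M k (\sum_(i <- r) F i).
Proof.
move=> h; elim/big_ind : _ => //; [exact: ideal_pow0 | exact: ideal_powD].
Qed.

Lemma ideal_pow_monomial k (mm : 'X_{1..n.+1}) : (k <= mdeg mm)%N ->
  ideal_pow M k (chi 'X_[mm]).
Proof.
elim: k mm => [//|k IH] mm lt_k.
have : (0 < mdeg mm)%N by exact: leq_ltn_trans lt_k.
rewrite lt0n mdegE sum_nat_eq0 negb_forall => /existsP[i] /=.
rewrite -lep1mP => /submK e; rewrite -e addmC mpolyXD rmorphM; apply: ideal_powS.
  apply/center0; rewrite mcoeffX mnm1_eq0; by [].
by apply: IH; move: lt_k; rewrite -{1}e mdegD mdeg1 addn1.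
Qed.

Lemma ideal_pow_ord k g : ord_ge k g -> ideal_pow M k (chi g).
Proof.
move=> hg; rewrite [g]mpolyE rmorph_sum big_seq /=.
elim/big_ind : _ => [||mm mg]; [exact: ideal_pow0 | exact: ideal_powD |].
rewrite -mul_mpolyC rmorphM; apply/ideal_powM/ideal_pow_monomial.
by rewrite leqNgt; apply/negP => /hg/eqP; apply/negP; rewrite -mcoeff_msupp.
Qed.

Lemma ideal_powP k a : ideal_pow M k a <->
  exists g h, [/\ h@_0%MM <> 0, ord_ge k g & a * chi h = chi g].
Proof.
split=> [|[g [h [nh hg e]]]]; last first.
  have [b hb] := unit_chi nh.
  have -> : a = b * chi g by rewrite -e mulrC -mulrA hb mulr1.
  exact/ideal_powM/ideal_pow_ord.
elim: k a => [|k IH] a; first by move=> _; have [g [h [nh e]]] := frac a; exists g, h.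
move=> [s [hs ->]]; rewrite big_seq; elim/big_ind : _ => [|x y|p /hs[h1 /IH]].
- exists 0, 1; rewrite mcoeff1 eqxx rmorph0 mul0r; split=> //.
    by apply/eqP; exact: oner_neq0.
  by case: (@ord_ge_lin K n.+1 k.+1).
- move=> [g [h [nh hg e]]] [g' [h' [nh' hg' e']]].
  exists (g * h' + g' * h), (h * h'); split.
  + by rewrite (rmorphM (mcoeff 0%MM)) => /eqP; rewrite mulf_eq0 => /orP[] /eqP.
  + apply: (lin_closedD (@ord_ge_lin K n.+1 _)); rewrite mulrC; exact: ord_geMl.
  + by rewrite mulrDl rmorphD !rmorphM /= -e -e'; ring.
move=> [g' [h' [nh' hg' e']]]; have [g [h [nh e]]] := frac p.1.
exists (g * g'), (h * h'); split.
- by rewrite (rmorphM (mcoeff 0%MM)) => /eqP; rewrite mulf_eq0 => /orP[] /eqP.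
- rewrite -[k.+1]add1n; apply: ord_geM => //; apply/ord_ge1P.
  exact/(max_idealP nh e).
- by rewrite !rmorphM /= mulrACA e e'.
Qed.

(** The sum of the ideal of [f] and of the power [m.+1] of the ideal of the origin. *)
Let initial_ideal m (w : S) := exists q, ord_ge m.+1 (w - f * q).

(** A truncated geometric series inverts [h] modulo order [m.+1]. *)
Let initial_idealM m p h : h@_0%MM <> 0 -> initial_ideal m (p * h) -> initial_ideal m p.
Proof.
move=> /eqP nh [q hq]; pose c := h@_0%MM.
pose y := 1 - c^-1 *: h.
have hy : ord_ge 1 y.
  by apply/ord_ge1P; rewrite mcoeffB mcoeff1 eqxx mcoeffZ mulVf ?subrr.
pose v := c^-1 *: \sum_(i < m.+1) y ^+ i.
have hv : 1 - h * v = y ^+ m.+1.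
  have -> : h * v = (1 - y) * \sum_(i < m.+1) y ^+ i.
    by rewrite [1 - y]subKr /v -scalerAr scalerAl.
  rewrite -[1 - y]opprB mulNr -subrX1; ring.
exists (q * v).
have -> : p - f * (q * v) = p * (1 - h * v) + (p * h - f * q) * v by ring.
rewrite hv; apply: (lin_closedD (@ord_ge_lin K n.+1 _)).
  apply: ord_geMl; rewrite -[X in ord_ge X]mul1n; exact: ord_geX.
by rewrite mulrC; exact: ord_geMl.
Qed.

Variable mu0 : nat.
Hypothesis f_ord : ord_ge mu0 f.
Hypothesis f_exact : ~ ord_ge mu0.+1 f.

(** Modulo order [m.+1], the polynomials of order at least [m] have as a basis the numerators of the
    [e i] together with [f] times the monomials of degree [m - mu0]; another basis is formed by the
    monomials of degree [m] in [n.+1] variables. *)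
Lemma gr_dimE m d : gr_dim A m d -> (mu0 <= m)%N ->
  (d + 'C(m - mu0 + n, n) = 'C(m + n, n))%N.
Proof.
move=> [e [e_mem e_span e_indep]] le_mu.
have [b [b_uniq <- b_deg]] := monomials_of_degree n m.
have [b' [b'_uniq <- b'_deg]] := monomials_of_degree n (m - mu0).
have /choice[gh hgh] : forall i, exists gh : S * S,
    [/\ gh.2@_0%MM <> 0, ord_ge m gh.1 & e i * chi gh.2 = chi gh.1].
  by move=> i; have /ideal_powP[g [h hgh]] := e_mem i; exists (g, h).
(* To first order a denominator acts through its constant term, so [E i] represents [e i] modulo the
   next power of the maximal ideal. *)
pose c0 i := ((gh i).2)@_0%MM; pose E i := (c0 i)^-1 *: (gh i).1.
have c0_neq0 i : c0 i != 0 by apply/eqP; case: (hgh i).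
have E_ord i : ord_ge m (E i).
  by apply: (lin_closedZ _ (@ord_ge_lin K n.+1 m)); case: (hgh i).
have chi_E (c : 'I_d -> K) : chi (\sum_i c i *: E i) =
    \sum_i chi ((c i * (c0 i)^-1)%:MP * (gh i).2) * e i.
  rewrite rmorph_sum; apply: eq_bigr => i _.
  rewrite /E scalerA -mul_mpolyC (rmorphM chi) [in RHS](rmorphM chi) /= -mulrA.
  congr (_ * _).
  by have [_ _ <-] := hgh i; rewrite mulrC.
have E_indep : indep_mod (initial_ideal m) E.
  move=> c [q hq] i.
  have : ideal_pow M m.+1 (\sum_i chi ((c i * (c0 i)^-1)%:MP * (gh i).2) * e i).
    rewrite -chi_E; have := ideal_pow_ord hq; rewrite rmorphB rmorphM /=.
    by have [_ _ _ ->] := hchi; rewrite mul0r subr0.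
  move=> /e_indep /(_ i) /center0; rewrite (rmorphM (mcoeff 0%MM)) /= mcoeffC eqxx mulr1.
  by move/eqP; rewrite !mulf_eq0 invr_eq0 -/(c0 i) (negPf (c0_neq0 i)) !orbF => /eqP.
have E_span w : ord_ge m w -> spans_mod (initial_ideal m) E w.
  move=> hw; have [a ha] := e_span _ (ideal_pow_ord hw).
  have /choice[pq hpq] : forall i, exists pq : S * S,
      pq.2@_0%MM <> 0 /\ a i * chi pq.2 = chi pq.1.
    by move=> i; have [g [h gh']] := frac (a i); exists (g, h).
  pose c i := ((pq i).1)@_0%MM / ((pq i).2)@_0%MM.
  exists c.
  have : ideal_pow M m.+1 (chi (w - \sum_i c i *: E i)).
    rewrite rmorphB chi_E.
    have -> : chi w - \sum_i chi ((c i / c0 i)%:MP * (gh i).2) * e i =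
      (chi w - \sum_i a i * e i) +
      \sum_i (a i - chi ((c i / c0 i)%:MP * (gh i).2)) * e i.
      by under [X in _ = _ + X]eq_bigr do rewrite mulrBl; rewrite sumrB addrA subrK.
    apply: ideal_powD => //; apply: ideal_pow_sum => i; apply: ideal_powS => //.
    have [nq eq_a] := hpq i.
    apply/(@max_idealP _ ((pq i).1 - (c i / c0 i)%:MP * (gh i).2 * (pq i).2) _ nq).
      by rewrite mulrBl eq_a -rmorphM -rmorphB.
    rewrite mcoeffB !(rmorphM (mcoeff 0%MM)) /= mcoeffC eqxx mulr1 -/(c0 i).
    by rewrite divfK // /c divfK ?subrr //; exact/eqP.
  move=> /ideal_powP[g [h [nh hg eg]]].
  have [_ _ ker _] := hchi.
  have [|h' [b0 [nh' eb]]] := ker ((w - \sum_i c i *: E i) * h - g).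
    by rewrite rmorphB rmorphM /= eg subrr.
  apply: (initial_idealM nh); apply: (@initial_idealM _ _ h').
    by move=> h0; apply/nh'/center0.
  exists b0; rewrite -eb.
  rewrite (_ : _ - _ = h' * g); last by ring.
  exact: ord_geMl.
pose F (x : 'I_d + 'I_(size b')) : S :=
  match x with inl i => E i | inr j => f * monoms K j end.
have F_ord x : ord_ge m (F x).
  case: x => [i|j] /=; first exact: E_ord.
  by rewrite -(subnKC le_mu); apply: ord_geM => //; exact: monoms_ord.
have sumF (c : 'I_d + 'I_(size b') -> K) : \sum_x c x *: F x =
    \sum_i c (inl i) *: E i + f * \sum_j c (inr j) *: monoms K j.
  rewrite big_sumType /= mulr_sumr; congr (_ + _); apply: eq_bigr => j _.
  by rewrite scalerAr.
have F_indep : indep_mod (ord_ge m.+1) F.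
  move=> c; rewrite sumF => hc.
  have c1 i : c (inl i) = 0.
    apply: (E_indep (fun i => c (inl i))).
    by exists (- \sum_j c (inr j) *: monoms K j); rewrite mulrN opprK.
  case=> [//|j]; apply: (monoms_indep b'_uniq b'_deg (c := fun j => c (inr j))).
  apply: (ord_ge_mulr f_ord f_exact); rewrite addnS subnKC //.
  by move: hc; rewrite big1 ?add0r // => i _; rewrite c1 scale0r.
have F_span w : ord_ge m w -> spans_mod (ord_ge m.+1) F w.
  move=> hw; have [c [q hq]] := E_span w hw.
  have q_ord : ord_ge (m - mu0) q.
    apply: (ord_ge_mulr f_ord f_exact); rewrite subnKC //.
    rewrite -[f * q](subKr (w - \sum_i c i *: E i)).
    apply: (lin_closedB (@ord_ge_lin K n.+1 m)); last exact: ord_ge_le hq.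
    apply: (lin_closedB (@ord_ge_lin K n.+1 m)) => //.
    apply: lin_closed_sum; first exact: (@ord_ge_lin K n.+1).
    by move=> i _; apply: (lin_closedZ _ (@ord_ge_lin K n.+1 m)).
  have [c' hc'] := monoms_span b'_uniq b'_deg q_ord.
  exists (fun x => match x with inl i => c i | inr j => c' j end); rewrite sumF.
  set s := \sum_i _; set s' := \sum_j _ in hc' *.
  have -> : w - (s + f * s') = (w - s - f * q) + f * (q - s') by ring.
  apply: (lin_closedD (@ord_ge_lin K n.+1 _)) => //.
  by rewrite -(subnKC le_mu) -addnS; apply: ord_geM.
have hU := @ord_ge_lin K n.+1 m.+1.
have := leq_card_indep_spans hU F_indep
  (fun x => monoms_span b_uniq b_deg (F_ord x)).
have := leq_card_indep_spans hU (monoms_indep b_uniq b_deg)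
  (fun i => F_span _ (monoms_ord K b_deg i)).
rewrite card_sum !card_ord => h1 h2; apply/eqP.
by rewrite eqn_leq h2.
Qed.

(** For large arguments [p] is a difference of two binomials, whose difference of order [n.-1] is
    the constant [mu0], while its difference of order [t.-1] is the constant [mu]. If the orders
    differ, the constant of higher order is 0: this excludes [t < n] and gives [mu = 0] for
    [t > n]. *)
Lemma is_multiplicity_le mu : (0 < n)%N -> (0 < mu0)%N -> is_multiplicity A mu ->
  (mu <= mu0)%N.
Proof.
move=> n_gt0 mu0_gt0 [t [p [N [t_gt0 _ hp sp pt]]]].
have st : (size p <= t.-1.+1)%N by rewrite prednK.
pose E (k : nat) : rat := p.[(k + (N + mu0))%:R].
have EE k : E k = 'C(k + (N + mu0) + n, n)%:R - 'C(k + N + n, n)%:R.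
  rewrite /E; have [|d dm <-] := hp (k + (N + mu0))%N.
    by rewrite addnCA leq_addr.
  have /= := gr_dimE dm _; rewrite [(k + _)%N]addnA leq_addl addnK => /(_ isT) <-.
  by rewrite natrD addrK.
have dE_t k : iter t.-1 fdiff E k = mu%:R.
  rewrite (fdiff_shift (fun m => p.[m%:R])) fdiff_poly // pt mulrC divfK //.
  by rewrite pnatr_eq0 -lt0n fact_gt0.
have dE_n k : iter n.-1 fdiff E k = mu0%:R.
  have -> : E = fun k => 'C(k + (N + mu0) + (1 + n.-1), 1 + n.-1)%:R -
      'C(k + N + (1 + n.-1), 1 + n.-1)%:R.
    by apply/funext => l; rewrite EE add1n prednK.
  rewrite fdiffB !fdiff_binomial !bin1 !natrD; ring.
have [lt_tn|lt_nt|e] := ltngtP t.-1 n.-1.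
- have := dE_n 0%N; rewrite -(subnK (ltnW lt_tn)) -(subnSK lt_tn).
  rewrite iterD (_ : iter t.-1 _ _ = fun=> mu%:R); last exact/funext.
  by rewrite fdiff_const => /eqP; rewrite eq_sym pnatr_eq0 eqn0Ngt mu0_gt0.
- have := dE_t 0%N; rewrite -(subnK (ltnW lt_nt)) -(subnSK lt_nt).
  rewrite iterD (_ : iter n.-1 _ _ = fun=> mu0%:R); last exact/funext.
  by rewrite fdiff_const => /eqP; rewrite eq_sym pnatr_eq0 => /eqP ->.
have := dE_t 0%N; rewrite e dE_n => /eqP.
by rewrite eqr_nat => /eqP ->.
Qed.

End GradedDimension.

(** * Affine charts of the hypersurface *)

Section Dehomogenization.
Variables (K : numFieldType) (n : nat) (i0 : 'I_n.+1).
Local Notation S1 := {mpoly K[n.+1]}.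
Local Notation S := {mpoly K[n]}.

Definition dehom_coord (j : 'I_n.+1) : S := if unlift i0 j is Some i then 'X_i else 1.

Local Notation dehom := (mmap (@mpolyC n K) dehom_coord).

Lemma dehomX0 : dehom 'X_i0 = 1.
Proof. by rewrite mmapX mmap1U /dehom_coord unlift_none. Qed.

Lemma dehomX i : dehom 'X_(lift i0 i) = 'X_i.
Proof. by rewrite mmapX mmap1U /dehom_coord liftK. Qed.

Lemma dhomog_prod_seq N (I : Type) (r : seq I) (k : I -> nat) (F : I -> {mpoly K[N]}) :
  (forall i, F i \is (k i).-homog) ->
  \prod_(i <- r) F i \is (\sum_(i <- r) k i).-homog.
Proof.
move=> h; elim: r => [|i r IH]; first by rewrite !big_nil dhomog1.
by rewrite !big_cons; apply: dhomogM.
Qed.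

Lemma dhomog_mderiv N d (p : {mpoly K[N]}) i : p \is d.-homog -> p^`M(i) \is d.-1.-homog.
Proof.
move=> /dhomogP hp; apply/dhomogP => m; rewrite mcoeff_msupp mcoeff_deriv => nz.
have /hp /= <- : (m + U_(i))%MM \in msupp p.
  by rewrite mcoeff_msupp; apply: contraNneq nz => ->; rewrite mul0rn.
by rewrite mdegD mdeg1 addn1.
Qed.

Lemma dehom_mderiv i p : (dehom p)^`M(i) = dehom p^`M(lift i0 i).
Proof.
rewrite mderiv_mmap (bigD1 (lift i0 i)) //= big1 ?addr0 => [|j nj].
  rewrite /dehom_coord liftK mderivX mnm1E eqxx scale1r.
  by rewrite subm_diag mpolyX0 mulr1.
rewrite /dehom_coord; case: unliftP => [k jk|_]; last by rewrite mderivC mulr0.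
have /negPf nki : k != i by apply: contraNneq nj => <-; rewrite jk.
by rewrite mderivX mnm1E nki scale0r mulr0.
Qed.

(** Expand [p] in powers of the ['X_i - (b i)%:MP], replace these by the linear forms [l i], and pad
    with powers of ['X_i0]. The [l i] vanish on the whole line over [b], so the order is kept at all
    its points. *)
Lemma exists_homogenization (b : 'I_n -> K) mu (p : S) : mult_ge b mu p ->
  exists D, forall d, (D <= d)%N -> exists G : S1,
    [/\ G \is d.-homog, dehom G = p
      & forall a : 'I_n.+1 -> K, (forall i, a (lift i0 i) = b i * a i0) -> mult_ge a mu G].
Proof.
move=> hp; set c := mmap (@mpolyC n K) (fun i => 'X_i + (b i)%:MP) p in hp.
exists (msize c) => d le_d.
pose l i : S1 := 'X_(lift i0 i) - b i *: 'X_i0.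
have hl i : l i \is 1.-homog.
  by rewrite rpredB ?rpredZ // dhomogX /= mdeg1.
exists (\sum_(m <- msupp c) c@_m *: ('X_i0 ^+ (d - mdeg m) * \prod_i l i ^+ m i)).
split=> [||a ha].
- rewrite big_seq; apply: rpred_sum => m mc; apply: rpredZ.
  have le_m : (mdeg m <= d)%N by apply: ltnW; apply: leq_trans le_d; exact: msize_mdeg_lt.
  have pow_homog (q : S1) k : q \is 1.-homog -> q ^+ k \is k.-homog.
    by move=> /(dhomogMn k); rewrite mul1n.
  have hX : 'X_i0 ^+ (d - mdeg m) \is [in K[n.+1], (d - mdeg m).-homog].
    by apply: pow_homog; rewrite dhomogX /= mdeg1.
  have hL : \prod_i l i ^+ m i \is (mdeg m).-homog.
    by rewrite mdegE; apply: dhomog_prod_seq => i; exact: pow_homog.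
  by have := dhomogM hX hL; rewrite subnK.
- rewrite raddf_sum /=.
  rewrite -[p](trK (a := b) (b := fun i => - b i)) // -/c [in RHS]/mmap.
  apply: eq_bigr => m _; rewrite mmapZ; congr (_ * _).
  rewrite rmorphM rmorphXn /= dehomX0 expr1n mul1r rmorph_prod; apply: eq_bigr => i _.
  rewrite rmorphXn rmorphB /= dehomX mmapZ dehomX0 mulr1 mpolyCN.
  by [].
rewrite big_seq; apply: lin_closed_sum => [|m mc]; first exact: mult_ge_lin.
apply: (lin_closedZ _ (mult_ge_lin a mu)); apply: mult_geMl.
have le_mu : (mu <= mdeg m)%N.
  by rewrite leqNgt; apply/negP => /hp/eqP; apply/negP; rewrite -mcoeff_msupp.
apply: (mult_ge_le le_mu); rewrite mdegE; apply: mult_ge_prod => i _.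
rewrite -[X in mult_ge _ X]mul1n; apply: mult_geX; apply/mult_ge1P.
by rewrite mevalB mevalZ !mevalXU ha subrr.
Qed.

Lemma meval_dehom (b : 'I_n -> K) (a : 'I_n.+1 -> K) p : a i0 = 1 ->
  (forall i, a (lift i0 i) = b i) -> (dehom p).@[b] = p.@[a].
Proof.
move=> a0 ha; have h := @rmorph_mpoly_eq _ _ _ (meval b \o dehom) (meval a) _ _ p; apply: h.
  by move=> c /=; rewrite mmapC !mevalC.
move=> j /=; rewrite mmapX mmap1U mevalXU /dehom_coord.
by case: unliftP => [i ->|->]; rewrite ?mevalXU ?meval1.
Qed.

Lemma meval_homog N d (p : {mpoly K[N]}) (c : K) (v : 'I_N -> K) : p \is d.-homog ->
  p.@[fun j => c * v j] = c ^+ d * p.@[v].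
Proof.
move=> /dhomogP hp; rewrite !mevalE mulr_sumr big_seq [RHS]big_seq.
apply: eq_bigr => m mp; rewrite mulrCA; congr (_ * _).
rewrite -(hp _ mp) /= mdegE -prodrXr -big_split; apply: eq_bigr => i _.
by rewrite exprMn.
Qed.

Section Fractions.
Local Notation F := {fraction S1}.
Local Notation "x %:F" := (tofrac x) : ring_scope.

Definition affine_frac : S -> F :=
  mmap (@tofrac S1 \o @mpolyC n.+1 K) (fun i => ('X_(lift i0 i))%:F / ('X_i0)%:F).

HB.instance Definition _ := GRing.RMorphism.copy affine_frac
  (mmap (@tofrac S1 \o @mpolyC n.+1 K) (fun i => ('X_(lift i0 i))%:F / ('X_i0)%:F)).

Lemma affine_fracC c : affine_frac c%:MP = (c%:MP)%:F.
Proof. exact: mmapC. Qed.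

Lemma affine_fracX i : affine_frac 'X_i = ('X_(lift i0 i))%:F / ('X_i0)%:F.
Proof. by rewrite /affine_frac mmapX mmap1U. Qed.

Lemma tofracX_neq0 : ('X_i0)%:F != 0 :> F.
Proof. by rewrite tofrac_eq0 -msize_poly_eq0 msizeX. Qed.

Lemma affine_frac_dehom d p : p \is d.-homog -> affine_frac (dehom p) = p%:F / ('X_i0)%:F ^+ d.
Proof.
move=> /dhomogP hp.
have -> : affine_frac (dehom p) =
    \sum_(m <- msupp p) affine_frac (dehom (p@_m *: 'X_[m])).
  by rewrite {1}(mpolyE p) (raddf_sum dehom) (raddf_sum affine_frac).
rewrite [in RHS](mpolyE p) (raddf_sum (@tofrac S1)) mulr_suml big_seq [RHS]big_seq /=.
apply: eq_bigr => m mp.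
rewrite -mul_mpolyC (rmorphM dehom) /= mmapC !rmorphM /= affine_fracC -mulrA.
congr (_ * _).
rewrite -(hp _ mp) /= mdegE mpolyXE_id !rmorph_prod /= -prodrXr -prodf_div.
apply: eq_bigr => j _; rewrite !rmorphXn /= -expr_div_n; congr (_ ^+ _).
rewrite mmapX mmap1U /dehom_coord; case: unliftP => [i ->|->].
  by rewrite affine_fracX.
by rewrite rmorph1 divff // tofracX_neq0.
Qed.

Lemma affine_frac_inj p : affine_frac p = 0 -> p = 0.
Proof.
(* Order 0 at the origin is no condition on [p], so this just provides a homogenization. *)
have [D hD] := exists_homogenization (ord_ge0 (mmap (@mpolyC n K) (fun i => 'X_i + 0%:MP) p)).
have [G [hG <- _]] := hD D (leqnn _).
rewrite (affine_frac_dehom hG) => /eqP.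
rewrite mulf_eq0 invr_eq0 expf_eq0 (negPf tofracX_neq0) andbF orbF tofrac_eq0.
by move=> /eqP ->; rewrite rmorph0.
Qed.

Lemma dehom_inj d p q : p \is d.-homog -> q \is d.-homog -> dehom p = dehom q -> p = q.
Proof.
move=> hp hq e; have := affine_frac_dehom hp; rewrite e (affine_frac_dehom hq).
have nz : (('X_i0)%:F ^+ d)^-1 != 0 :> F.
  by rewrite invr_eq0 expf_eq0 (negPf tofracX_neq0) andbF.
by move/(mulIf nz)/eqP; rewrite tofrac_eq => /eqP.
Qed.

End Fractions.
End Dehomogenization.

(** * Stalks of the hypersurface in a standard chart *)

Section StalkPresentation.
Variables (n delta : nat) (f : {mpoly rat[n.+1]}).
Hypothesis f_homog : f \is delta.-homog.
Variables (x : hypoint f) (i0 : 'I_n.+1).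
Hypothesis i0x : 'X_i0 \notin point_ideal x.
Local Notation S1 := {mpoly rat[n.+1]}.
Local Notation S := {mpoly rat[n]}.
Local Notation F := {fraction S1}.
Local Notation dehom := (mmap (@mpolyC n rat) (dehom_coord rat i0)).
Local Notation "x %:F" := (tofrac x) : ring_scope.

Lemma homogenize (p : S) : exists D, forall d, (D <= d)%N ->
  exists2 G : S1, G \is d.-homog & dehom G = p.
Proof.
have [D hD] := exists_homogenization i0
  (ord_ge0 (mmap (@mpolyC n rat) (fun i => 'X_i + 0%:MP) p)).
by exists D => d /hD[G [hG <- _]]; exists G.
Qed.

Lemma dhomogX_pow d : 'X_i0 ^+ d \is [in rat[n.+1], d.-homog].
Proof.
by have := @dhomogMn n.+1 rat mdeg 1 'X_i0 d; rewrite mul1n dhomogX /= mdeg1; apply.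
Qed.

Lemma pow_notin d : 'X_i0 ^+ d \notin point_ideal x.
Proof.
elim: d => [|d IH]; first by rewrite expr0 idealr1.
by rewrite exprS prime_idealrM negb_or i0x.
Qed.

Lemma affine_frac_stalk p : affine_frac i0 p \in stalk_pred x.
Proof.
have [D /(_ D (leqnn D))[G hG <-]] := homogenize p.
apply/asboolP; exists D, G, ('X_i0 ^+ D); rewrite (affine_frac_dehom i0 hG) rmorphXn.
by split=> //; [exact: dhomogX_pow | exact: pow_notin].
Qed.

Definition affine_stalk p : proj_stalk x := ProjStalk (affine_frac_stalk p).

Fact affine_stalk_zmod : zmod_morphism affine_stalk.
Proof. by move=> p q; apply: val_inj; rewrite /= rmorphB. Qed.

Fact affine_stalk_monoid : monoid_morphism affine_stalk.
Proof.
by split=> [|p q]; apply: val_inj; rewrite /= ?rmorph1 ?rmorphM.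
Qed.

HB.instance Definition _ :=
  GRing.isZmodMorphism.Build S (proj_stalk x) affine_stalk affine_stalk_zmod.
HB.instance Definition _ :=
  GRing.isMonoidMorphism.Build S (proj_stalk x) affine_stalk affine_stalk_monoid.

Definition chart : S -> stalk x := (\pi_({ideal_quot @hyp_ideal n f x}))%qT \o affine_stalk.

HB.instance Definition _ := GRing.RMorphism.copy chart
  ((\pi_({ideal_quot @hyp_ideal n f x}))%qT \o affine_stalk).

Local Notation pi := ((\pi_({ideal_quot @hyp_ideal n f x}))%qT).

Lemma chartE p : chart p = pi (affine_stalk p). Proof. by []. Qed.

Lemma piM (r s : proj_stalk x) : (pi r : stalk x) * (pi s : stalk x) = pi (r * s).
Proof. exact: (esym (rmorphM pi r s)). Qed.

Lemma pi1 : pi 1 = 1 :> stalk x.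
Proof. exact: (rmorph1 pi). Qed.

Lemma pi_eq0 (r : proj_stalk x) : (pi r = 0) <-> r \in @hyp_ideal n f x.
Proof.
have := Quotient.idealrBE (@hyp_ideal n f x) r 0; rewrite subr0 => ->.
by rewrite rmorph0; split=> [->|/eqP].
Qed.

Lemma stalk_repr (a : stalk x) : exists d (g h : S1) (r : proj_stalk x),
  [/\ g \is d.-homog, h \is d.-homog, h \notin point_ideal x,
      val r = g%:F / h%:F & a = pi r].
Proof.
have /asboolP[d [g [h [hg hh hx e]]]] := valP (repr a : proj_stalk x).
by exists d, g, h, (repr a); split=> //; rewrite reprK.
Qed.

Let tofrac_neq0 (h : S1) : h \notin point_ideal x -> h%:F != 0.
Proof. by move=> /notin_point_neq0 nz; rewrite tofrac_eq0. Qed.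

Let X_neq0 d : ('X_i0 : S1)%:F ^+ d != 0 := expf_neq0 d (tofracX_neq0 rat i0).

(** If [g] is outside the ideal of the point, ['X_i0 ^+ d / g] is an inverse. Conversely, clearing
    denominators in an inverse [p / q] modulo [f] would put ['X_i0 ^+ d * q] into this prime ideal,
    which contains neither factor. *)
Lemma chart_center d (g : S1) : g \is d.-homog ->
  (center chart (dehom g) <-> g \in point_ideal x).
Proof.
move=> hg; split=> [nu|gx [b]].
  apply/negPn/negP => ngx; apply: nu.
  have st : ('X_i0 ^+ d)%:F / g%:F \in stalk_pred x.
    by apply/asboolP; exists d, ('X_i0 ^+ d), g; split=> //; exact: dhomogX_pow.
  exists (pi (ProjStalk st)); rewrite /= chartE piM.
  have -> : affine_stalk (dehom g) * ProjStalk st = 1; last exact: pi1.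
  apply: val_inj; rewrite /= (affine_frac_dehom i0 hg) rmorphXn.
  by rewrite mulf_div [X in X / _]mulrC divff // mulf_neq0 ?tofrac_neq0.
have [e [p [q [r [hp hq qx er ->]]]]] := stalk_repr b.
rewrite /= chartE piM => e1.
have : pi (affine_stalk (dehom g) * r - 1) = 0.
  by rewrite rmorphB rmorph1; apply/eqP; rewrite subr_eq0; apply/eqP.
move=> /pi_eq0 /asboolP[k [u [v [_ _ vx]]]].
rewrite /= er (affine_frac_dehom i0 hg) -rmorphXn mulf_div -!rmorphM => eq1.
have Dx : 'X_i0 ^+ d * q \notin point_ideal x.
  by rewrite prime_idealrM negb_or pow_notin.
have : ((g * p - 'X_i0 ^+ d * q) * v)%:F = (f * u * ('X_i0 ^+ d * q))%:F.
  rewrite rmorphM rmorphB [in RHS]rmorphM.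
  set B := ('X_i0 ^+ d * q)%:F in eq1 *; have nzB : B != 0 by exact: tofrac_neq0.
  rewrite -[X in (X - _) * _](divfK nzB) -[X in (_ - X) * _]mul1r -mulrBl eq1.
  by rewrite mulrAC divfK ?tofrac_neq0.
move/eqP; rewrite tofrac_eq => /eqP eq2.
have : (g * p - 'X_i0 ^+ d * q) * v \in point_ideal x.
  by rewrite eq2 -mulrA mulrC idealMr // hypoint_on.
rewrite prime_idealrM (negPf vx) orbF => h.
have gpx : g * p \in point_ideal x by rewrite mulrC idealMr.
case/negP: Dx; have := rpredB gpx h; rewrite opprB addrC subrK.
by [].
Qed.

(** In a fraction of two forms of the same degree the powers of ['X_i0] cancel, so it is the
    fraction of their dehomogenizations. The center is shown to be a prime ideal on homogenizations,
    taken of a common degree when they are added. *)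
Lemma chart_presentation : local_presentation chart (dehom f).
Proof.
have centerP (p : S) : exists D, forall d, (D <= d)%N -> exists2 G : S1,
    G \is d.-homog /\ dehom G = p & center chart p <-> G \in point_ideal x.
  have [D hD] := homogenize p; exists D => d /hD[G hG <-].
  by exists G; [split | exact: (chart_center hG)].
have notin_center d (h : S1) : h \is d.-homog -> h \notin point_ideal x ->
    ~ center chart (dehom h).
  by move=> hh hx /(chart_center hh); apply/negP.
split.
- split=> [||a b].
  + split=> [|a u v cu cv].
      by rewrite /center rmorph0 => -[b]; rewrite mul0r => /eqP; rewrite eq_sym oner_eq0.
    have [Da /(_ Da (leqnn _))[Ga [hGa <-] _]] := centerP a.
    have [Du hu] := centerP u; have [Dv hv] := centerP v.
    have [Gu [hGu eu] cGu] := hu (maxn Du Dv) (leq_maxl _ _).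
    have [|Gv [hGv ev] cGv] := hv (Da + maxn Du Dv)%N.
      by rewrite (leq_trans (leq_maxr Du Dv)) // leq_addl.
    rewrite -eu -ev -rmorphM -rmorphD; apply/(@chart_center (Da + maxn Du Dv)).
      by rewrite rpredD //; exact: dhomogM.
    by rewrite rpredD //; [rewrite idealMr //; exact/cGu | exact/cGv].
  + by apply; exists 1; rewrite rmorph1 mulr1.
  + have [Da /(_ Da (leqnn _))[Ga [hGa <-] ca]] := centerP a.
    have [Db /(_ Db (leqnn _))[Gb [hGb <-] cb]] := centerP b.
    rewrite -rmorphM => /(chart_center (dhomogM hGa hGb)).
    by rewrite prime_idealrM => /orP[/ca|/cb]; [left | right].
- move=> a; have [d [g [h [r [hg hh hx er ->]]]]] := stalk_repr a.
  exists (dehom g), (dehom h); split; first exact: notin_center hh hx.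
  rewrite /= !chartE piM; congr (pi _); apply: val_inj.
  rewrite /= er (affine_frac_dehom i0 hg) (affine_frac_dehom i0 hh).
  by rewrite mulrA divfK ?tofrac_neq0.
- move=> g /pi_eq0 /asboolP[d [u [v [hu hv vx]]]] /= e.
  exists (dehom v), (dehom u); split; first exact: notin_center hv vx.
  apply/eqP; rewrite -subr_eq0 -rmorphM; apply/eqP/(@affine_frac_inj _ _ i0).
  rewrite rmorphB /= (affine_frac_dehom i0 hu) (rmorphM (affine_frac i0)) /= e.
  rewrite (affine_frac_dehom i0 hv).
  by rewrite mulrA divfK ?tofrac_neq0 // subrr.
apply/pi_eq0/asboolP; exists delta, 1, ('X_i0 ^+ delta); split.
- by rewrite mulr1.
- exact: dhomogX_pow.
- exact: pow_notin.
by rewrite mulr1 /= (affine_frac_dehom i0 f_homog) rmorphXn.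
Qed.

End StalkPresentation.

Lemma singular_point_derivatives n delta (f : {mpoly rat[n.+1]}) (x : hypoint f) :
  f \is delta.-homog -> f != 0 -> (forall j, f^`M(j) \in point_ideal x) ->
  singular_point x.
Proof.
move=> hf f0 hd; have [i0 hi0] := point_relevant x.
apply: (not_regular_local (chart_presentation hf hi0)) => [|i].
  apply: contraNneq f0 => e; apply/eqP.
  by apply: (dehom_inj (i0 := i0) hf) => //; rewrite ?rpred0 // e rmorph0.
rewrite dehom_mderiv; apply/(chart_center hi0 (dhomog_mderiv _ hf)).
exact: hd.
Qed.

Section Translation.
Variables (K : numFieldType) (N : nat) (A : comNzRingType).
Local Notation S := {mpoly K[N]}.
Local Notation tr a := (mmap (@mpolyC N K) (fun i => 'X_i + (a i)%:MP)).
Variables (chi : {rmorphism S -> A}) (f : S) (b : 'I_N -> K).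

(** If the center of [chi] is the ideal of the point [b], the center of [translate] is the ideal of
    the origin. *)
Definition translate : S -> A := chi \o tr (fun i => - b i).
HB.instance Definition _ := GRing.RMorphism.copy translate (chi \o tr (fun i => - b i)).

Lemma translate_tr g : translate (tr b g) = chi g.
Proof. by rewrite /translate /= (trK (a := b)). Qed.

Lemma local_presentation_translate :
  local_presentation chi f -> local_presentation translate (tr b f).
Proof.
have trK' g : tr b (tr (fun i => - b i) g) = g by apply: trK => i; rewrite opprK.
move=> [[[c0 cl] c1 cp] hfrac ker chif]; split.
- split=> [||u v].
  + split=> [|u v w]; first by rewrite /center rmorph0 -(rmorph0 chi).
    rewrite /center /= /translate /= rmorphD rmorphM /= => h1 h2.
    exact: (cl _ _ _ h1 h2).
  + by rewrite /center rmorph1 -(rmorph1 chi).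
  + by rewrite /center /= /translate /= rmorphM; exact: cp.
- move=> a; have [g [h [nh e]]] := hfrac a.
  by exists (tr b g), (tr b h); rewrite /center /= !translate_tr.
- move=> g /ker[h [d [nh e]]]; exists (tr b h), (tr b d).
  rewrite /center /= translate_tr; split=> //.
  by rewrite -rmorphM -e rmorphM /= trK'.
by rewrite /= translate_tr.
Qed.

End Translation.

(** In a chart around [xi] the multiplicity is at most the order of the dehomogenized equation. The
    order passes to the cone through a form [G] with ['X_i0 ^+ D * f = 'X_i0 ^+ delta * G], because
    ['X_i0] does not vanish at [xi]. *)
Lemma rat_multiplicity_mult_ge n delta (f : {mpoly rat[n.+1]}) (xi : ratpoint n) :
  (1 < n)%N -> f \is delta.-homog -> f != 0 ->
  mult_ge (rat_coord xi) (rat_multiplicity f xi) f.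
Proof.
case: n f xi => [//|n] f xi n_gt0 hf f0.
rewrite /rat_multiplicity; case: {-}_ / idP => [fx|_]; last exact: ord_ge0.
set x := HyPoint fx; rewrite /multiplicity.
(* If no integer satisfies [is_multiplicity], then [xget] returns its default 0 and the claim holds
   trivially. *)
have [[mu hmu]|nmu] := pselect (exists mu, is_multiplicity (stalk x) mu); last first.
  by rewrite xgetPN ?(fun H => H) => [|mu hmu]; [exact: ord_ge0 | apply: nmu; exists mu].
have {hmu} hmu := xgetPex 0%N (ex_intro _ mu hmu).
set m := xget _ _ in hmu *.
have [i0 hi0] := point_relevant x.
have xi0 : rat_coord xi i0 != 0.
  apply: contraNneq hi0 => e; rewrite [_ \in _](vanishing_homogE xi (d := 1)) ?mevalXU ?e //.
  by rewrite dhomogX /= mdeg1.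
pose b i := rat_coord xi (lift i0 i) / rat_coord xi i0.
pose dh := mmap (@mpolyC n.+1 rat) (dehom_coord rat i0).
have hpres := local_presentation_translate b (chart_presentation hf hi0).
have center_b g : center (chart hi0) g <-> g.@[b] = 0.
  have [D /(_ D (leqnn _))[G hG <-]] := homogenize i0 g.
  rewrite (chart_center hi0 hG) [_ \in _](vanishing_homogE xi hG).
  rewrite (@meval_dehom _ _ _ _ (fun j => (rat_coord xi i0)^-1 * rat_coord xi j)); first last.
  - by move=> i; rewrite /b mulrC.
  - by rewrite mulVf.
  rewrite (meval_homog _ _ hG); split=> [/eqP ->|/eqP]; first by rewrite mulr0.
  by rewrite mulf_eq0 expf_eq0 invr_eq0 (negPf xi0) andbF.
have center0 g : center (translate (chart hi0) b) g <-> g@_0%MM = 0.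
  rewrite /center /= /translate /= -/(center _ _) center_b -mult_ge1P /mult_ge.
  by rewrite trK ?ord_ge1P // => i; rewrite opprK.
pose f' := mmap (@mpolyC n.+1 rat) (fun i => 'X_i + (b i)%:MP) (dh f).
have dhf0 : dh f != 0.
  apply: contraNneq f0 => e; apply/eqP.
  by apply: (dehom_inj (i0 := i0) hf); rewrite ?rpred0 // rmorph0.
have f'0 : f' != 0.
  apply: contraNneq dhf0 => e.
  by rewrite -[dh f](trK (a := b) (b := fun i => - b i)) // -/f' e rmorph0.
have [mu0 [ord1 ord2]] := exact_order f'0.
have mu0_gt0 : (0 < mu0)%N.
  rewrite lt0n; apply: contra_notN ord2 => /eqP ->.
  by apply/mult_ge1P/center_b/(chart_center hi0 hf).
have le_m : (m <= mu0)%N by exact: (is_multiplicity_le hpres center0 ord1 ord2) hmu.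
have f_mult : mult_ge b m (dh f) := ord_ge_le le_m ord1.
have [D /(_ D (leqnn _))[G [hG eG hGm]]] := exists_homogenization i0 f_mult.
have {}hGm : mult_ge (rat_coord xi) m G.
  by apply: hGm => i; rewrite /b divfK.
have hX d : 'X_i0 ^+ d \is [in rat[n.+2], d.-homog] by exact: (dhomogX_pow i0 d).
have fG : 'X_i0 ^+ D * f = 'X_i0 ^+ delta * G.
  apply: (dehom_inj (i0 := i0) (dhomogM (hX D) hf)).
    by rewrite addnC; exact: dhomogM.
  by rewrite !rmorphM !rmorphXn /= dehomX0 !expr1n !mul1r eG.
apply: (@ord_ge_mulr _ _ 0 m
  (mmap (@mpolyC _ rat) (fun i => 'X_i + (rat_coord xi i)%:MP) ('X_i0 ^+ D))).
- exact: ord_ge0.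
- move=> /mult_ge1P; rewrite rmorphXn /= mevalXU => /eqP.
  by rewrite expf_eq0 (negPf xi0) andbF.
by rewrite -rmorphM fG add0n; exact: mult_geMl.
Qed.

(** * Choice of the system of parameters *)

Section PointOfPrime.
Variables (n : nat) (P : {mpoly rat[n.+1]} -> Prop).
Hypotheses (hP : homog_prime P) (rel : relevant P).

Definition prime_pred : {pred {mpoly rat[n.+1]}} := fun p => `[< P p >].

Fact prime_pred_closed : idealr_closed prime_pred.
Proof.
have [[[P0 Pl] nP1 _] _] := hP; split.
- exact/asboolP.
- exact/asboolP.
- by move=> a u v /asboolP hu /asboolP hv; apply/asboolP; exact: Pl.
Qed.

Fact prime_pred_prime : prime_idealr_closed prime_pred.
Proof.
have [[_ _ pP] _] := hP.
by move=> u v /asboolP /pP[] h; apply/orP; [left | right]; apply/asboolP.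
Qed.

HB.instance Definition _ :=
  isIdealr.Build {mpoly rat[n.+1]} prime_pred prime_pred_closed.
HB.instance Definition _ :=
  isPrimeIdealrClosed.Build {mpoly rat[n.+1]} prime_pred prime_pred_prime.

Fact prime_pred_homog g : g \in prime_pred -> forall d, pihomog mdeg d g \in prime_pred.
Proof. by have [_ hh] := hP; move=> /asboolP hg d; apply/asboolP; exact: hh. Qed.

Fact prime_pred_relevant : exists i, 'X_i \notin prime_pred.
Proof. by have [i hi] := rel; exists i; apply/negP => /asboolP. Qed.

Definition point_of_prime : projpoint n :=
  ProjPoint prime_pred_homog prime_pred_relevant.

Lemma mem_point_of_prime p : p \in point_ideal point_of_prime <-> P p.
Proof. by split=> h; apply/asboolP. Qed.

End PointOfPrime.

Lemma homog_prime_point n (x : projpoint n) : homog_prime (fun p => p \in point_ideal x).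
Proof.
split; last by move=> p; exact: point_homog.
split=> [||a b]; last by rewrite prime_idealrM => /orP.
  split=> [|a u v hu hv]; first exact: idealr0.
  by rewrite rpredD // idealMr.
by rewrite idealr1.
Qed.

Lemma homog_chain_le (K : numFieldType) N (I : {mpoly K[N]} -> Prop) r r' :
  (r' <= r)%N -> homog_chain I r -> homog_chain I r'.
Proof.
move=> le_r [P [hP hstep]]; exists P.
by split=> i lt_i; [apply: hP | apply: hstep]; exact: leq_trans le_r.
Qed.

Definition jacobian n (f : {mpoly rat[n.+1]}) (p : {mpoly rat[n.+1]}) : Prop :=
  p = f \/ exists j, p = f^`M(j).

(** Each prime of the chain contains [f] and its derivatives, so it is a singular point by the
    Jacobian criterion. *)
Lemma homog_chain_singular n delta (f : {mpoly rat[n.+1]}) r :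
  f \is delta.-homog -> f != 0 -> homog_chain (jacobian f) r -> singular_chain f r.
Proof.
move=> hf f0 [P [hP hstep]].
(* A singular chain assigns a point to every natural number, so the indices are capped at [r]. *)
have hPm i := hP (minn i r) (geq_minr i r).
have hp i : homog_prime (P (minn i r)) by case: (hPm i).
have hr i : relevant (P (minn i r)) by case: (hPm i).
have hJ i p : jacobian f p -> P (minn i r) p by case: (hPm i) => _ _; apply.
have fx i : f \in point_ideal (point_of_prime (hp i) (hr i)).
  by apply/mem_point_of_prime/hJ; left.
exists (fun i => HyPoint (fx i)); split=> [i _|i lt_ir].
  apply: (singular_point_derivatives hf f0) => j.
  by apply/mem_point_of_prime/hJ; right; exists j.
have [sub [p [p1 p2]]] := hstep i lt_ir.
have e1 : minn i r = i by apply/minn_idPl; exact: ltnW.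
have e2 : minn i.+1 r = i.+1 by exact/minn_idPl.
split=> [q /mem_point_of_prime|h]; last apply: p2.
  by rewrite e1 => hq; apply/mem_point_of_prime; rewrite e2; exact: sub.
have /h /mem_point_of_prime : p \in point_ideal (point_of_prime (hp i.+1) (hr i.+1)).
  by apply/mem_point_of_prime; rewrite e2.
by rewrite e1.
Qed.

Lemma singular_chain_lt n (f : {mpoly rat[n.+1]}) s :
  f != 0 -> singular_chain f s -> (s < n)%N.
Proof.
move=> f0 [x [_ hx]].
apply: (@homog_chain_bound rat n (fun p => p = f) f s erefl f0).
exists (fun i p => p \in point_ideal (x i)); split=> [i _|i lt_is].
  split; first exact: homog_prime_point.
    by have [j hj] := point_relevant (x i); exists j; exact/negP.
  by move=> p ->; exact: hypoint_on.
have [sub nsub] := hx i lt_is; split=> [p|]; first exact: sub.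
have /existsNP[p /not_implyP[h1 /negP h2]] := nsub.
by exists p; split=> //; exact/negP.
Qed.

Section Sequences.
Variables (K : numFieldType) (N : nat).
Local Notation S := {mpoly K[N]}.

Definition idseq (ps : seq S) : S -> Prop :=
  foldr (fun g I => adjoin I g) (fun p => p = 0) ps.

Lemma idseq_homog ps : (forall p, p \in ps -> exists d, p \is [in K[N], d.-homog]) ->
  homog_ideal (idseq ps).
Proof.
elim: ps => [|p ps IH] h.
  split; last by move=> p -> d; rewrite pihomog0.
  by split=> // a u v -> ->; rewrite mulr0 addr0.
have [|d hd] := h p; first by rewrite inE eqxx.
by apply: (adjoin_homog _ hd); apply: IH => q qps; apply: h; rewrite inE qps orbT.
Qed.

Lemma idseq_igen M ps : size ps = M -> forall p, idseq ps p ->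
  igen (fun i : 'I_M => nth 0 ps i) p.
Proof.
move=> <- {M}; elim: ps => [|g ps IH] p /=.
  by move=> ->; exists (fun=> 0); rewrite big_ord0.
move=> [q /IH[c hc]].
exists (fun i => if unlift ord0 i is Some j then c j else q).
rewrite big_ord_recl unlift_none /= addrC.
rewrite -[LHS](subrK (q * g)) hc; congr (_ + _); apply: eq_bigr => i _.
by rewrite liftK.
Qed.

Lemma idseq_catr ps qs p : idseq qs p -> idseq (ps ++ qs) p.
Proof.
by elim: ps => [//|g ps IH] h; apply: adjoin_sub; exact: IH.
Qed.

Definition lspan (J : finType) (b : J -> S) : S -> Prop :=
  fun v => exists c : J -> K, v = \sum_j c j *: b j.

Lemma lspan_lin (J : finType) (b : J -> S) : lin_closed (lspan b).
Proof.
split=> [|a u v [c ->] [c' ->]].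
  by exists (fun=> 0); rewrite big1 // => j _; rewrite scale0r.
exists (fun j => a * c j + c' j); rewrite scaler_sumr -big_split.
by apply: eq_bigr => j _ /=; rewrite scalerDl scalerA.
Qed.

Lemma lspan_mem (J : finType) (b : J -> S) j : lspan b (b j).
Proof.
exists (fun i => (i == j)%:R); rewrite (bigD1 j) //= eqxx scale1r big1 ?addr0 //.
by move=> i /negPf ->; rewrite scale0r.
Qed.

Lemma lspan_homog (J : finType) (b : J -> S) d v : (forall j, b j \is d.-homog) ->
  lspan b v -> v \is d.-homog.
Proof. by move=> hb [c ->]; apply: rpred_sum => j _; exact: rpredZ. Qed.

(** Each general element of the span of [b] lowers the dimension by one, as long as it exceeds the
    dimension of the zeros common to [qs] and [b], which are zeros of [I]. *)
Lemma generic_sections I (qs : seq S) (J : finType) (b : J -> S) d r k :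
  (forall p, p \in qs -> exists e, p \is [in K[N], e.-homog]) ->
  (forall j, b j \is d.-homog) ->
  (forall P, homog_prime P -> relevant P -> (forall p, idseq qs p -> P p) ->
     (forall v, lspan b v -> P v) -> forall p, I p -> P p) ->
  ~ homog_chain (idseq qs) (r + k) -> ~ homog_chain I r ->
  exists ps : seq S, [/\ size ps = k, forall p, p \in ps -> lspan b p
    & ~ homog_chain (idseq (ps ++ qs)) r].
Proof.
move=> hqs hb hI; elim: k r => [|k IH] r nc nI.
  by exists [::]; rewrite addn0 in nc.
have [|nI'|ps [sps psV nps]] := IH r.+1.
- by rewrite addSnnS.
- by apply: nI; exact: homog_chain_le nI'.
have [|||||g Vg ng] := @generic_section K N (idseq (ps ++ qs)) I (lspan b) r => //.
- apply: idseq_homog => p; rewrite mem_cat => /orP[/psV /(lspan_homog hb) hp|]; last exact: hqs.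
  by exists d.
- exact: lspan_lin.
- by move=> P pP rP sP; apply: hI => // p hp; apply: sP; exact: idseq_catr.
exists (g :: ps); split=> //=; first by rewrite sps.
by move=> p; rewrite inE => /orP[/eqP ->|/psV].
Qed.

(** Without a relevant prime over the ideal, [decomposable_irrelevant] applies. *)
Lemma idseq_primary ps : (forall p, p \in ps -> exists d, p \is [in K[N], d.-homog]) ->
  ~ homog_chain (idseq ps) 0 ->
  exists M, forall p e, p \is e.-homog -> (M <= e)%N -> idseq ps p.
Proof.
move=> hps nc; have hI := idseq_homog hps; have [iI _] := hI.
have [|//|M hM] := decomposable_irrelevant (homog_ideal_decomposable hI).
  move=> P pP sP i; apply: contrapT => nPi; apply: nc.
  by exists (fun=> P); split=> // j _; split=> //; exists i.
exists M => p e /dhomogP hp le_M; rewrite [p]mpolyE big_seq.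
apply: (ideal_sum _ iI) => m mp; rewrite -mul_mpolyC.
by apply: (ideal_mull _ iI); apply: hM; rewrite (hp _ mp).
Qed.

End Sequences.

Section Degree.
Variables (K : numFieldType) (N : nat).
Local Notation S := {mpoly K[N]}.
Local Notation tr a := (mmap (@mpolyC N K) (fun i => 'X_i + (a i)%:MP)).

Lemma msize_translate (a : 'I_N -> K) (p : S) : (msize (tr a p) <= msize p)%N.
Proof.
rewrite /mmap big_seq; apply: leq_trans (msize_sum _ _ _) _.
apply/bigmax_leqP_seq => m _ mp; rewrite mul_mpolyC; apply: leq_trans (msizeZ_le _ _) _.
apply: leq_trans (msize_mdeg_lt mp); rewrite mdegE /mmap1.
elim/big_rec2 : _ => [|i q k _ hq]; first by rewrite msize1.
rewrite -addSn; apply: msizeM_leq => //.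
have h : (msize ('X_i + (a i)%:MP : S) <= 2)%N.
  apply: leq_trans (msizeD_le _ _) _; rewrite geq_max msizeX mdeg1 msizeC.
  by case: (a i != 0).
by have := msizeX_leq (m i) h; rewrite mul1n.
Qed.

(** Translation does not raise the degree, so an order above the degree forces [f] to be zero. *)
Lemma mult_ge_leq_degree (a : 'I_N -> K) mu d (f : S) :
  f \is d.-homog -> f != 0 -> mult_ge a mu f -> (mu <= d)%N.
Proof.
move=> hf f0 hmu; rewrite leqNgt; apply/negP => lt_d; case/eqP: f0.
rewrite -[f](trK (a := a) (b := fun i => - a i)) //.
suff -> : tr a f = 0 by rewrite rmorph0.
apply/mpolyP => m; rewrite mcoeff0.
have [lt_m|le_m] := ltnP (mdeg m) mu; first exact: hmu.
apply/memN_msupp_eq0/msize_mdeg_ge; apply: leq_trans (msize_translate _ _) _.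
by apply: leq_trans (dhomog_msize_leq hf) _; exact: leq_trans le_m.
Qed.

Lemma msize_prod_XsubC (c : nat -> K) (i : 'I_N) q :
  (msize (\prod_(k < q) ('X_i - (c k)%:MP) - 'X_i ^+ q : S) <= q)%N.
Proof.
elim: q => [|q IH]; first by rewrite big_ord0 expr0 subrr msize0.
have hX : (msize ('X_i : S) <= 2)%N by rewrite msizeX mdeg1.
have hc : (msize ((c q)%:MP : S) <= 1)%N by rewrite msizeC; case: (c q != 0).
have hl : (msize ('X_i - (c q)%:MP : S) <= 2)%N.
  by apply: leq_trans (msizeD_le _ _) _; rewrite geq_max hX mmeasureN (leq_trans hc).
rewrite big_ord_recr exprSr /=.
set p := \prod_(_ < q) _ in IH *.
have -> : p * ('X_i - (c q)%:MP) - 'X_i ^+ q * 'X_i =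
  (p - 'X_i ^+ q) * ('X_i - (c q)%:MP) - (c q)%:MP * 'X_i ^+ q by ring.
apply: leq_trans (msizeD_le _ _) _; rewrite geq_max mmeasureN; apply/andP; split.
  by rewrite -addn1; exact: msizeM_leq.
rewrite -add1n; apply: msizeM_leq => //.
by have := msizeX_leq q hX; rewrite mul1n.
Qed.

End Degree.

Lemma prod_nseq (k a : nat) : (\prod_(x <- nseq k a) x = a ^ k)%N.
Proof. by elim: k => [|k IH]; rewrite ?big_nil //= big_cons IH expnS. Qed.

Lemma prod_cat3 (a c x y z : nat) :
  (\prod_(t <- nseq a x ++ nseq c y ++ [:: z]) t = x ^ a * (y ^ c * z))%N.
Proof. by rewrite !big_cat /= !prod_nseq big_seq1. Qed.

Lemma nth_cat3 (T : Type) (x0 : T) (u v : seq T) (w : T) a c i :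
  size u = a -> size v = c -> (i <= a + c)%N ->
  [/\ (i < a)%N -> nth x0 (u ++ v ++ [:: w]) i = nth x0 u i,
      (a <= i < a + c)%N -> nth x0 (u ++ v ++ [:: w]) i = nth x0 v (i - a)
    & i = (a + c)%N -> nth x0 (u ++ v ++ [:: w]) i = w].
Proof.
move=> <- <- le_i; rewrite !nth_cat; split=> [->//|/andP[le lt]|->].
  by rewrite ltnNge le /= ltn_subLR // lt.
by rewrite ltnNge leq_addr /= addKn ltnn subnn.
Qed.

Lemma prod_nth (s : seq nat) M : size s = M -> (\prod_(i < M) nth 0%N s i = \prod_(x <- s) x)%N.
Proof. by move=> <-; rewrite (big_nth 0%N) big_mkord. Qed.

(** * Counting the points of bounded height *)

Section Counting.
Variables (n delta s : nat) (f : {mpoly rat[n.+1]}) (b : nat).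
Hypothesis n_gt1 : (1 < n)%N.
Hypothesis f_neq0 : f != 0.
Hypothesis f_homog : f \is delta.-homog.
Hypothesis sing : singular_dim f s.
Hypothesis delta_gt0 : (0 < delta)%N.
Local Notation S := {mpoly rat[n.+1]}.
Local Notation k := (n - s - 1)%N.
Local Notation q := b.*2.+1.
Local Notation mu := (rat_multiplicity f).

Let lt_sn : (s < n)%N. Proof. by case: sing => h _; exact: singular_chain_lt h. Qed.

(** The zero set of [f] has dimension less than [n = s.+1 + k]. First [k] combinations of
    derivatives cut it down to dimension at most [s], that of the singular locus; then [s.+1]
    combinations of the ['X_j ^+ q], which have no common projective zero, make it empty. *)
Lemma system_of_parameters : exists (gs : seq S) (hs : seq S) M,
  [/\ size gs = k, size hs = s.+1,
      forall p, p \in gs -> lspan (fun j => f^`M(j)) p,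
      forall p, p \in hs -> lspan (fun j : 'I_n.+1 => 'X_j ^+ q) p &
      forall p e, p \is e.-homog -> (M <= e)%N ->
        igen (fun i : 'I_n.+1 => nth 0 (hs ++ gs ++ [:: f]) i) p].
Proof.
have [_ nsing] := sing.
have f_mem p : p \in [:: f] -> exists e, p \is [in rat[n.+1], e.-homog].
  by rewrite inE => /eqP ->; exists delta.
have df_homog j : f^`M(j) \is delta.-1.-homog by exact: dhomog_mderiv.
have Xq_homog (j : 'I_n.+1) : 'X_j ^+ q \is [in rat[n.+1], q.-homog].
  by have := @dhomogMn n.+1 rat mdeg 1 'X_j q; rewrite mul1n dhomogX /= mdeg1; apply.
have f_idseq : idseq [:: f] f.
  by apply: adjoin_mem; split=> // a u v -> ->; rewrite mulr0 addr0.
have nf : ~ homog_chain (idseq [:: f]) (s.+1 + k).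
  have -> : (s.+1 + k = n)%N by move: lt_sn; lia.
  by move/(homog_chain_bound f_idseq f_neq0); rewrite ltnn.
have nJ : ~ homog_chain (jacobian f) s.+1.
  by move/(homog_chain_singular f_homog f_neq0).
have hJ P : homog_prime P -> relevant P -> (forall p, idseq [:: f] p -> P p) ->
    (forall v, lspan (fun j => f^`M(j)) v -> P v) -> forall p, jacobian f p -> P p.
  move=> pP rP sP VP p [->|[j ->]]; first exact: sP.
  exact: (VP _ (lspan_mem _ _)).
have [gs [sgs gsV ngs]] := generic_sections f_mem df_homog hJ nf nJ.
have gs_mem p : p \in gs ++ [:: f] -> exists e, p \is [in rat[n.+1], e.-homog].
  rewrite mem_cat => /orP[/gsV /(lspan_homog df_homog) h|]; last exact: f_mem.
  by exists delta.-1.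
have nT : ~ homog_chain (fun _ : S => True) 0.
  by move=> [P [/(_ 0%N isT)[[[_ nP1 _] _] _ hT] _]]; apply: nP1; exact: hT.
have hT P : homog_prime P -> relevant P -> (forall p, idseq (gs ++ [:: f]) p -> P p) ->
    (forall v, lspan (fun j : 'I_n.+1 => 'X_j ^+ q) v -> P v) -> forall p, True -> P p.
  move=> [[_ nP1 pP] _] [i nPi] _ VP; case: nPi.
  have : P ('X_i ^+ q) by apply: VP; exact: (lspan_mem (fun j => 'X_j ^+ q) i).
  by elim: (q) => [|m IH]; rewrite ?expr0 // exprS => /pP[].
have [hs [shs hsV nhs]] := generic_sections (r := 0) (k := s.+1) gs_mem Xq_homog hT ngs nT.
have hs_mem p : p \in hs ++ gs ++ [:: f] -> exists e, p \is [in rat[n.+1], e.-homog].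
  rewrite mem_cat => /orP[/hsV /(lspan_homog Xq_homog) h|]; last exact: gs_mem.
  by exists q.
have [M hM] := idseq_primary hs_mem nhs.
exists gs, hs, M; split=> // p e hp le_M; apply: idseq_igen (hM p e hp le_M).
by rewrite !size_cat sgs shs /=; move: lt_sn; lia.
Qed.

Let grid (j : 'I_n.+1) : S := \prod_(i < q) ('X_j - ((i%:Z - b%:Z)%:~R)%:MP).

Lemma grid_top j : (msize (grid j - 'X_j ^+ q) <= q)%N.
Proof. exact: (msize_prod_XsubC (fun i => (i%:Z - b%:Z)%:~R)). Qed.

Lemma grid_vanish (xi : ratpoint n) j : (height xi <= b)%N -> mult_ge (rat_coord xi) 1 (grid j).
Proof.
move=> hb; have hj : (`|xi j| <= b)%N by apply: leq_trans hb; exact: (leq_bigmax j).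
have lt_q : (absz (xi j + b%:Z)%R < q)%N.
  by move: hj; move: (xi j) => z; lia.
rewrite /grid (bigD1 (Ordinal lt_q)) //=; apply: mult_geMr.
have -> : (absz (xi j + b%:Z)%R)%:Z - b%:Z = xi j.
  by move: hj; move: (xi j) => z; lia.
exact: mult_geXsubC.
Qed.

(** The points with a nonzero summand, for which all the multiplicities used in the Bezout
    inequality are positive. For [k = 0] the factor [0 ^ 0 = 1] keeps the points of multiplicity
    one. *)
Let good (xi : ratpoint n) := (0 < mu xi)%N && ((k == 0%N) || (1 < mu xi)%N).

Lemma leq_sum_multiplicities (pts : seq (ratpoint n)) : uniq pts ->
  (forall xi, xi \in pts -> (height xi <= b)%N) ->
  (\sum_(xi <- pts) mu xi * (mu xi).-1 ^ k
   <= (n.+1 * n.+2) ^ n.+1 * (q ^ s.+1 * (delta.-1 ^ k * delta)))%N.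
Proof.
move=> pts_uniq pts_height.
rewrite (bigID good) /= [X in (_ + X)%N]big1 ?addn0 => [|xi]; last first.
  rewrite /good; case: (mu xi) => [|[|m]] //=; last by rewrite orbT.
  by rewrite orbF => k0; rewrite exp0n ?muln0 // lt0n.
rewrite -big_filter; set P := [seq _ <- _ | _].
have P_uniq : uniq P by exact: filter_uniq.
have hP xi : xi \in P -> good xi /\ (height xi <= b)%N.
  by rewrite mem_filter => /andP[h1 /pts_height].
case: P P_uniq hP => [|x0 P'] P_uniq hP; first by rewrite big_nil.
set P := x0 :: P' in P_uniq hP *.
(* The degrees in the Bezout inequality must be positive. If [k] is nonzero, the good point [x0] has
   multiplicity at least 2, which [delta] bounds from above. *)
have delta1 : (k == 0%N) || (0 < delta.-1)%N.
  have [/andP[_ /orP[->//|lt1]] _] := hP x0 (mem_head _ _).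
  have := mult_ge_leq_degree f_homog f_neq0
    (rat_multiplicity_mult_ge (xi := x0) n_gt1 f_homog f_neq0).
  by move/(leq_trans lt1); case: (delta) => [|[|d]] //; rewrite orbT.
have [gs [hs [M [sgs shs gsV hsV hM]]]] := system_of_parameters.
(* The same combination with each ['X_j ^+ q] replaced by [grid j] has the same leading form and
   vanishes at all points of height at most [b]. *)
have /choice[lift_h hlift] : forall h : S, exists h' : S,
    lspan (fun j : 'I_n.+1 => 'X_j ^+ q) h -> (msize (h' - h) <= q)%N /\
      forall xi : ratpoint n, (height xi <= b)%N -> mult_ge (rat_coord xi) 1 h'.
  move=> h; have [[c ->]|nV] :=
    pselect (lspan (fun j : 'I_n.+1 => 'X_j ^+ q) h); last by exists 0.
  exists (\sum_j c j *: grid j) => _; split=> [|xi hxi].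
    rewrite -sumrB; apply: leq_trans (msize_sum _ _ _) _; apply/bigmax_leqP => j _.
    by rewrite -scalerBr; apply: leq_trans (msizeZ_le _ _) _; exact: grid_top.
  apply: lin_closed_sum => [|j _]; first exact: mult_ge_lin.
  by apply: (lin_closedZ _ (mult_ge_lin _ _)); exact: grid_vanish.
pose th := hs ++ gs ++ [:: f]; pose G := map lift_h hs ++ gs ++ [:: f].
pose ds := nseq s.+1 q ++ nseq k delta.-1 ++ [:: delta].
pose ms xi := nseq s.+1 1%N ++ nseq k (mu xi).-1 ++ [:: mu xi].
have size_ds : size ds = n.+1.
  by rewrite /ds !size_cat !size_nseq /=; move: lt_sn; lia.
have size_ms xi : size (ms xi) = n.+1.
  by rewrite /ms !size_cat !size_nseq /=; move: lt_sn; lia.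
pose a (i : 'I_(size P)) := rat_coord (tnth (in_tuple P) i).
have tnthP i : good (tnth (in_tuple P) i) /\ (height (tnth (in_tuple P) i) <= b)%N.
  by apply: hP; exact: mem_tnth.
(* The four sequences are indexed alike: forms of degree [q], then linear
   combinations of partial derivatives, then [f]. *)
have cases (i : 'I_n.+1) : [\/ exists h, [/\ lspan (fun j : 'I_n.+1 => 'X_j ^+ q) h,
      nth 0 th i = h, nth 0 G i = lift_h h, nth 0%N ds i = q
      & forall xi, nth 0%N (ms xi) i = 1%N],
    exists g, [/\ lspan (fun j => f^`M(j)) g,
      nth 0 th i = g, nth 0 G i = g, (k != 0%N) /\ nth 0%N ds i = delta.-1
      & forall xi, nth 0%N (ms xi) i = (mu xi).-1]
  | [/\ nth 0 th i = f, nth 0 G i = f, nth 0%N ds i = delta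
      & forall xi, nth 0%N (ms xi) i = mu xi]].
  have sk : (s.+1 + k = n)%N by move: lt_sn; lia.
  have le_i : (i <= s.+1 + k)%N by rewrite sk -ltnS.
  have [th1 th2 th3] := nth_cat3 0 f shs sgs le_i.
  have [G1 G2 G3] := nth_cat3 0 f (etrans (size_map lift_h hs) shs) sgs le_i.
  have [d1 d2 d3] := nth_cat3 0%N delta (size_nseq s.+1 q) (size_nseq k delta.-1) le_i.
  have hm xi := nth_cat3 0%N (mu xi) (size_nseq s.+1 1%N) (size_nseq k (mu xi).-1) le_i.
  have [lt_i|ge_i] := ltnP i s.+1.
    apply: Or31; exists (nth 0 hs i); split; first by apply: hsV; rewrite mem_nth ?shs.
    - exact: th1.
    - by rewrite [LHS]G1 // (nth_map 0) ?shs.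
    - by rewrite [LHS]d1 // nth_nseq lt_i.
    - by move=> xi; have [m1 _ _] := hm xi; rewrite [LHS]m1 // nth_nseq lt_i.
  have [lt_k|ge_k] := ltnP i (s.+1 + k).
    have range : (s.+1 <= i < s.+1 + k)%N by rewrite ge_i.
    have lt_ik : (i - s.+1 < k)%N by rewrite ltn_subLR.
    apply: Or32; exists (nth 0 gs (i - s.+1)); split.
    - by apply: gsV; rewrite mem_nth ?sgs.
    - exact: th2.
    - exact: G2.
    - split; first by rewrite -lt0n; exact: leq_ltn_trans lt_ik.
      by rewrite [LHS]d2 // nth_nseq lt_ik.
    - by move=> xi; have [_ m2 _] := hm xi; rewrite [LHS]m2 // nth_nseq lt_ik.
  have ei : nat_of_ord i = (s.+1 + k)%N by apply/eqP; rewrite eqn_leq le_i.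
  apply: Or33; split; [exact: th3 | exact: G3 | exact: d3 |].
  by move=> xi; case: (hm xi) => _ _; apply.
have := @bezout_multiplicities rat n.+1 _ a _ (fun i => nth 0%N ds i) (fun i => nth 0 th i)
  (fun i => nth 0 G i) M (fun x i => nth 0%N (ms (tnth (in_tuple P) x)) i).
rewrite (prod_nth size_ds) prod_cat3.
have -> : (\sum_(x < size P) \prod_(i < n.+1) nth 0%N (ms (tnth (in_tuple P) x)) i =
   \sum_(xi <- P) mu xi * (mu xi).-1 ^ k)%N.
  rewrite [RHS]big_tnth; apply: eq_bigr => x _.
  rewrite (prod_nth (size_ms _)) prod_cat3 exp1n mul1n.
  exact: mulnC.
apply => //.
- move=> x y nxy; apply: contrapT => same; case/negP: nxy.
  suff /eqP : tnth (in_tuple P) x = tnth (in_tuple P) y.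
    by rewrite !(tnth_nth x0) nth_uniq.
  apply/val_inj/ffunP => j; apply: contrapT => nj; apply: same; exists j.
  by apply/eqP => /eqP; rewrite /a /rat_coord eqr_int => /eqP.
- move=> i; have [[h [hV -> _ -> _]]|[g [gV -> _ [_ ->] _]]|[-> _ -> _]] := cases i => //.
    apply: (lspan_homog _ hV) => j.
    by have := @dhomogMn n.+1 rat mdeg 1 'X_j q; rewrite mul1n dhomogX /= mdeg1; apply.
  by apply: (lspan_homog _ gV) => j; exact: dhomog_mderiv.
- move=> i; have [[h [hV -> -> -> _]]|[g [_ -> -> _ _]]|[-> -> _ _]] := cases i.
  + by have [] := hlift h hV.
  + by rewrite subrr msize0.
  + by rewrite subrr msize0.
- move=> i; have [[h [_ _ _ -> _]]|[g [_ _ _ [k0 ->] _]]|[_ _ -> _]] := cases i => //.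
  by move: delta1; rewrite (negPf k0).
- move=> x i; have [/andP[mu_gt0 mu_gt1] _] := tnthP x.
  have [[h [_ _ _ _ ->]]|[g [_ _ _ [k0 _] ->]]|[_ _ _ ->]] := cases i => //.
  by move: mu_gt1; rewrite (negPf k0) /=; case: (mu _) => [|[]].
move=> x i; have [_ hx] := tnthP x.
have fx := rat_multiplicity_mult_ge (xi := tnth (in_tuple P) x) n_gt1 f_homog f_neq0.
have [[h [hV _ -> _ ->]]|[g [[c ->] _ -> _ ->]]|[_ -> _ ->]] := cases i => //.
  by have [_] := hlift h hV; apply.
apply: lin_closed_sum => [|j _]; first exact: mult_ge_lin.
apply: (lin_closedZ _ (mult_ge_lin _ _)).
by case: (mu _) fx => [_|m]; [exact: ord_ge0 | exact: mult_ge_deriv].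
Qed.

End Counting.

Theorem corollary1p2 (R : realType) (n : nat) (n_ge2 : (2 <= n)%N) :
  exists C : R, 0 <= C /\
    forall (delta s : nat) (f : {mpoly rat[n.+1]}) (B : R),
      (1 <= delta)%N ->
      f != 0 -> f \is delta.-homog ->
      reduced_hypersurface f ->
      (exists x : hypoint f, singular_point x) ->
      singular_dim f s ->
      1 <= B ->
      \sum_(xi \in bounded_points f B)
         ((rat_multiplicity f xi)%:R : R)
           * ((rat_multiplicity f xi)%:R - 1) ^+ (n - s - 1)
      <= C * delta%:R ^+ (n - s) * Num.max B (delta%:R - 1) ^+ s.+1.
Proof.
(* The first factor is the Bezout constant in [n.+1] variables; [3 ^ n] absorbs the factor
   [3 ^ s.+1] that comes from [2 b + 1 <= 3 X], where [X] is the maximum in the bound. *)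
exists ((n.+1 * n.+2) ^ n.+1 * 3 ^ n)%:R; split; first exact: ler0n.
move=> delta s f B delta_gt0 f_neq0 f_homog _ _ sing B_ge1.
have lt_sn : (s < n)%N by case: sing => h _; exact: singular_chain_lt h.
pose k := (n - s - 1)%N; pose b := Num.truncn B.
have B_ge0 : 0 <= B by exact: le_trans B_ge1.
rewrite (fsbig_finite _ _ (finite_bounded_points f B)) /=.
set pts := fset_set _.
have pts_height xi : xi \in pts -> (height xi <= b)%N.
  rewrite in_fset_set; last exact: finite_bounded_points.
  by rewrite inE => -[_ h]; rewrite truncn_ge_nat.
have := leq_sum_multiplicities n_ge2 f_neq0 f_homog sing delta_gt0 (fset_uniq pts) pts_height.
rewrite -(ler_nat R) natr_sum -/k => h.
rewrite (eq_bigr (fun xi => (rat_multiplicity f xi * (rat_multiplicity f xi).-1 ^ k)%:R));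
  last first.
  (* At multiplicity 0 the truncated predecessor differs from the real difference [-1], but both
     products vanish. *)
  move=> xi _; rewrite natrM natrX; case: (rat_multiplicity f xi) => [|m].
    by rewrite !mul0r.
  by congr (_ * _ ^+ _); rewrite /= -natr1 addrK.
apply: le_trans h _; rewrite natrM (natrM _ _ (3 ^ n)%N) -!mulrA ler_wpM2l ?ler0n //.
set X := Num.max _ _.
have le_BX : B <= X by rewrite le_max lexx.
have X_ge0 : 0 <= X by exact: le_trans le_BX.
(* Here [b <= B <= X], and the remaining 1 is at most [B]. *)
have le_q : (b.*2.+1)%:R <= 3 * X.
  have le_b : b%:R <= B by rewrite truncn_le.
  by rewrite -addn1 natrD -muln2 natrM; lra.
have le_delta : (delta.-1 ^ k * delta)%:R <= delta%:R ^+ (n - s) :> R.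
  have -> : (n - s = k.+1)%N by move: lt_sn; rewrite /k; lia.
  rewrite -natrX ler_nat expnSr leq_mul //.
  by case: (posnP k) => [->//|k_gt0]; rewrite leq_exp2r // leq_pred.
have le_3 : (3 : R) ^+ s.+1 <= (3 ^ n)%:R by rewrite -natrX ler_nat leq_pexp2l.
rewrite natrM natrX [leRHS]mulrCA [leRHS]mulrC ler_pM ?exprn_ge0 ?ler0n //.
apply: (@le_trans _ _ ((3 * X) ^+ s.+1)).
  by rewrite lerXn2r ?nnegrE ?ler0n // mulr_ge0 // ler0n.
by rewrite exprMn; apply: ler_wpM2r => //; exact: exprn_ge0.
Qed.
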